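(* There is an algorithm which, given a finite poset $\mathcal P$ on $\{1,\dots,N\}$, a vector $\vec n=(n_1,\dots,n_N)$ of positive integers and matrices $A,B\in M_{\mathcal P,\vec n}(\mathbb Q)$, decides whether $A$ and $B$ are $GL_{\mathcal P,\vec n}(\mathbb Z)$-equivalent; and there is an algorithm which, given the same data, decides whether $A$ and $B$ are $SL_{\mathcal P,\vec n}(\mathbb Z)$-equivalent.
   Context: $(\mathcal P,\preceq)$ is a finite poset with $\mathcal P=\{1,\dots,N\}$, labelled so that $i\preceq j$ implies $i\le j$. Put $|\vec n|=n_1+\cdots+n_N$. For a commutative ring $R$ with unit, $M_{\mathcal P,\vec n}(R)$ is the subalgebra of $M_{|\vec n|}(R)$ consisting of the matrices $M$ with $N\times N$ block form $(M_{i,j})_{1\le i,j\le N}$, where $M_{i,j}$ is an $n_i\times n_j$ matrix over $R$, such that $M_{i,j}\neq 0$ implies $i\preceq j$. $GL_{\mathcal P,\vec n}(R)$ is the group of units of $M_{\mathcal P,\vec n}(R)$, and $SL_{\mathcal P,\vec n}(R)$ is its subgroup of matrices $M$ for which every diagonal block $M_{i,i}$ has determinant $1$. For a subgroup $\Gamma$ of $GL_{\mathcal P,\vec n}(\mathbb Q)$ (such as $GL_{\mathcal P,\vec n}(\mathbb Z)$ or $SL_{\mathcal P,\vec n}(\mathbb Z)$), matrices $A,B\in M_{\mathcal P,\vec n}(\mathbb Q)$ are $\Gamma$-equivalent if there are $U,V\in\Gamma$ with $UAV=B$. *)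

(* Defs.v *)
From HB Require Import structures.
From mathcomp Require Import all_boot all_order all_algebra.
Set Implicit Arguments.
Unset Strict Implicit.
Unset Printing Implicit Defensive.
Import GRing.Theory.
Local Open Scope ring_scope.

(* Algorithms are partial recursive (mu-recursive) functions.  The syntax is   *)
(* untyped in the arity: a term is run on a list of natural numbers, and a     *)
(* missing argument of a projection or of the successor reads as 0.            *)

Inductive recfun : Type :=
| RZero
| RSucc
| RProj of nat
| RComp of recfun & seq recfun
| RPrec of recfun & recfun
| RMin of recfun.

(* [reval f s y] : the computation of f on the arguments s halts with value y. *)
(* RPrec f g is h with h(0,s) = f(s) and h(k+1,s) = g(k,h(k,s),s), and RMin f  *)
(* is the least k with f(k,s) = 0, all previous values being defined.          *)
Inductive reval : recfun -> seq nat -> nat -> Prop :=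
| EZero s : reval RZero s 0%N
| ESucc s : reval RSucc s (nth 0%N s 0).+1
| EProj i s : reval (RProj i) s (nth 0%N s i)
| EComp f gs s ys y :
    revals gs s ys -> reval f ys y -> reval (RComp f gs) s y
| EPrec0 f g s y : reval f s y -> reval (RPrec f g) (0%N :: s) y
| EPrecS f g k s y z :
    reval (RPrec f g) (k :: s) y -> reval g [:: k, y & s] z ->
    reval (RPrec f g) (k.+1 :: s) z
| EMin f s k (y : nat -> nat) :
    (forall i, (i < k)%N -> reval f (i :: s) (y i).+1) ->
    reval f (k :: s) 0%N -> reval (RMin f) s k
with revals : seq recfun -> seq nat -> seq nat -> Prop :=
| ENil s : revals [::] s [::]
| ECons g gs s y ys :
    reval g s y -> revals gs s ys -> revals (g :: gs) s (y :: ys).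

Scheme reval_mut := Minimality for reval Sort Prop
  with revals_mut := Minimality for revals Sort Prop.

Lemma reval_inj f s y z : reval f s y -> reval f s z -> y = z.
Proof.
move=> H; move: z; move: f s y H.
apply: (@reval_mut (fun f s y => forall z, reval f s z -> y = z)
  (fun gs s ys => forall zs, revals gs s zs -> ys = zs))
  => [s|s|i s|f gs s ys y _ IHs _ IH|f g s y _ IH|f g k s y z _ IH1 _ IH2|
      f s k y _ IHlt _ IHk|s|g gs s y ys _ IH _ IHs] z' H.
- by inversion H.
- by inversion H.
- by inversion H.
- inversion H as [| | |? ? ? ys' ? Hs Hf| | |]; subst.
  by rewrite -(IHs _ Hs) in Hf; apply: IH.
- by inversion H; subst; apply: IH.
- inversion H as [| | | | |? ? ? ? y' ? H1 H2|]; subst.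
  by rewrite -(IH1 _ H1) in H2; apply: IH2.
- inversion H as [| | | | | |? ? ? y' Hlt Hk]; subst.
  case: (ltngtP k z') => // ltk.
  + by have := IHk _ (Hlt _ ltk).
  + by have := IHlt _ ltk _ Hk.
- by inversion H.
- inversion H as [|? ? ? y' ys' H1 H2]; subst.
  by rewrite (IH _ H1) (IHs _ H2).
Qed.

(* [f] halts on the input word [w], and answers 1 or 0 according to whether P  *)
(* holds; words are passed to f through their Goedel number.                   *)
Definition decides_at (f : recfun) (w : seq nat) (P : Prop) : Prop :=
  exists b : bool, reval f [:: CodeSeq.code w] b /\ (b <-> P).

Definition labelled_poset (N : nat) (le : rel 'I_N) : Prop :=
  [/\ reflexive le, antisymmetric le, transitive le
    & forall i j : 'I_N, le i j -> (i <= j)%N].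

Section PosetMatrices.
Variables (N : nat) (le : rel 'I_N) (n : 'I_N -> nat).

Definition inMP (R : comPzRingType) (M : 'M[R]_(\sum_i n i)) : Prop :=
  forall i j : 'I_N, submxblock M i j <> 0 -> le i j.

Definition inGLP (R : comPzRingType) (M : 'M[R]_(\sum_i n i)) : Prop :=
  inMP M /\ exists M', [/\ inMP M', M *m M' = 1%:M & M' *m M = 1%:M].

Definition inSLP (R : comPzRingType) (M : 'M[R]_(\sum_i n i)) : Prop :=
  inGLP M /\ forall i : 'I_N, \det (submxblock M i i) = 1.

Definition mx_of_int (M : 'M[int]_(\sum_i n i)) : 'M[rat]_(\sum_i n i) :=
  map_mx intr M.

Definition GLPZ (M : 'M[rat]_(\sum_i n i)) : Prop :=
  exists2 M0 : 'M[int]_(\sum_i n i), inGLP M0 & M = mx_of_int M0.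

Definition SLPZ (M : 'M[rat]_(\sum_i n i)) : Prop :=
  exists2 M0 : 'M[int]_(\sum_i n i), inSLP M0 & M = mx_of_int M0.

Definition mx_equivalent (Gamma : 'M[rat]_(\sum_i n i) -> Prop)
    (A B : 'M[rat]_(\sum_i n i)) : Prop :=
  exists U V, [/\ Gamma U, Gamma V & U *m A *m V = B].

(* The input word: N, the N * N truth values of the order, the block sizes,    *)
(* then the entries of A and of B in row-major order, each entry being given   *)
(* by its reduced numerator and denominator.                                   *)

Definition int_code (z : int) : nat :=
  match z with Posz k => k.*2 | Negz k => k.*2.+1 end.

Definition rat_word (q : rat) : seq nat :=
  [:: int_code (numq q); `|denq q|%N].

Definition mx_word (p q : nat) (M : 'M[rat]_(p, q)) : seq nat :=
  flatten [seq rat_word (M i j) | i <- enum 'I_p, j <- enum 'I_q].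

Definition input_word (A B : 'M[rat]_(\sum_i n i)) : seq nat :=
  N :: [seq nat_of_bool (le i j) | i <- enum 'I_N, j <- enum 'I_N]
    ++ [seq n i | i <- enum 'I_N] ++ mx_word A ++ mx_word B.

End PosetMatrices.

Arguments inMP {N} le {n R} M.
Arguments inGLP {N} le {n R} M.
Arguments inSLP {N} le {n R} M.
Arguments GLPZ {N} le n M.
Arguments SLPZ {N} le n M.
Arguments input_word {N} le {n} A B.

(* Main.v *)
(* Scaling clears denominators, so let A and B be integral.  If they are      *)
(* equivalent then U A = B W with U and W = V^-1 invertible over Z; the pair   *)
(* (U, W) is an isomorphism between two objects of the category of matrices    *)
(* with morphisms {x of poset shape | x A = B x}.  The theorem follows from a  *)
(* computable bound on the entries of some isomorphism with the same block     *)
(* determinants, since then all bounded candidates can be tried.               *)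
(*                                                                            *)
(* For the bound, divide Hom(A, B) by the radical of the trace form: it is     *)
(* nilpotent, hence invisible to invertibility and to determinants, and what   *)
(* remains is a lattice of bounded rank over an order E with nondegenerate     *)
(* trace form, whose Gram matrix provides a Casimir tensor.  An isomorphism g  *)
(* of E-lattices is joined to the identity by the forms                        *)
(* 4^(2m-j)|v|^2 + 4^j |v g|^2, whose endomorphisms keep a bounded norm.  In a *)
(* reduced basis of such a form, E acts by matrices which are bounded, except  *)
(* that they are block triangular where the successive minima have large gaps; *)
(* there, averaging by the Casimir tensor provides an automorphism, unipotent  *)
(* and hence of determinant 1, after which all is bounded.  Adjacent forms     *)
(* then have bases related by bounded matrices, and by the pigeonhole          *)
(* principle loops in this walk can be cut out, which leaves a bounded         *)
(* product.                                                                    *)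

Require Import Defs.
From HB Require Import structures.
From mathcomp Require Import all_boot all_order all_fingroup all_algebra.
From mathcomp Require Import zify ring.
From Stdlib Require Import Classical_Prop.
Set Implicit Arguments.
Unset Strict Implicit.
Unset Printing Implicit Defensive.
Import Order.TTheory GRing.Theory Num.Theory.

(** * Recursive functions *)

(** Trying all pairs of matrices finds an equivalence if there is one; the search becomes a decision
    procedure once some equivalence, if any exists, has entries below a computable function of the
    input. After multiplication by a common denominator A and B are integral, and U A V = B becomes
    U A = B W with W = V^-1. At double size, diag(U, W) is one isomorphism between the objects with
    A and B in the upper right corner, in a category whose morphisms are the integral x of a fixed
    pattern with x A = B x ([bounded_two_sided]). The heart is therefore [bounded_equivalence]: an
    isomorphism can be replaced by a bounded one with the same block determinants.

    Modulo the radical of the trace pairing, Hom(A, B) is a lattice with a bounded basis and bounded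
    structure constants ([hom_basis]), and a right module over the order E, which is End(A) modulo
    its radical. Radical endomorphisms are nilpotent ([mxrad_nilpotent]), so isomorphisms lift
    through the quotient and block determinants do not see it ([is_det_eqm]). The trace form of E is
    nondegenerate, and dual bases give a Casimir tensor ([trace_form_casimir]).

    What remains is [bounded_isomorphism], about an isomorphism g of E-lattices with bounded action.
    One walks from the form |v|^2 to the form |v g|^2 in steps of bounded ratio. Every form on the
    way has a reduced basis in which E acts by bounded matrices ([reduced_basis], [normalize_rep]),
    and consecutive bases differ by a bounded matrix up to a unipotent automorphism ([transition],
    [good_basis_step]). Only finitely many tuples of bounded action matrices exist, so a long walk
    repeats one, and the loop in between is an automorphism that can be cut out while keeping track
    of determinants ([chain_shorten]). The walk then has bounded length; its product is bounded, and
    so is the inverse of that product. *)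

Definition cf (n : nat) (F : seq nat -> nat) : Prop :=
  exists r, forall s, size s = n -> reval r s (F s).

Lemma cf_ext n F G : (forall s, size s = n -> F s = G s) -> cf n F -> cf n G.
Proof. by move=> eFG [r Hr]; exists r => s Hs; rewrite -eFG //; apply: Hr. Qed.

Lemma cf_nth n i : cf n (fun s => nth 0 s i).
Proof. by exists (RProj i) => s _; constructor. Qed.

Lemma cf_comp n (F : seq nat -> nat) (Gs : seq (seq nat -> nat)) :
  cf (size Gs) F -> (forall i, i < size Gs -> cf n (nth (fun=> 0) Gs i)) ->
  cf n (fun s => F [seq G s | G <- Gs]).
Proof.
move=> [r Hr] HG.
have [gs Hgs] : exists gs, forall s, size s = n -> revals gs s [seq G s | G <- Gs].
  elim: Gs {Hr} HG => [_|G Gs IH HG]; first by exists [::] => s _; constructor.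
  have [gs Hgs] := IH (fun i => HG i.+1); have [g Hg] := HG 0 isT.
  by exists (g :: gs) => s Hs /=; constructor; [apply: Hg|apply: Hgs].
exists (RComp r gs) => s Hs; apply: EComp (Hgs s Hs) _.
by apply: Hr; rewrite size_map.
Qed.

Lemma cf_comp1 n f G : cf 1 (fun s => f (nth 0 s 0)) -> cf n G ->
  cf n (fun s => f (G s)).
Proof.
move=> Hf HG; apply: (@cf_ext n (fun s => f (nth 0 [seq F s | F <- [:: G]] 0))) => //.
by apply: (@cf_comp n (fun s => f (nth 0 s 0))) => // -[|i].
Qed.

Lemma cf_comp2 n f G H : cf 2 (fun s => f (nth 0 s 0) (nth 0 s 1)) ->
  cf n G -> cf n H -> cf n (fun s => f (G s) (H s)).
Proof.
move=> Hf HG HH.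
by apply: (@cf_comp n (fun s => f (nth 0 s 0) (nth 0 s 1)) [:: G; H]) => // -[|[|i]].
Qed.

Lemma cf_const n c : cf n (fun=> c).
Proof.
elim: c => [|c IH]; first by exists RZero => s _; constructor.
by apply: (cf_comp1 (f := succn)) => //; exists RSucc => s _; constructor.
Qed.

(* Extending the environment by a value is a composition with projections,    *)
(* available because the length of the environment is known.                  *)
Lemma cf_cons n G F : cf n G -> cf n.+1 F -> cf n (fun s => F (G s :: s)).
Proof.
move=> HG HF.
pose Gs := G :: [seq (fun s : seq nat => nth 0 s i) | i <- iota 0 n].
have sGs : size Gs = n.+1 by rewrite /= size_map size_iota.
apply: (@cf_ext n (fun s => F [seq K s | K <- Gs])) => [s Hs|].
  by rewrite /Gs /= -map_comp /comp -Hs; congr (F (_ :: _)); exact: mkseq_nth.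
apply: cf_comp; rewrite ?sGs // => -[|i] // Hi.
by rewrite /= (nth_map 0) ?size_iota //; apply: cf_nth.
Qed.

Lemma cf_behead n F : cf n F -> cf n.+1 (fun s => F (behead s)).
Proof.
move=> HF; pose Gs := [seq (fun s : seq nat => nth 0 s i) | i <- iota 1 n].
have sGs : size Gs = n by rewrite /= size_map size_iota.
apply: (@cf_ext n.+1 (fun s => F [seq K s | K <- Gs])) => [[|x s] //= [Hs]|].
  rewrite /Gs -map_comp /comp (iotaDl 1 0) -map_comp /comp /= -Hs.
  by congr F; exact: mkseq_nth.
apply: cf_comp; rewrite ?sGs // => i Hi.
by rewrite (nth_map 0) ?size_iota //; apply: cf_nth.
Qed.

Fixpoint primrec (f : seq nat -> nat) (g : seq nat -> nat) (k : nat) (s : seq nat) :=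
  if k is k'.+1 then g [:: k', primrec f g k' s & s] else f s.

Lemma cf_primrec n f g K : cf n f -> cf n.+2 g -> cf n K ->
  cf n (fun s => primrec f g (K s) s).
Proof.
move=> [rf Hf] [rg Hg] HK.
apply: (@cf_cons n K (fun s => primrec f g (head 0 s) (behead s))) => //.
exists (RPrec rf rg) => -[|k s] //= [Hs]; elim: k => [|k IH] /=.
  by constructor; apply: Hf.
by apply: EPrecS IH _; apply: Hg; rewrite /= Hs.
Qed.

(** Primitive recursion whose step ignores the counter, which is the entry removed by [behead]. *)
Lemma cf_iter n G K F : cf n.+1 (fun s => G (head 0 s) (behead s)) -> cf n K -> cf n F ->
  cf n (fun s => iter (K s) (G^~ s) (F s)).
Proof.
move=> HG HK HF.
apply: (@cf_ext n (fun s => primrec F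
    (fun s => G (head 0 (behead s)) (behead (behead s))) (K s) s)) => [s _|].
  by elim: (K s) => //= k ->.
apply: cf_primrec => //.
exact: (@cf_behead _ (fun s => G (head 0 s) (behead s))).
Qed.

Lemma cf_succ n F : cf n F -> cf n (fun s => (F s).+1).
Proof.
by move=> HF; apply: (cf_comp1 (f := succn)) => //; exists RSucc => s _; constructor.
Qed.

Lemma cf_head n : cf n (head 0).
Proof. by apply: cf_ext (cf_nth n 0) => s _; rewrite nth0. Qed.

Lemma cf_pred n F : cf n F -> cf n (fun s => (F s).-1).
Proof.
move=> HF; apply: (cf_comp1 (f := predn)) => //.
apply: (@cf_ext 1 (fun s => primrec (fun=> 0) (head 0) (nth 0 s 0) s)) => [s _|].
  by case: (nth 0 s 0).
by apply: cf_primrec; [exact: cf_const|exact: cf_head|exact: cf_nth].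
Qed.

Lemma cf_add n F G : cf n F -> cf n G -> cf n (fun s => F s + G s).
Proof.
move=> HF HG.
apply: (@cf_ext n (fun s => iter (G s) (fun x => (fun x _ => x.+1) x s) (F s))) => [s _|].
  by rewrite addnC; elim: (G s) => //= k ->.
apply: (@cf_iter n (fun x _ => x.+1)) => //.
exact/cf_succ/cf_head.
Qed.

Lemma cf_mul n F G : cf n F -> cf n G -> cf n (fun s => F s * G s).
Proof.
move=> HF HG.
apply: (@cf_ext n (fun s => iter (G s) ((fun x s => F s + x)^~ s) 0)) => [s _|].
  by rewrite mulnC; elim: (G s) => //= k ->; rewrite mulSn.
apply: (@cf_iter n (fun x s => F s + x)) => //; last exact: cf_const.
by apply: cf_add; [exact: cf_behead|exact: cf_head].
Qed.

Lemma cf_exp n F G : cf n F -> cf n G -> cf n (fun s => F s ^ G s).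
Proof.
move=> HF HG.
apply: (@cf_ext n (fun s => iter (G s) ((fun x s => F s * x)^~ s) 1)) => [s _|].
  by elim: (G s) => //= k ->; rewrite expnS.
apply: (@cf_iter n (fun x s => F s * x)) => //; last exact: cf_const.
by apply: cf_mul; [exact: cf_behead|exact: cf_head].
Qed.

(* Bounds only need to be computable; being monotone and inflationary they     *)
(* compose without any case analysis.                                          *)
Definition good (f : nat -> nat) : Prop :=
  [/\ {homo f : x y / x <= y}, (forall x, x <= f x) & cf 1 (fun s => f (nth 0 s 0))].

Lemma good_mono f x y : good f -> x <= y -> f x <= f y.
Proof. by case=> H _ _; apply: H. Qed.

Lemma good_infl f x : good f -> x <= f x.
Proof. by case. Qed.

Lemma good_le f x y : good f -> x <= y -> x <= f y.
Proof. by move=> gf xy; apply: leq_trans xy (good_infl _ gf). Qed.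

Lemma good_cf f : good f -> cf 1 (fun s => f (nth 0 s 0)).
Proof. by case. Qed.

Lemma good_id : good (fun x => x).
Proof. by split=> //; apply: cf_nth. Qed.

Lemma good_comp f g : good f -> good g -> good (fun x => f (g x)).
Proof.
move=> gf gg; split=> [x y xy|x|].
- by apply: good_mono => //; apply: good_mono.
- by apply: leq_trans (good_infl _ gg) (good_infl _ gf).
- exact: cf_comp1 (good_cf gf) (good_cf gg).
Qed.

Lemma good_addr f c : good f -> good (fun x => f x + c).
Proof.
move=> gf; split=> [x y xy|x|].
- by rewrite leq_add2r; apply: good_mono.
- by apply: leq_trans (good_infl _ gf) (leq_addr _ _).
- by apply: cf_add; [exact: good_cf|exact: cf_const].
Qed.

Lemma good_mulc f c : 0 < c -> good f -> good (fun x => c * f x).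
Proof.
move=> c0 gf; split=> [x y xy|x|].
- by rewrite leq_mul2l good_mono ?orbT.
- by apply: leq_trans (good_infl _ gf) _; rewrite leq_pmull.
- by apply: cf_mul; [exact: cf_const|exact: good_cf].
Qed.

Lemma good_add f g : good f -> good g -> good (fun x => f x + g x).
Proof.
move=> gf gg; split=> [x y xy|x|].
- by apply: leq_add; apply: good_mono.
- by apply: leq_trans (good_infl _ gf) (leq_addr _ _).
- by apply: cf_add; exact: good_cf.
Qed.

Lemma good_mul f g : good f -> good g -> good (fun x => f x * g x).
Proof.
move=> gf gg; split=> [x y xy|x|].
- by apply: leq_mul; apply: good_mono.
- case: x => // x; apply: leq_trans (good_infl _ gf) _.
  by rewrite leq_pmulr // good_le.
- by apply: cf_mul; exact: good_cf.
Qed.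

Lemma good_exp f g : good f -> good g -> good (fun x => (f x).+1 ^ g x).
Proof.
move=> gf gg; split=> [x y xy|x|].
- apply: (@leq_trans ((f y).+1 ^ g x)).
    by case: (g x) => // e; rewrite leq_exp2r // ltnS good_mono.
  by rewrite leq_pexp2l // good_mono.
- case: x => // x; apply: leq_trans (good_infl _ gf) _.
  by apply: leq_trans (leqnSn _) _; rewrite -{1}[(f _).+1]expn1 leq_pexp2l // good_le.
- by apply: cf_exp; [apply: cf_succ|]; exact: good_cf.
Qed.

Lemma good_iter f g : good f -> good g -> good (fun x => iter (g x) f x).
Proof.
move=> gf gg.
have mono k x y : x <= y -> iter k f x <= iter k f y.
  by move=> xy; elim: k => //= k; apply: good_mono.
have infl k x : x <= iter k f x.
  by elim: k => //= k IH; apply: leq_trans IH (good_infl _ gf).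
split=> [x y xy|x|] //.
- apply: leq_trans (mono _ _ _ xy) _.
  by rewrite -(subnK (good_mono gg xy)) iterD infl.
- apply: (@cf_iter 1 (fun x _ => f x)); [|exact: good_cf|exact: cf_nth].
  exact: cf_comp1 (good_cf gf) (cf_head _).
Qed.

Lemma cf_nth1 n i : cf n (fun e => nth 0 (behead e) i).
Proof. by apply: cf_ext (cf_nth n i.+1) => e _; rewrite nth_behead. Qed.

Lemma cf_nth2 n i : cf n (fun e => nth 0 (behead (behead e)) i).
Proof. by apply: cf_ext (cf_nth n i.+2) => e _; rewrite !nth_behead. Qed.

Lemma cf_nth3 n i : cf n (fun e => nth 0 (behead (behead (behead e))) i).
Proof. by apply: cf_ext (cf_nth n i.+3) => e _; rewrite !nth_behead. Qed.

Lemma cf_head1 n : cf n (fun e => head 0 (behead e)).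
Proof. by apply: cf_ext (cf_nth1 n 0) => e _; rewrite nth0. Qed.

Lemma cf_head2 n : cf n (fun e => head 0 (behead (behead e))).
Proof. by apply: cf_ext (cf_nth2 n 0) => e _; rewrite nth0. Qed.

Lemma cf_head3 n : cf n (fun e => head 0 (behead (behead (behead e)))).
Proof. by apply: cf_ext (cf_nth3 n 0) => e _; rewrite nth0. Qed.

(** In the step of a recursion the accumulator stands between the counter and the environment; a
    summand or factor depends on the last two only. *)
Lemma cf_skip n F : cf n.+1 F -> cf n.+2 (fun e => F (head 0 e :: behead (behead e))).
Proof.
move=> HF.
apply: (@cf_ext n.+2 (fun e => F [seq G e | G <- (fun e => nth 0 e 0) ::
   [seq (fun e : seq nat => nth 0 e i) | i <- iota 2 n]])) => [[|x [|y e]] //= [He]|].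
  congr (F (_ :: _)); rewrite -map_comp /comp (iotaDl 2 0) -map_comp /comp /= -He.
  exact: mkseq_nth.
apply: cf_comp; rewrite /= size_map size_iota // => -[|i] Hi; first exact: cf_nth.
by rewrite /= (nth_map 0) ?size_iota //; apply: cf_nth.
Qed.

Lemma cf_sum n K (F : nat -> seq nat -> nat) :
  cf n.+1 (fun e => F (head 0 e) (behead e)) -> cf n K ->
  cf n (fun s => \sum_(i < K s) F i s).
Proof.
move=> HF HK.
apply: (@cf_ext n (fun s => primrec (fun=> 0)
   (fun e => head 0 (behead e) + F (head 0 e) (behead (behead e))) (K s) s)) => [s _|].
  by elim: (K s) => [|k IH]; rewrite ?big_ord0 // big_ord_recr /= IH.
apply: cf_primrec => //; first exact: cf_const.
apply: cf_add; first exact: cf_head1.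
exact: (cf_skip HF).
Qed.

Lemma cf_prod n K (F : nat -> seq nat -> nat) :
  cf n.+1 (fun e => F (head 0 e) (behead e)) -> cf n K ->
  cf n (fun s => \prod_(i < K s) F i s).
Proof.
move=> HF HK.
apply: (@cf_ext n (fun s => primrec (fun=> 1)
   (fun e => head 0 (behead e) * F (head 0 e) (behead (behead e))) (K s) s)) => [s _|].
  by elim: (K s) => [|k IH]; rewrite ?big_ord0 // big_ord_recr /= IH.
apply: cf_primrec => //; first exact: cf_const.
apply: cf_mul; first exact: cf_head1.
exact: (cf_skip HF).
Qed.

Lemma cf_sub n F G : cf n F -> cf n G -> cf n (fun s => F s - G s).
Proof.
move=> HF HG.
apply: (@cf_ext n (fun s => iter (G s) ((fun x (_ : seq nat) => x.-1)^~ s) (F s))) => [s _|].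
  by elim: (G s) => [|k IH]; rewrite ?subn0 //= IH -subnS.
apply: (@cf_iter n (fun x _ => x.-1)) => //; exact/cf_pred/cf_head.
Qed.

Lemma cf_leq n F G : cf n F -> cf n G -> cf n (fun s => (F s <= G s : nat)).
Proof.
move=> HF HG; apply: (@cf_ext n (fun s => 1 - (F s - G s))) => [s _|].
  by case: leqP; lia.
by do 2?apply: cf_sub => //; apply: cf_const.
Qed.

Lemma cf_eq n F G : cf n F -> cf n G -> cf n (fun s => (F s == G s : nat)).
Proof.
move=> HF HG; apply: (@cf_ext n (fun s => (F s <= G s) * (G s <= F s))) => [s _|].
  by rewrite mulnb eqn_leq.
by apply: cf_mul; apply: cf_leq.
Qed.

Lemma cf_and n (P Q : seq nat -> bool) : cf n (fun s => P s : nat) ->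
  cf n (fun s => Q s : nat) -> cf n (fun s => (P s && Q s : nat)).
Proof. by move=> HP HQ; apply: cf_ext (cf_mul HP HQ) => s _; rewrite mulnb. Qed.

Lemma cf_neg n (P : seq nat -> bool) : cf n (fun s => P s : nat) ->
  cf n (fun s => (~~ P s : nat)).
Proof.
by move=> HP; apply: cf_ext (cf_sub (cf_const n 1) HP) => s _; case: (P s).
Qed.

Lemma cf_imply n (P Q : seq nat -> bool) : cf n (fun s => P s : nat) ->
  cf n (fun s => Q s : nat) -> cf n (fun s => ((P s ==> Q s) : nat)).
Proof.
move=> HP HQ; apply: cf_ext (cf_neg (cf_and HP (cf_neg HQ))) => s _.
by case: (P s); case: (Q s).
Qed.

Definition ball (k : nat) (P : nat -> bool) : bool := all P (iota 0 k).
Definition bex (k : nat) (P : nat -> bool) : bool := has P (iota 0 k).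

Lemma ballP k (P : nat -> bool) : reflect (forall i, i < k -> P i) (ball k P).
Proof.
apply: (iffP allP) => H i; first by move=> ik; apply: H; rewrite mem_iota.
by rewrite mem_iota => /H.
Qed.

Lemma bexP k (P : nat -> bool) : reflect (exists2 i, i < k & P i) (bex k P).
Proof.
by apply: (iffP hasP) => -[i ik Pi]; exists i => //; move: ik; rewrite mem_iota.
Qed.

Lemma cf_ball n K (P : nat -> seq nat -> bool) :
  cf n.+1 (fun e => P (head 0 e) (behead e) : nat) -> cf n K ->
  cf n (fun s => ball (K s) (P^~ s) : nat).
Proof.
move=> HP HK.
apply: (@cf_ext n (fun s => \prod_(i < K s) (P i s : nat))) => [s _|].
  rewrite /ball; elim: (K s) => [|k IH]; first by rewrite big_ord0.
  by rewrite big_ord_recr IH -[in RHS]addn1 iotaD all_cat /= andbT mulnb.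
exact: (@cf_prod n K (fun i s => P i s : nat)).
Qed.

Lemma cf_bex n K (P : nat -> seq nat -> bool) :
  cf n.+1 (fun e => P (head 0 e) (behead e) : nat) -> cf n K ->
  cf n (fun s => bex (K s) (P^~ s) : nat).
Proof.
move=> HP HK.
apply: cf_ext (cf_neg (@cf_ball n K (fun i s => ~~ P i s) (cf_neg HP) HK)) => s _.
by rewrite /ball /bex all_predC negbK.
Qed.

Lemma cf_if n (P : seq nat -> bool) F G : cf n (fun s => P s : nat) -> cf n F -> cf n G ->
  cf n (fun s => if P s then F s else G s).
Proof.
move=> HP HF HG.
apply: cf_ext (cf_add (cf_mul HP HF) (cf_mul (cf_neg HP) HG)) => s _.
by case: (P s); rewrite ?mul1n ?mul0n ?addn0.
Qed.

(** Counting the multiples of d up to m turns division into a bounded sum. *)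
Lemma divn_sum m d : 0 < d -> m %/ d = \sum_(i < m) (i.+1 * d <= m : nat).
Proof.
move=> d0; have H k : \sum_(i < k) (i.+1 * d <= m : nat) = minn k (m %/ d).
  elim: k => [|k IH]; first by rewrite big_ord0 min0n.
  rewrite big_ord_recr IH /= -leq_divRL //.
  by case: leqP; lia.
by rewrite H; apply/esym/minn_idPr/leq_div.
Qed.

(** The divisor is a successor so that it cannot vanish; positive divisors are written [(x.-1).+1]
    in the program for this reason. *)
Lemma cf_div n F G : cf n F -> cf n G -> cf n (fun s => F s %/ (G s).+1).
Proof.
move=> HF HG.
apply: (@cf_ext n (fun s => \sum_(i < F s) (i.+1 * (G s).+1 <= F s : nat))) => [s _|].
  by rewrite -divn_sum.
apply: (@cf_sum n F (fun i s => (i.+1 * (G s).+1 <= F s : nat))) => //.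
apply: cf_leq; last exact: (cf_behead HF).
apply: cf_mul; first exact/cf_succ/cf_head.
exact/cf_succ/(cf_behead HG).
Qed.

Lemma cf_mod n F G : cf n F -> cf n G -> cf n (fun s => F s %% (G s).+1).
Proof.
move=> HF HG.
apply: (@cf_ext n (fun s => F s - F s %/ (G s).+1 * (G s).+1)) => [s _|].
  by rewrite {1}(divn_eq (F s) (G s).+1) addKn.
by apply: cf_sub => //; apply: cf_mul; [apply: cf_div|apply: cf_succ].
Qed.

Lemma cf_odd n F : cf n F -> cf n (fun s => odd (F s) : nat).
Proof.
move=> HF; apply: cf_ext (cf_mod HF (cf_const n 1)) => s _.
by rewrite modn2.
Qed.

Lemma cf_half n F : cf n F -> cf n (fun s => (F s)./2).
Proof.
by move=> HF; apply: cf_ext (cf_div HF (cf_const n 1)) => s _; rewrite divn2.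
Qed.

(** * Integer-valued computable functions, as differences of natural ones *)

Definition zcf (n : nat) (F : seq nat -> int) : Prop :=
  exists P N, [/\ cf n P, cf n N & forall s, size s = n -> F s = ((P s)%:Z - (N s)%:Z)%R].

Lemma zcf_nat n F : cf n F -> zcf n (fun s => ((F s)%:Z)%R).
Proof.
by move=> HF; exists F, (fun=> 0); split=> // [|s _]; [exact: cf_const|rewrite subr0].
Qed.

Lemma zcf_add n F G : zcf n F -> zcf n G -> zcf n (fun s => F s + G s)%R.
Proof.
move=> [P [N [HP HN E]]] [P' [N' [HP' HN' E']]].
exists (fun s => P s + P' s), (fun s => N s + N' s).
by split=> [||s Hs]; [exact: cf_add|exact: cf_add|rewrite E // E' //; lia].
Qed.

Lemma zcf_opp n F : zcf n F -> zcf n (fun s => - F s)%R.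
Proof.
move=> [P [N [HP HN E]]]; exists N, P.
by split=> // s Hs; rewrite E //; lia.
Qed.

Lemma zcf_mul n F G : zcf n F -> zcf n G -> zcf n (fun s => F s * G s)%R.
Proof.
move=> [P [N [HP HN E]]] [P' [N' [HP' HN' E']]].
exists (fun s => P s * P' s + N s * N' s), (fun s => P s * N' s + N s * P' s).
split=> [||s Hs]; last by rewrite E // E' // !PoszD !PoszM; ring.
  by apply: cf_add; apply: cf_mul.
by apply: cf_add; apply: cf_mul.
Qed.

Lemma zcf_sum n K (F : nat -> seq nat -> int) :
  zcf n.+1 (fun e => F (head 0 e) (behead e)) -> cf n K ->
  zcf n (fun s => (\sum_(i < K s) F i s)%R).
Proof.
move=> [P [N [HP HN E]]] HK.
exists (fun s => \sum_(i < K s) P (nat_of_ord i :: s)),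
  (fun s => \sum_(i < K s) N (nat_of_ord i :: s)); split=> [||s Hs].
- apply: (@cf_sum n K (fun i s => P (i :: s))) => //.
  by apply: cf_ext HP => -[].
- apply: (@cf_sum n K (fun i s => N (i :: s))) => //.
  by apply: cf_ext HN => -[].
rewrite -!natz !natr_sum -sumrB; apply: eq_bigr => i _.
by rewrite !natz -E //= Hs.
Qed.

(** Positive and negative parts do not multiply separately, so the product is computed as absolute
    value and sign, the sign being the parity of the number of negative factors. *)
Lemma zcf_prod n K (F : nat -> seq nat -> int) :
  zcf n.+1 (fun e => F (head 0 e) (behead e)) -> cf n K ->
  zcf n (fun s => (\prod_(i < K s) F i s)%R).
Proof.
move=> [P [N [HP HN E]]] HK.
pose ab i s := (P (i :: s) - N (i :: s)) + (N (i :: s) - P (i :: s)).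
pose ng i s : nat := P (i :: s) < N (i :: s).
have HP' : cf n.+1 (fun e => P (head 0 e :: behead e)) by apply: cf_ext HP => -[].
have HN' : cf n.+1 (fun e => N (head 0 e :: behead e)) by apply: cf_ext HN => -[].
have Hab : cf n (fun s => \prod_(i < K s) ab i s).
  by apply: (@cf_prod n K ab) => //; apply: cf_add; apply: cf_sub.
have Hng : cf n (fun s => odd (\sum_(i < K s) ng i s) : nat).
  apply: cf_odd; apply: (@cf_sum n K ng) => //; rewrite /ng.
  by apply: cf_leq => //; apply: cf_succ.
exists (fun s => if odd (\sum_(i < K s) ng i s) then 0 else \prod_(i < K s) ab i s),
  (fun s => if odd (\sum_(i < K s) ng i s) then \prod_(i < K s) ab i s else 0).
split=> [||s Hs]; try by apply: cf_if => //; apply: cf_const.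
have -> : (\prod_(i < K s) F i s =
    (-1) ^+ odd (\sum_(i < K s) ng i s) * (\prod_(i < K s) ab i s)%:Z)%R.
  elim: (K s) => [|k IH]; first by rewrite !big_ord0 mulr1.
  rewrite !big_ord_recr /= IH oddD signr_addb PoszM.
  have -> : F k s = ((-1) ^+ odd (ng k s) * (ab k s)%:Z)%R.
    have := E (k :: s) (ltac:(by rewrite /= Hs)) => /= ->; rewrite /ab /ng.
    by move: (P _) (N _) => p q; case: (ltnP p q) => pq /=; lia.
  by move: ((-1) ^+ _)%R ((-1) ^+ _)%R (\prod_(i < k) _) => x y z; ring.
by case: (odd _); rewrite /= ?expr1 ?expr0 ?mulN1r ?mul1r ?sub0r ?subr0.
Qed.

Lemma cf_zeq n F G : zcf n F -> zcf n G -> cf n (fun s => (F s == G s : nat)).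
Proof.
move=> [P [N [HP HN E]]] [P' [N' [HP' HN' E']]].
apply: cf_ext (cf_eq (cf_add HP HN') (cf_add HP' HN)) => s Hs.
by rewrite E // E' //; lia.
Qed.

(** * The search program *)

(** The Goedel number of [n :: s] is 2^n times the odd number 2 m + 1, with m the number of s. So
    the head is the 2-adic valuation, and the tail is the quotient by 2^(n+1), rounded down. *)
Definition word_hd (w : nat) : nat := \sum_(k < w) (w %% ((2 ^ k.+1).-1).+1 == 0).
Definition word_tl (w : nat) : nat := w %/ ((2 ^ (word_hd w).+1).-1).+1.
Definition ent (w j : nat) : nat := word_hd (iter j word_tl w).

Lemma word_hd_code n s : word_hd (CodeSeq.code (n :: s)) = n.
Proof.
set m := CodeSeq.code s; have -> : CodeSeq.code (n :: s) = 2 ^ n * m.*2.+1 by [].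
rewrite /word_hd.
have E k : (2 ^ n * m.*2.+1 %% ((2 ^ k.+1).-1).+1 == 0) = (k < n).
  rewrite prednK ?expn_gt0 // -/(dvdn _ _); case: (ltnP k n) => kn.
    by rewrite dvdn_mulr // dvdn_exp2l.
  rewrite -(subnK kn) -addSn expnD [2 ^ n * _]mulnC dvdn_pmul2r ?expn_gt0 //.
  have d2 : 2 %| 2 ^ (k - n).+1 by rewrite expnS dvdn_mulr.
  by apply/negbTE/negP => /(dvdn_trans d2); rewrite dvdn2 /= odd_double.
under eq_bigr => k _ do rewrite E.
have H l : \sum_(k < l) (k < n : nat) = minn l n.
  elim: l => [|l IH]; first by rewrite big_ord0 min0n.
  by rewrite big_ord_recr IH /=; case: ltnP; lia.
rewrite H; apply/minn_idPr; apply: leq_trans (ltnW (ltn_expl n (isT : 1 < 2))) _.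
by rewrite leq_pmulr.
Qed.

Lemma word_tl_code n s : word_tl (CodeSeq.code (n :: s)) = CodeSeq.code s.
Proof.
rewrite /word_tl word_hd_code prednK ?expn_gt0 //= expnSr.
by rewrite divnMl ?expn_gt0 // -addn1 -muln2 divnMDl // addn0.
Qed.

Lemma ent_code s j : j < size s -> ent (CodeSeq.code s) j = nth 0 s j.
Proof.
rewrite /ent; elim: s j => // n s IH [|j] Hj; first exact: word_hd_code.
by rewrite iterSr word_tl_code IH.
Qed.

(** Digits in base b + 1: a single bounded number encodes a tuple of bounded matrices, or a map
    between finite sets. *)
Definition digit (b c j : nat) : nat := (c %/ ((b.+1 ^ j).-1).+1) %% b.+1.

Lemma digits_surj b l (g : nat -> nat) : (forall j, g j < b.+1) ->
  exists2 c, c < b.+1 ^ l & forall j, j < l -> digit b c j = g j.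
Proof.
elim: l g => [|l IH] g gb; first by exists 0.
have [c cl cg] := IH (fun j => g j.+1) (fun j => gb j.+1).
exists (c * b.+1 + g 0).
  apply: (@leq_trans (c.+1 * b.+1)); last by rewrite expnSr leq_mul2r cl orbT.
  by rewrite mulSn addnC ltn_add2r.
move=> [|j] Hj; rewrite /digit prednK ?expn_gt0 //.
  by rewrite expn0 divn1 modnMDl modn_small.
rewrite expnS divnMA divnMDl // (divn_small (gb 0)) addn0 -cg //.
by rewrite /digit prednK ?expn_gt0.
Qed.

Lemma digit_lt b c j : digit b c j < b.+1.
Proof. exact: ltn_pmod. Qed.

Definition zdecode (x : nat) : int := if odd x then Negz x./2 else Posz x./2.

Lemma zdecodeK z : zdecode (int_code z) = z.
Proof. by case: z => k; rewrite /zdecode /= odd_double ?uphalf_double ?doubleK. Qed.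

(* Reading the input word: N, the order relation, the block sizes, and the    *)
(* entries scaled by [w`!], a common denominator.                             *)
Definition pN (w : nat) : nat := ent w 0.
Definition ple (w i j : nat) : nat := ent w (1 + i * pN w + j).
Definition pn (w i : nat) : nat := ent w (1 + pN w * pN w + i).
Definition poff (w k : nat) : nat := \sum_(i < k) pn w i.
Definition ptot (w : nat) : nat := poff w (pN w).
Definition pfact (w : nat) : nat := \prod_(i < w) i.+1.
(** The offset o is 0 for A and the square of the total size for B; the factor 2 is there because an
    entry takes a numerator and a denominator. *)
Definition pcell (w o i j : nat) : nat :=
  1 + pN w * pN w + pN w + 2 * (o + i * ptot w + j).
Definition pscaled (w o i j : nat) : int :=
  (zdecode (ent w (pcell w o i j)) *
   ((pfact w %/ ((ent w (pcell w o i j).+1).-1).+1))%:Z)%R.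

(* The k-th of the candidate matrices, which are U, W, U^-1 and W^-1.         *)
Definition pcand (be : nat -> nat) (w c k i j : nat) : int :=
  ((digit (2 * be w) c (k * (ptot w * ptot w) + i * ptot w + j))%:Z - (be w)%:Z)%R.

Definition pinverse be w c k l : bool :=
  ball (ptot w) (fun i => ball (ptot w) (fun j =>
    (\sum_(x < ptot w) pcand be w c k i x * pcand be w c l x j)%R == Posz (i == j))).

Definition pblock_ok be w c k i j : bool :=
  (ple w i j == 0) ==> ball (pn w i) (fun x => ball (pn w j) (fun y =>
    pcand be w c k (poff w i + x) (poff w j + y) == 0%R)).

Definition ppattern be w c k : bool :=
  ball (pN w) (fun i => ball (pN w) (fun j => pblock_ok be w c k i j)).

Definition pequation be w c : bool :=
  ball (ptot w) (fun i => ball (ptot w) (fun j =>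
    (\sum_(x < ptot w) pcand be w c 0 i x * pscaled w 0 x j)%R ==
    (\sum_(x < ptot w) pscaled w (ptot w * ptot w) i x * pcand be w c 1 x j)%R)).

(* The Leibniz formula, with the sign of a permutation replaced by its        *)
(* Vandermonde product, which also discards maps that are not injective.      *)
Definition pvand (n s : nat) : int :=
  (\prod_(y < n) \prod_(x < y) ((digit n.-1 s y)%:Z - (digit n.-1 s x)%:Z))%R.
Definition pvand1 (n : nat) : int := (\prod_(y < n) \prod_(x < y) (y%:Z - x%:Z))%R.
Definition pleibniz be w c k i : int :=
  (\sum_(s < pn w i ^ pn w i) (\prod_(x < pn w i)
     pcand be w c k (poff w i + x) (poff w i + digit (pn w i).-1 s x)) * pvand (pn w i) s)%R.
Definition pdet1 be w c k : bool :=
  ball (pN w) (fun i => pleibniz be w c k i == pvand1 (pn w i)).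

(** Candidates 0 and 2 stand for U and U^-1, candidates 1 and 3 for W and W^-1 = V. Exhibiting the
    inverses certifies invertibility, and determinants are tested on U and on V. *)
Definition pcheck (sl : bool) be w c : bool :=
  [&& pinverse be w c 0 2, pinverse be w c 1 3,
      [&& ppattern be w c 0, ppattern be w c 1, ppattern be w c 2 & ppattern be w c 3],
      pequation be w c & (sl ==> (pdet1 be w c 0 && pdet1 be w c 3))].

Definition pdecide (sl : bool) be w : bool :=
  bex ((2 * be w).+1 ^ (4 * (ptot w * ptot w))) (pcheck sl be w).

(** * Computability of the search program *)

Ltac cf_step :=
  match goal with
  | |- cf _ (fun s => ?c) => exact: cf_const
  | |- cf _ (fun s => nth 0 s _) => exact: cf_nth
  | |- cf _ (fun s => nth 0 (behead s) _) => exact: cf_nth1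
  | |- cf _ (fun s => nth 0 (behead (behead s)) _) => exact: cf_nth2
  | |- cf _ (fun s => nth 0 (behead (behead (behead s))) _) => exact: cf_nth3
  | |- cf _ (head 0) => exact: cf_head
  | |- cf _ (fun s => head 0%N s) => exact: cf_head
  | |- cf _ (fun s => head 0%N (behead s)) => exact: cf_head1
  | |- cf _ (fun s => head 0%N (behead (behead s))) => exact: cf_head2
  | |- cf _ (fun s => @?F s + @?G s) => apply: cf_add
  | |- cf _ (fun s => @?F s * @?G s) => apply: cf_mul
  | |- cf _ (fun s => @?F s ^ @?G s) => apply: cf_exp
  | |- cf _ (fun s => (@?F s).+1) => apply: cf_succ
  | |- cf _ (fun s => (@?F s).-1) => apply: cf_pred
  | |- cf _ (fun s => (@?F s) %/ (@?G s).+1) => apply: cf_div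
  | |- cf _ (fun s => (@?F s) %% (@?G s).+1) => apply: cf_mod
  end.

Ltac cfs := repeat cf_step.

Lemma cf_word_hd n F : cf n F -> cf n (fun s => word_hd (F s)).
Proof.
apply: (@cf_comp1 n word_hd).
apply: (@cf_sum 1 (fun s => nth 0 s 0)
  (fun k s => (nth 0 s 0) %% ((2 ^ k.+1).-1).+1 == 0 : nat)); last by cfs.
by apply: cf_eq; cfs.
Qed.

Lemma cf_word_tl n F : cf n F -> cf n (fun s => word_tl (F s)).
Proof.
by apply: (@cf_comp1 n word_tl); rewrite /word_tl; cfs; apply: cf_word_hd; cfs.
Qed.

Lemma cf_ent n F G : cf n F -> cf n G -> cf n (fun s => ent (F s) (G s)).
Proof.
apply: (@cf_comp2 n ent); apply: cf_word_hd.
apply: (@cf_iter 2 (fun x _ => word_tl x)); cfs.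
by apply: cf_word_tl; cfs.
Qed.

Lemma cf_digit n F G H : cf n F -> cf n G -> cf n H ->
  cf n (fun s => digit (F s) (G s) (H s)).
Proof. by move=> HF HG HH; rewrite /digit; cfs. Qed.

Lemma cf_pN n F : cf n F -> cf n (fun s => pN (F s)).
Proof. by move=> HF; apply: cf_ent => //; cfs. Qed.

Lemma cf_ple n F G H : cf n F -> cf n G -> cf n H -> cf n (fun s => ple (F s) (G s) (H s)).
Proof. by move=> HF HG HH; apply: cf_ent => //; cfs => //; apply: cf_pN. Qed.

Lemma cf_pn n F G : cf n F -> cf n G -> cf n (fun s => pn (F s) (G s)).
Proof. by move=> HF HG; apply: cf_ent => //; cfs => //; apply: cf_pN. Qed.

Lemma cf_poff n F G : cf n F -> cf n G -> cf n (fun s => poff (F s) (G s)).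
Proof.
move=> HF HG; apply: (@cf_sum n G (fun i s => pn (F s) i)) => //.
by apply: cf_pn; [exact: (cf_behead HF)|cfs].
Qed.

Lemma cf_ptot n F : cf n F -> cf n (fun s => ptot (F s)).
Proof. by move=> HF; apply: cf_poff => //; apply: cf_pN. Qed.

Lemma cf_pfact n F : cf n F -> cf n (fun s => pfact (F s)).
Proof. by move=> HF; apply: (@cf_prod n F (fun i s => i.+1)) => //; cfs. Qed.

Lemma cf_pcell n F G H K : cf n F -> cf n G -> cf n H -> cf n K ->
  cf n (fun s => pcell (F s) (G s) (H s) (K s)).
Proof.
by move=> *; rewrite /pcell; cfs => //; try apply: cf_pN => //; apply: cf_ptot.
Qed.

Lemma zcf_zdecode n F : cf n F -> zcf n (fun s => zdecode (F s)).
Proof.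
move=> HF; exists (fun s => if odd (F s) then 0 else (F s)./2),
  (fun s => if odd (F s) then (F s)./2.+1 else 0).
split=> [||s _].
- by apply: cf_if; [apply: cf_odd|exact: cf_const|apply: cf_half].
- by apply: cf_if; [apply: cf_odd|apply/cf_succ/cf_half|exact: cf_const].
- by rewrite /zdecode; case: ifP => _; rewrite ?NegzE; lia.
Qed.

Lemma zcf_pscaled n F G H K : cf n F -> cf n G -> cf n H -> cf n K ->
  zcf n (fun s => pscaled (F s) (G s) (H s) (K s)).
Proof.
move=> HF HG HH HK; have Hc := cf_pcell HF HG HH HK.
apply: zcf_mul; first by apply/zcf_zdecode/cf_ent.
apply/zcf_nat/cf_div; first exact: cf_pfact.
by apply/cf_pred/cf_ent => //; apply: cf_succ.
Qed.

Section Program.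
Variable be : nat -> nat.
Hypothesis Hbe : cf 1 (fun s => be (nth 0 s 0)).

Lemma cf_be n F : cf n F -> cf n (fun s => be (F s)).
Proof. exact: cf_comp1. Qed.

Lemma zcf_pcand n F C K I J : cf n F -> cf n C -> cf n K -> cf n I -> cf n J ->
  zcf n (fun s => pcand be (F s) (C s) (K s) (I s) (J s)).
Proof.
move=> HF HC HK HI HJ; have Hb := cf_be HF; have Ht := cf_ptot HF.
apply: zcf_add; last exact/zcf_opp/zcf_nat.
by apply/zcf_nat/cf_digit; cfs.
Qed.

Lemma cf_pinverse n F C k l : cf n F -> cf n C ->
  cf n (fun s => pinverse be (F s) (C s) k l : nat).
Proof.
move=> HF HC; have Ht := cf_ptot HF.
(* Each bounded quantifier or sum pushes its variable onto the environment; the numbered hypotheses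
   lift the arguments to the deeper environments. *)
have HF1 := cf_behead HF; have HC1 := cf_behead HC; have Ht1 := cf_behead Ht.
have HF2 := cf_behead HF1; have HC2 := cf_behead HC1; have Ht2 := cf_behead Ht1.
have HF3 := cf_behead HF2; have HC3 := cf_behead HC2.
apply: (@cf_ball n _ (fun i s => ball (ptot (F s)) (fun j =>
  (\sum_(x < ptot (F s)) pcand be (F s) (C s) k i x * pcand be (F s) (C s) l x j)%R ==
    Posz (i == j)))) => //.
apply: (@cf_ball n.+1 _ (fun j e => (\sum_(x < ptot (F (behead e)))
   pcand be (F (behead e)) (C (behead e)) k (head 0%N e) x *
   pcand be (F (behead e)) (C (behead e)) l x j)%R == Posz (head 0%N e == j))) => //.
apply: cf_zeq; last by apply/zcf_nat/cf_eq; cfs.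
apply: (@zcf_sum n.+2 _ (fun x e =>
   (pcand be (F (behead (behead e))) (C (behead (behead e))) k (head 0%N (behead e)) x *
   pcand be (F (behead (behead e))) (C (behead (behead e))) l x (head 0%N e))%R)) => //.
by apply: zcf_mul; apply: zcf_pcand => //; cfs.
Qed.

Lemma cf_ppattern n F C k : cf n F -> cf n C ->
  cf n (fun s => ppattern be (F s) (C s) k : nat).
Proof.
move=> HF HC.
have HF1 := cf_behead HF; have HC1 := cf_behead HC.
have HF2 := cf_behead HF1; have HC2 := cf_behead HC1.
have HF3 := cf_behead HF2; have HC3 := cf_behead HC2.
have HF4 := cf_behead HF3; have HC4 := cf_behead HC3.
apply: (@cf_ball n _ (fun i s => ball (pN (F s)) (fun j => pblock_ok be (F s) (C s) k i j)));
  last exact: cf_pN.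
apply: (@cf_ball n.+1 _ (fun j e => pblock_ok be (F (behead e)) (C (behead e)) k (head 0%N e) j));
  last exact: cf_pN.
apply: cf_imply; first by apply: cf_eq; [apply: cf_ple; cfs|cfs].
apply: (@cf_ball n.+2 _ (fun x e => ball (pn (F (behead (behead e))) (head 0%N e)) (fun y =>
   pcand be (F (behead (behead e))) (C (behead (behead e))) k
     (poff (F (behead (behead e))) (head 0%N (behead e)) + x)
     (poff (F (behead (behead e))) (head 0%N e) + y) == 0%R))); last by apply: cf_pn; cfs.
apply: (@cf_ball n.+3 _ (fun y e =>
   pcand be (F (behead (behead (behead e)))) (C (behead (behead (behead e)))) k
     (poff (F (behead (behead (behead e)))) (head 0%N (behead (behead e))) + head 0%N e)
     (poff (F (behead (behead (behead e)))) (head 0%N (behead e)) + y) == 0%R));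
  last by apply: cf_pn; cfs.
apply: cf_zeq; last exact/zcf_nat/cf_const.
by apply: zcf_pcand => //; cfs; apply: cf_poff => //; cfs; exact: cf_head3.
Qed.

Lemma cf_pequation n F C : cf n F -> cf n C ->
  cf n (fun s => pequation be (F s) (C s) : nat).
Proof.
move=> HF HC; have Ht := cf_ptot HF.
have HF1 := cf_behead HF; have HC1 := cf_behead HC; have Ht1 := cf_behead Ht.
have HF2 := cf_behead HF1; have HC2 := cf_behead HC1; have Ht2 := cf_behead Ht1.
have HF3 := cf_behead HF2; have HC3 := cf_behead HC2; have Ht3 := cf_behead Ht2.
apply: (@cf_ball n _ (fun i s => ball (ptot (F s)) (fun j =>
    (\sum_(x < ptot (F s)) pcand be (F s) (C s) 0 i x * pscaled (F s) 0 x j)%R ==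
    (\sum_(x < ptot (F s)) pscaled (F s) (ptot (F s) * ptot (F s)) i x *
       pcand be (F s) (C s) 1 x j)%R))) => //.
apply: (@cf_ball n.+1 _ (fun j e =>
    (\sum_(x < ptot (F (behead e))) pcand be (F (behead e)) (C (behead e)) 0 (head 0%N e) x *
       pscaled (F (behead e)) 0 x j)%R ==
    (\sum_(x < ptot (F (behead e))) pscaled (F (behead e))
       (ptot (F (behead e)) * ptot (F (behead e))) (head 0%N e) x *
       pcand be (F (behead e)) (C (behead e)) 1 x j)%R)) => //.
apply: cf_zeq.
- apply: (@zcf_sum n.+2 _ (fun x e => (pcand be (F (behead (behead e))) (C (behead (behead e))) 0
       (head 0%N (behead e)) x * pscaled (F (behead (behead e))) 0 x (head 0%N e))%R)) => //.
  by apply: zcf_mul; [apply: zcf_pcand|apply: zcf_pscaled] => //; cfs.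
- apply: (@zcf_sum n.+2 _ (fun x e => (pscaled (F (behead (behead e)))
       (ptot (F (behead (behead e))) * ptot (F (behead (behead e)))) (head 0%N (behead e)) x *
       pcand be (F (behead (behead e))) (C (behead (behead e))) 1 x (head 0%N e))%R)) => //.
  by apply: zcf_mul; [apply: zcf_pscaled|apply: zcf_pcand] => //; cfs.
Qed.

Lemma zcf_pvand n F S : cf n F -> cf n S -> zcf n (fun s => pvand (F s) (S s)).
Proof.
move=> HF HS.
have HF1 := cf_behead HF; have HS1 := cf_behead HS.
have HF2 := cf_behead HF1; have HS2 := cf_behead HS1.
apply: (@zcf_prod n _ (fun y s => (\prod_(x < y)
  ((digit (F s).-1 (S s) y)%:Z - (digit (F s).-1 (S s) x)%:Z))%R)) => //.
apply: (@zcf_prod n.+1 _ (fun x e =>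
  ((digit (F (behead e)).-1 (S (behead e)) (head 0%N e))%:Z -
   (digit (F (behead e)).-1 (S (behead e)) x)%:Z)%R)); last by cfs.
by apply: zcf_add; [|apply: zcf_opp]; apply/zcf_nat/cf_digit; cfs.
Qed.

Lemma zcf_pvand1 n F : cf n F -> zcf n (fun s => pvand1 (F s)).
Proof.
move=> HF; apply: (@zcf_prod n _ (fun y s => (\prod_(x < y) (y%:Z - x%:Z))%R)) => //.
apply: (@zcf_prod n.+1 _ (fun x e => ((head 0%N e)%:Z - x%:Z)%R)); last by cfs.
by apply: zcf_add; [|apply: zcf_opp]; apply/zcf_nat; cfs.
Qed.

Lemma zcf_pleibniz n F C k I : cf n F -> cf n C -> cf n I ->
  zcf n (fun s => pleibniz be (F s) (C s) k (I s)).
Proof.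
move=> HF HC HI; have Hn := cf_pn HF HI; have Ho := cf_poff HF HI.
have HF1 := cf_behead HF; have HC1 := cf_behead HC; have HI1 := cf_behead HI.
have HF2 := cf_behead HF1; have HC2 := cf_behead HC1; have HI2 := cf_behead HI1.
have Hn1 := cf_behead Hn; have Hn2 := cf_behead Hn1.
have Ho1 := cf_behead Ho; have Ho2 := cf_behead Ho1.
apply: (@zcf_sum n _ (fun t s => ((\prod_(x < pn (F s) (I s))
     pcand be (F s) (C s) k (poff (F s) (I s) + x)
       (poff (F s) (I s) + digit (pn (F s) (I s)).-1 t x)) * pvand (pn (F s) (I s)) t)%R));
  last by cfs.
apply: zcf_mul; last by apply: zcf_pvand => //; cfs.
apply: (@zcf_prod n.+1 _ (fun x e =>
     pcand be (F (behead e)) (C (behead e)) k (poff (F (behead e)) (I (behead e)) + x)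
       (poff (F (behead e)) (I (behead e)) +
        digit (pn (F (behead e)) (I (behead e))).-1 (head 0%N e) x))) => //.
by apply: zcf_pcand => //; cfs => //; apply: cf_digit; cfs.
Qed.

Lemma cf_pdet1 n F C k : cf n F -> cf n C ->
  cf n (fun s => pdet1 be (F s) (C s) k : nat).
Proof.
move=> HF HC; have HF1 := cf_behead HF; have HC1 := cf_behead HC.
apply: (@cf_ball n _ (fun i s => pleibniz be (F s) (C s) k i == pvand1 (pn (F s) i)));
  last exact: cf_pN.
apply: cf_zeq; first by apply: zcf_pleibniz; cfs.
by apply/zcf_pvand1/cf_pn; cfs.
Qed.

Lemma cf_pdecide sl : cf 1 (fun s => pdecide sl be (nth 0 s 0) : nat).
Proof.
apply: (@cf_bex 1 _ (fun c s => pcheck sl be (nth 0 s 0) c)); last first.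
  by cfs; [apply: cf_be|apply: cf_ptot|apply: cf_ptot]; cfs.
have HF : cf 2 (fun e => nth 0 (behead e) 0) by cfs.
have HC : cf 2 (fun e => head 0%N e) by cfs.
rewrite /pcheck; do !apply: cf_and;
  try by [apply: cf_pinverse|apply: cf_ppattern|apply: cf_pequation].
by apply: cf_imply; [cfs|apply: cf_and; apply: cf_pdet1].
Qed.
End Program.

Local Open Scope ring_scope.

(** * Bounded solutions of linear systems *)

Lemma absz_sum (I : Type) (r : seq I) (P : pred I) (F : I -> int) :
  (`|(\sum_(i <- r | P i) F i)%R| <= \sum_(i <- r | P i) `|F i|)%N.
Proof.
elim/big_rec2: _ => [|i m n _ H]; first by [].
by apply: leq_trans (_ : `|F i| + `|n| <= _)%N; [lia|rewrite leq_add2l].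
Qed.

Lemma absz_sum_le (I : finType) (P : pred I) (F : I -> int) B :
  (forall i, (`|F i| <= B)%N) -> (`|(\sum_(i | P i) F i)%R| <= #|I| * B)%N.
Proof.
move=> HF; apply: leq_trans (absz_sum _ _ _) _.
apply: leq_trans (leq_sum _ (fun i _ => HF i)) _.
by rewrite sum_nat_const leq_mul2r max_card orbT.
Qed.

(** A generous bound for one elimination, applied twice per unknown: to the eliminated system, and
    to the value recovered for the pivot unknown. *)
Definition lin_grow (t : nat) : nat := (2 * (t * (t * t)))%N.

Lemma good_lin_grow : good lin_grow.
Proof.
apply: good_mulc => //; apply: good_mul; first exact: good_id.
by apply: good_mul; exact: good_id.
Qed.

Lemma lin_grow_iter k t : (t <= iter k lin_grow t)%N.
Proof.
by elim: k => //= k IH; apply: leq_trans IH (good_infl _ good_lin_grow).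
Qed.

Lemma iter_lin_grow_mono k x y : (x <= y)%N -> (iter k lin_grow x <= iter k lin_grow y)%N.
Proof. by move=> xy; elim: k => //= k; apply: good_mono good_lin_grow. Qed.

(* Gaussian elimination of the first unknown: if [al * x0] occurs in an       *)
(* equation, the other unknowns are only moved modulo [al * D], which keeps   *)
(* the value of [x0] that this equation prescribes integral and fixed mod D.  *)
Lemma lin_solve_ord q : forall s (K : finType) (a : K -> 'I_q -> int)
    (x : 'I_q -> int) (D : nat),
  (q <= s)%N -> (0 < D <= s)%N -> (forall k i, (`|a k i| <= s)%N) ->
  (forall k, (`|(\sum_i a k i * x i)%R| <= s)%N) ->
  exists x' : 'I_q -> int, [/\ forall k, \sum_i a k i * x' i = \sum_i a k i * x i,
    forall i, (`|x' i| <= iter (2 * q) lin_grow s)%N &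
    forall i, (D%:Z %| x' i - x i)%Z].
Proof.
elim: q => [|q IH] s K a x D qs Ds as_ rs.
  by exists x; split=> [k|[]|[]] //.
have s0 : (0 < s)%N by lia.
have iterE : iter (2 * q.+1) lin_grow s = lin_grow (iter (2 * q) lin_grow (lin_grow s)).
  by rewrite mulnS -[RHS]/(iter (2 * q).+1 lin_grow (lin_grow s)) -iterSr.
have [k0 Hk0|a0] := pickP (fun k => a k ord0 != 0); last first.
  have a00 k : a k ord0 = 0 by apply/eqP; move: (a0 k) => /negbFE.
  have sumE (y : 'I_q.+1 -> int) k :
      \sum_i a k i * y i = \sum_(i < q) a k (lift ord0 i) * y (lift ord0 i).
    by rewrite big_ord_recl a00 mul0r add0r.
  have [||k i|k|x' [Hx' Bx' Dx']] :=
    IH s K (fun k i => a k (lift ord0 i)) (fun i => x (lift ord0 i)) D.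
  - lia.
  - lia.
  - exact: as_.
  - by rewrite -sumE.
  (* The first unknown occurs in no equation, so it may be reduced modulo D. *)
  exists (fun i => if unlift ord0 i is Some j then x' j else (x ord0 %% D%:Z)%Z); split.
  - by move=> k; rewrite !sumE -Hx'; apply: eq_bigr => i _; rewrite liftK.
  - move=> i; case: (unliftP ord0 i) => [j _|_].
      apply: leq_trans (Bx' j) _; rewrite iterE.
      apply: leq_trans _ (good_infl _ good_lin_grow).
      exact/iter_lin_grow_mono/(good_infl _ good_lin_grow).
    apply: leq_trans _ (lin_grow_iter _ _).
    have D0 : D%:Z != 0 by lia.
    have := ltz_pmod (x ord0) (d := D%:Z); have := modz_ge0 (x ord0) D0; lia.
  - move=> i; case: (unliftP ord0 i) => [j ->|->] //.
    by rewrite -eqz_mod_dvd modz_mod.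
set al := a k0 ord0 in Hk0.
pose S (y : 'I_q.+1 -> int) k := \sum_i a k i * y i.
have SE (y : 'I_q.+1 -> int) k :
    S y k = a k ord0 * y ord0 + \sum_(i < q) a k (lift ord0 i) * y (lift ord0 i).
  by rewrite /S big_ord_recl.
(* Equation k times the pivot, minus a multiple of the pivot equation. *)
pose a' k (i : 'I_q) := al * a k (lift ord0 i) - a k ord0 * a k0 (lift ord0 i).
have a'E (y : 'I_q.+1 -> int) k :
    \sum_i a' k i * y (lift ord0 i) = al * S y k - a k ord0 * S y k0.
  rewrite !SE -/al !mulrDr.
  transitivity (al * (\sum_(i < q) a k (lift ord0 i) * y (lift ord0 i)) -
    a k ord0 * (\sum_(i < q) a k0 (lift ord0 i) * y (lift ord0 i))); last by ring.
  rewrite !mulr_sumr -sumrB; apply: eq_bigr => i _; rewrite /a'; ring.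
have two_le (u v w z : int) : (`|u| <= s -> `|v| <= s -> `|w| <= s -> `|z| <= s ->
    `|(u * v - w * z)%R| <= lin_grow s)%N.
  move=> us vs ws zs; apply: (@leq_trans (`|u| * `|v| + `|w| * `|z|)%N).
    by rewrite -!abszM; lia.
  apply: (@leq_trans (s * s + s * s)%N); first by rewrite leq_add // leq_mul.
  rewrite /lin_grow; nia.
have D'0 : (0 < D * `|al| <= lin_grow s)%N.
  have al0 : (0 < `|al|)%N by lia.
  have als : (`|al| <= s)%N by apply: as_.
  have : (D * `|al| <= s * s)%N by apply: leq_mul => //; lia.
  rewrite muln_gt0 al0 andbT /lin_grow; nia.
have [||k i|k|x' [Hx' Bx' Dx']] :=
  IH (lin_grow s) K a' (fun i => x (lift ord0 i)) (D * `|al|)%N.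
- exact: leq_trans (leq_trans (leqnSn _) qs) (good_infl _ good_lin_grow).
- exact: D'0.
- by apply: two_le; apply: as_.
- by rewrite a'E; apply: two_le; by [apply: as_|apply: rs].
pose u i := ((x' i - x (lift ord0 i)) %/ (D%:Z * al))%Z.
have uE i : x' i - x (lift ord0 i) = u i * (D%:Z * al).
  by rewrite /u divzK // dvdzE abszM absz_nat; have := Dx' i; rewrite dvdzE absz_nat.
(* Moving the other unknowns by al D u changes the pivot equation by al D t, which is compensated by
   moving the first unknown by - D t. *)
pose t := \sum_(i < q) a k0 (lift ord0 i) * u i.
pose x0 := x ord0 - D%:Z * t.
pose y i := if unlift ord0 i is Some j then x' j else x0.
have y0 : y ord0 = x0 by rewrite /y unlift_none.
have yS i : y (lift ord0 i) = x' i by rewrite /y liftK.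
have Sk0 : S y k0 = S x k0.
  rewrite !SE y0 -/al.
  under eq_bigr do rewrite yS.
  have -> : \sum_(i < q) a k0 (lift ord0 i) * x' i =
     \sum_(i < q) a k0 (lift ord0 i) * x (lift ord0 i) + t * (D%:Z * al).
    rewrite /t mulr_suml -big_split /=; apply: eq_bigr => i _.
    have := uE i; move/eqP; rewrite subr_eq => /eqP ->; ring.
  rewrite /x0; ring.
exists y; split.
- move=> k; rewrite -/(S y k) -/(S x k).
  have := a'E x k; rewrite -Hx'.
  have -> : \sum_i a' k i * x' i = \sum_i a' k i * y (lift ord0 i).
    by apply: eq_bigr => i _; rewrite yS.
  rewrite a'E Sk0 => /(addIr _); exact: mulfI.
- rewrite iterE; set b := iter _ _ _ in Bx' *.
  have sb : (s <= b)%N.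
    by apply: leq_trans (good_infl _ good_lin_grow) (lin_grow_iter _ _).
  move=> i; rewrite /y; case: (unliftP ord0 i) => [j _|_].
    exact: leq_trans (Bx' j) (good_infl _ good_lin_grow).
  have /eqP := SE y k0; rewrite Sk0 y0 -/al eq_sym -subr_eq0.
  under eq_bigr do rewrite yS.
  set T := \sum_(i < q) _ => eq0.
  have Tle : (`|T| <= q * (s * b))%N.
    rewrite -[X in (_ <= X * _)%N]card_ord; apply: absz_sum_le => j.
    by rewrite abszM leq_mul.
  have Sle := rs k0; rewrite -/(S x k0) in Sle.
  have : (`|(al * x0)%R| <= s + q * (s * b))%N by lia.
  rewrite abszM => H.
  have : (`|x0| <= `|al| * `|x0|)%N by rewrite leq_pmull //; lia.
  have : (q * (s * b) <= b * (b * b))%N by rewrite leq_mul ?leq_mul //; lia.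
  rewrite /lin_grow; nia.
- move=> i; rewrite /y; case: (unliftP ord0 i) => [j ->|->].
    by rewrite uE mulrA mulrAC dvdz_mull.
  by rewrite /x0 addrAC subrr sub0r -mulrN dvdz_mulr.
Qed.

Definition lin_bound (s : nat) : nat := iter (2 * s) lin_grow s.

Lemma good_lin_bound : good lin_bound.
Proof. by apply: good_iter good_lin_grow _; apply: good_mulc => //; apply: good_id. Qed.

Lemma lin_solve (I K : finType) s (a : K -> I -> int) (x : I -> int) (D : nat) :
  (#|I| <= s)%N -> (0 < D <= s)%N -> (forall k i, (`|a k i| <= s)%N) ->
  (forall k, (`|(\sum_i a k i * x i)%R| <= s)%N) ->
  exists x' : I -> int, [/\ forall k, \sum_i a k i * x' i = \sum_i a k i * x i,
    forall i, (`|x' i| <= lin_bound s)%N & forall i, (D%:Z %| x' i - x i)%Z].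
Proof.
move=> Is Ds as_ rs.
have sumE (y : 'I_#|I| -> int) (b : I -> int) :
    \sum_(i < #|I|) b (enum_val i) * y i = \sum_i b i * y (enum_rank i).
  rewrite (reindex_onto enum_rank enum_val) => [|i _]; last exact: enum_valK.
  by apply: eq_big => [i|i _]; rewrite enum_rankK ?eqxx.
have [||k i|k|x' [Hx' Bx' Dx']] :=
  @lin_solve_ord #|I| s K (fun k i => a k (enum_val i)) (fun i => x (enum_val i)) D.
- exact: Is.
- exact: Ds.
- exact: as_.
- rewrite sumE; under eq_bigr do rewrite enum_rankK; exact: rs.
exists (fun i => x' (enum_rank i)); split=> [k|i|i].
- rewrite -sumE Hx' sumE; by under eq_bigr do rewrite enum_rankK.
- apply: leq_trans (Bx' _) _.
  rewrite /lin_bound -(subnK Is) mulnDr iterD.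
  exact: (lin_grow_iter (2 * (s - #|I|))).
- by have := Dx' (enum_rank i); rewrite enum_rankK.
Qed.

Definition mxle (B : nat) p q (M : 'M[int]_(p, q)) : Prop := forall i j, (`|M i j| <= B)%N.

(** Used with D = 1 for bounded preimages and inverses, with D = 2 to generate Hom by bounded
    elements, and with general D for automorphisms congruent to 1. *)
Lemma mx_solve (K : finType) p q s (F : K -> 'M[int]_(p, q) -> int) (X : 'M[int]_(p, q))
    (D : nat) :
  (forall k, linear (F k : _ -> int^o)) -> (p * q <= s)%N -> (0 < D <= s)%N ->
  (forall k i j, (`|F k (delta_mx i j)| <= s)%N) -> (forall k, (`|F k X| <= s)%N) ->
  exists X' : 'M[int]_(p, q), [/\ forall k, F k X' = F k X,
    mxle (lin_bound s) X' & forall i j, (D%:Z %| X' i j - X i j)%Z].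
Proof.
move=> linF pqs Ds Fs rs.
have FE k (Y : 'M[int]_(p, q)) :
    F k Y = \sum_(ij : 'I_p * 'I_q) F k (delta_mx ij.1 ij.2) * Y ij.1 ij.2.
  have F0 : F k 0 = 0.
    have := linF k 1 0 0; rewrite scaler0 add0r /= scale1r.
    by move/eqP; rewrite -subr_eq0 opprD addrA subrr sub0r oppr_eq0 => /eqP.
  have FD (Z1 Z2 : 'M[int]_(p, q)) : F k (Z1 + Z2) = F k Z1 + F k Z2.
    by have := linF k 1 Z1 Z2; rewrite !scale1r.
  have FZ c (Z1 : 'M[int]_(p, q)) : F k (c *: Z1) = c * F k Z1.
    by have := linF k c Z1 0; rewrite F0 !addr0.
  rewrite {1}[Y]matrix_sum_delta -(pair_bigA _ (fun i j => F k (delta_mx i j) * Y i j)) /=.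
  rewrite (big_morph _ FD F0); apply: eq_bigr => i _.
  rewrite (big_morph _ FD F0); apply: eq_bigr => j _.
  by rewrite FZ mulrC.
have [|||k|x' [Hx' Bx' Dx']] := @lin_solve ('I_p * 'I_q)%type K s
    (fun k ij => F k (delta_mx ij.1 ij.2)) (fun ij => X ij.1 ij.2) D.
- by rewrite card_prod !card_ord.
- exact: Ds.
- by move=> k ij; apply: Fs.
- by rewrite -FE.
exists (\matrix_(i, j) x' (i, j)); split=> [k|i j|i j]; last 2 first.
- by rewrite mxE.
- by rewrite mxE; apply: (Dx' (i, j)).
by rewrite !FE -Hx'; apply: eq_bigr => -[i j] _; rewrite mxE.
Qed.

(** * Lattice reduction *)

Definition dot p (u v : 'rV[int]_p) : int := \sum_j u 0 j * v 0 j.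
Definition sq p (u : 'rV[int]_p) : int := dot u u.

Lemma dotC p (u v : 'rV[int]_p) : dot u v = dot v u.
Proof. by apply: eq_bigr => j _; rewrite mulrC. Qed.

Lemma dotDl p (u v w : 'rV[int]_p) : dot (u + v) w = dot u w + dot v w.
Proof. by rewrite -big_split; apply: eq_bigr => j _; rewrite mxE mulrDl. Qed.

Lemma dotZl p c (u v : 'rV[int]_p) : dot (c *: u) v = c * dot u v.
Proof. by rewrite mulr_sumr; apply: eq_bigr => j _; rewrite mxE mulrA. Qed.

Lemma dotDr p (u v w : 'rV[int]_p) : dot w (u + v) = dot w u + dot w v.
Proof. by rewrite ![dot w _]dotC dotDl. Qed.

Lemma dotZr p c (u v : 'rV[int]_p) : dot u (c *: v) = c * dot u v.
Proof. by rewrite ![dot u _]dotC dotZl. Qed.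

Lemma dotBl p (u v w : 'rV[int]_p) : dot (u - v) w = dot u w - dot v w.
Proof. by rewrite dotDl -scaleN1r dotZl mulN1r. Qed.

Lemma dot_mulmx d p (x : 'rV[int]_d) (G : 'M[int]_(d, p)) (v : 'rV[int]_p) :
  dot (x *m G) v = \sum_i x 0 i * dot (row i G) v.
Proof.
rewrite mulmx_sum_row /dot.
under eq_bigr => j _ do rewrite summxE mulr_suml.
rewrite exchange_big /=; apply: eq_bigr => i _; rewrite mulr_sumr.
by apply: eq_bigr => j _; rewrite !mxE mulrA.
Qed.

Lemma sq_ge0 p (u : 'rV[int]_p) : 0 <= sq u.
Proof. by apply: sumr_ge0 => j _; rewrite -expr2 sqr_ge0. Qed.

Lemma sq_eq0 p (u : 'rV[int]_p) : (sq u == 0) = (u == 0).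
Proof.
apply/idP/eqP => [|->]; last by rewrite /sq /dot big1 // => j _; rewrite mxE mul0r.
rewrite psumr_eq0 => [/allP H|j _]; last by rewrite -expr2 sqr_ge0.
apply/rowP => j; rewrite mxE; have := H j (mem_index_enum _).
by rewrite mulf_eq0 orbb => /eqP.
Qed.

Lemma sq_gt0 p (u : 'rV[int]_p) : (0 < sq u) = (u != 0).
Proof. by rewrite lt_def sq_ge0 andbT sq_eq0. Qed.

Lemma sqZ p c (u : 'rV[int]_p) : sq (c *: u) = c ^+ 2 * sq u.
Proof. by rewrite /sq dotZl dotZr mulrA expr2. Qed.

(** Cauchy-Schwarz, from the non-negativity of the double sum of (F i - F j)^2. *)
Lemma sqr_sum_le (I : finType) (F : I -> int) :
  (\sum_i F i) ^+ 2 <= #|I|%:R * \sum_i F i ^+ 2.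
Proof.
have sumr_card c : \sum_(i : I) (c : int) = #|I|%:R * c.
  by rewrite sumr_const mulr_natl.
have H : 0 <= \sum_i \sum_j (F i - F j) ^+ 2.
  by apply: sumr_ge0 => i _; apply: sumr_ge0 => j _; apply: sqr_ge0.
have E : \sum_i \sum_j (F i - F j) ^+ 2 =
   2 * (#|I|%:R * \sum_i F i ^+ 2) - 2 * (\sum_i F i) ^+ 2.
  have -> : \sum_i \sum_j (F i - F j) ^+ 2 = \sum_i \sum_(j : I) F i ^+ 2 +
     \sum_(i : I) \sum_j F j ^+ 2 - 2 * \sum_i \sum_j F i * F j.
    rewrite mulr_sumr -sumrN -!big_split /=; apply: eq_bigr => i _.
    rewrite mulr_sumr -sumrN -!big_split /=; apply: eq_bigr => j _; ring.
  rewrite sumr_card -big_distrlr /=; under eq_bigr => i _ do rewrite sumr_card.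
  rewrite -mulr_sumr; ring.
lia.
Qed.

Lemma exists_min (P : nat -> Prop) : (exists n, P n) ->
  exists2 n, P n & forall m, P m -> (n <= m)%N.
Proof.
case=> n; elim/ltn_ind: n => n IH Pn.
have [[m ltmn Pm]|H] := classic (exists2 m, (m < n)%N & P m); first exact: IH Pm.
by exists n => // m Pm; rewrite leqNgt; apply/negP => ltmn; apply: H; exists m.
Qed.

(** The Smith normal form of v as a matrix with one row; its left factor is a scalar and joins the
    coefficient k. *)
Lemma row_unimodular d (v : 'rV[int]_d.+1) :
  exists (R R' : 'M[int]_d.+1) k, [/\ R *m R' = 1%:M, R' *m R = 1%:M & v = k *: row 0 R].
Proof.
have [L _ [R uR [e _ ->]]] := int_Smith_normal_form v.
exists R, (invmx R), (L 0 0 * e`_0); split; rewrite ?mulmxV ?mulVmx //.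
have -> : \matrix_(i < 1, j < d.+1) (e`_i *+ (i == j :> nat)) = e`_0 *: delta_mx 0 0.
  by apply/matrixP => i j; rewrite !mxE ord1 eqxx /= mulr_natr eq_sym.
rewrite -scalemxAr -scalemxAl rowE [L]mx11_scalar -mul_scalar_mx -mulmxA.
rewrite !mul_scalar_mx scalerA mulrC mxE; congr (_ *: _).
Qed.

(** If v attains the least positive length, then v = k r with r the first row of a unimodular
    matrix, and r is not longer than v since k^2 >= 1. As G may have a kernel, only nonzero images
    compete. *)
Lemma shortest_row d p (G : 'M[int]_(d.+1, p)) : G != 0 ->
  exists R R' : 'M[int]_d.+1, [/\ R *m R' = 1%:M, R' *m R = 1%:M,
    row 0 (R *m G) != 0 &
    forall v, v *m G = 0 \/ sq (row 0 (R *m G)) <= sq (v *m G)].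
Proof.
move=> G0.
have [n [v vG0 vn] nmin] : exists2 n, (exists2 v, v *m G != 0 & `|sq (v *m G)|%N = n) &
    forall m, (exists2 v, v *m G != 0 & `|sq (v *m G)|%N = m) -> (n <= m)%N.
  apply: exists_min.
  have [i Hi] : exists i, row i G != 0.
    apply/existsP; apply: contraNT G0; rewrite negb_exists => /forallP H.
    by apply/eqP/row_matrixP => i; rewrite row0; apply/eqP; move: (H i); rewrite negbK.
  by exists `|sq (row i G)|%N, (delta_mx 0 i)%R; rewrite -?rowE.
have [R [R' [k [RR' R'R vE]]]] := row_unimodular v.
have rE : row 0 (R *m G) = row 0 R *m G by rewrite row_mul.
exists R, R'; split=> //; rewrite rE.
  by apply: contraNneq vG0 => H; rewrite vE -scalemxAl H scaler0.
move=> w; have [->|w0] := eqVneq (w *m G) 0; first by left.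
right; have := nmin _ (ex_intro2 _ _ w w0 erefl).
move: vn; rewrite vE -scalemxAl sqZ => vn.
have k0 : k != 0 by apply: contraNneq vG0 => k00; rewrite vE k00 scale0r mul0mx.
have k1 : 1 <= k ^+ 2.
  have : 0 < k ^+ 2 by rewrite exprn_even_gt0.
  lia.
have s0 := sq_ge0 (row 0 R *m G); have s1 := sq_ge0 (w *m G).
have : sq (row 0 R *m G) <= k ^+ 2 * sq (row 0 R *m G) by rewrite ler_peMl.
lia.
Qed.

Fixpoint red_const (d : nat) : nat := if d is d'.+1 then (d' + 2) * red_const d' else 2.

Lemma red_const_ge2 d : (2 <= red_const d)%N.
Proof. by elim: d => //= d IH; nia. Qed.

(** The quotient taken is an integer nearest to z / a, so the error is at most a / 2 in absolute
    value. *)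
Lemma nearest_quotient (z a : int) : 0 < a ->
  4 * (z - a * ((2 * z + a) %/ (2 * a))%Z) ^+ 2 <= a ^+ 2.
Proof.
move=> a0; have m0 : 2 * a != 0 by lia.
have := divz_eq (2 * z + a) (2 * a); have := modz_ge0 (2 * z + a) m0.
have : ((2 * z + a) %% (2 * a))%Z < 2 * a by apply: ltz_pmod; lia.
move: (_ %/ _)%Z (_ %% _)%Z => q y y1 y2 y3.
have [h1 h2] : 2 * (z - a * q) <= a /\ - a <= 2 * (z - a * q) by lia.
nia.
Qed.

(* Hermite-Korkine-Zolotareff reduction: start the basis with a shortest      *)
(* vector [w] and lift a reduced basis of the projection orthogonal to [w],   *)
(* which is scaled by [sq w] to stay integral.                                *)
Lemma reduced_basis d : forall p (G : 'M[int]_(d, p)), exists g g' : 'M[int]_d,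
  [/\ g *m g' = 1%:M, g' *m g = 1%:M & forall x : 'rV_d,
   \sum_i x 0 i ^+ 2 * sq (row i (g *m G)) <= (red_const d)%:Z * sq (x *m g *m G)].
Proof.
elim: d => [|d IH] p G.
  by exists 1%:M, 1%:M; split=> [||x]; rewrite ?mulmx1 // big_ord0 mulr_ge0 ?sq_ge0.
have [->|G0] := eqVneq G 0.
  exists 1%:M, 1%:M; split=> [||x]; rewrite ?mulmx1 // !mulmx0.
  rewrite big1 ?mulr_ge0 ?sq_ge0 // => i _.
  by rewrite row0 (_ : sq 0 = 0) ?mulr0 //; apply/eqP; rewrite sq_eq0.
have [R [R' [RR' R'R w0 wmin]]] := shortest_row G0.
set w := row 0 (R *m G) in w0 wmin.
set al := sq w in wmin.
have al0 : 0 < al by rewrite sq_gt0.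
pose G2 : 'M[int]_(d, p) := dsubmx ((R *m G) : 'M_(1 + d, p)).
have RGE : (R *m G : 'M_(1 + d, p)) = col_mx w G2.
  rewrite -[LHS](@vsubmxK _ 1 d); congr col_mx; apply/rowP => j.
  by rewrite [LHS]mxE [RHS]mxE; congr ((R *m G) _ j); apply/val_inj.
pose be (H : 'M[int]_(d, p)) : 'cV[int]_d := \col_i dot (row i H) w.
(* The rows of G2 projected orthogonally to w and scaled by al. *)
pose Gb : 'M[int]_(d, p) := al *: G2 - be G2 *m w.
have [g2 [g2' [g22' g2'2 IHg]]] := IH p Gb.
pose b3 := be (g2 *m G2).
(* nearest integers to b3 / al *)
pose t : 'cV[int]_d := \col_i ((2 * b3 i ord0 + al) %/ (2 * al))%Z.
pose G4 := g2 *m G2 - t *m w.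
pose b4 := be G4.
have beM (h : 'M_d) H : be (h *m H) = h *m be H.
  apply/colP => i; rewrite !mxE row_mul dot_mulmx; apply: eq_bigr => j _.
  by rewrite !mxE.
have beB H H' : be (H - H') = be H - be H'.
  by apply/colP => i; rewrite !mxE linearB /= dotBl.
have bew (u : 'cV_d) : be (u *m w) = al *: u.
  apply/colP => i; rewrite !mxE row_mul.
  have -> : row i u *m w = u i 0 *: w.
    by rewrite [row i u]mx11_scalar mul_scalar_mx mxE.
  by rewrite dotZl mulrC.
have b4E : b4 = b3 - al *: t by rewrite /b4 beB bew.
have b4le i : 4 * b4 i 0 ^+ 2 <= al ^+ 2.
  rewrite b4E !mxE -/b3.
  exact: nearest_quotient.
have gbE : g2 *m Gb = al *: G4 - b4 *m w.
  rewrite /Gb mulmxBr -scalemxAr mulmxA -beM -/b3 b4E /G4.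
  rewrite scalerBr mulmxBl -scalemxAl; move: (_ *m _) (_ *m _) (_ *: _) => A B C.
  by rewrite opprB addrA subrK.
have gb_orth i : dot (row i (g2 *m Gb)) w = 0.
  rewrite gbE linearB linearZ /= dotBl dotZl row_mul.
  have -> : row i b4 *m w = b4 i 0 *: w.
    by rewrite [row i b4]mx11_scalar mul_scalar_mx mxE.
  by rewrite dotZl -/(sq w) -/al mxE mulrC subrr.
pose P : 'M[int]_(1 + d) := block_mx 1%:M 0 (- t) g2.
pose P' : 'M[int]_(1 + d) := block_mx 1%:M 0 (g2' *m t) g2'.
have PP' : P *m P' = 1%:M.
  rewrite mulmx_block !mul1mx !mulmx1 !mul0mx !mulmx0 !addr0 add0r g22' mulmxA g22'.
  by rewrite mul1mx addNr -scalar_mx_block.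
exists ((P : 'M_d.+1) *m R), (R' *m (P' : 'M_d.+1)).
have HPR : (P : 'M_d.+1) *m R *m (R' *m (P' : 'M_d.+1)) = 1%:M.
  by rewrite mulmxA -(mulmxA _ R) RR' mulmx1.
split=> [||x]; [exact: HPR|exact: mulmx1C|].
have bE : (P : 'M_d.+1) *m R *m G = col_mx w G4.
  rewrite -mulmxA; transitivity (P *m (R *m G : 'M_(1 + d, p))); first by [].
  by rewrite RGE mul_block_col mul1mx mul0mx addr0 mulNmx addrC.
rewrite -[x *m _ *m _]mulmxA bE.
pose x0 := x 0 0; pose x2 : 'rV_d := rsubmx (x : 'rV_(1 + d)).
have xE : (x : 'rV_(1 + d)) = row_mx x0%:M x2.
  rewrite -[LHS](@hsubmxK _ _ 1 d); congr row_mx; rewrite [LHS]mx11_scalar; congr _%:M.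
  by rewrite mxE; congr (x _ _); apply/val_inj.
set V := x *m _.
have VE : V = x0 *: w + x2 *m G4.
  transitivity ((x : 'rV_(1 + d)) *m (col_mx w G4)); first by [].
  by rewrite xE mul_row_col mul_scalar_mx.
pose z := x2 *m g2 *m Gb.
pose c := (x2 *m b4) 0 0.
have aV : al *: V = (al * x0 + c) *: w + z.
  rewrite VE scalerDr scalerA scalerDl -addrA; congr (_ + _).
  rewrite /z -mulmxA gbE [x2 *m (_ *: _ - _)]mulmxBr -scalemxAr mulmxA.
  by rewrite [x2 *m b4]mx11_scalar mul_scalar_mx addrC subrK.
have zw : dot z w = 0.
  by rewrite /z -mulmxA dot_mulmx big1 // => i _; rewrite gb_orth mulr0.
(* Pythagoras for al V, split along w and orthogonally to w. *)
have E1 : al ^+ 2 * sq V = (al * x0 + c) ^+ 2 * al + sq z.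
  rewrite -sqZ aV /sq !dotDl !dotDr !dotZl !dotZr -/(sq w) -/(sq z) -/al.
  by rewrite [dot w z]dotC zw; ring.
pose bb i := sq (row i (g2 *m Gb)).
have E2 i : al ^+ 2 * sq (row i G4) = bb i + b4 i 0 ^+ 2 * al.
  rewrite -sqZ.
  have -> : al *: row i G4 = b4 i 0 *: w + row i (g2 *m Gb).
    have -> : row i (g2 *m Gb) = al *: row i G4 - row i (b4 *m w).
      by rewrite gbE; apply/rowP => j; rewrite !mxE.
    rewrite row_mul.
    by rewrite [row i b4]mx11_scalar mul_scalar_mx [row i b4 0 0]mxE addrC subrK.
  rewrite /bb /sq !dotDl !dotDr !dotZl !dotZr -/(sq w) -/al.
  by rewrite [dot w (row _ _)]dotC gb_orth; ring.
have bb0 i : 0 <= bb i by apply: sq_ge0.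
have nz i : row i G4 = 0 \/ al <= sq (row i G4).
  have -> : row i G4 = ((delta_mx 0 (rshift 1 i) : 'rV_(1 + d)) *m P : 'rV_d.+1) *m R *m G.
    rewrite -mulmxA.
    transitivity ((delta_mx 0 (rshift 1 i) : 'rV_(1 + d)) *m P *m
      (R *m G : 'M_(1 + d, p))); last by [].
    rewrite RGE -mulmxA mul_block_col mul1mx mul0mx addr0 mulNmx addrC -/G4 -rowE.
    by rewrite rowKd.
  exact: wmin.
(* A nonzero row is at least as long as w and has its coefficient along w rounded, |b4| <= al / 2,
   so at least three quarters of its squared length are orthogonal to w. *)
have E3 i : 3 * al ^+ 2 * sq (row i G4) <= 4 * bb i /\ 3 * (al * b4 i 0 ^+ 2) <= bb i.
  have [r0|ri] := nz i.
    have b0 : b4 i 0 = 0 by rewrite /b4 mxE r0 /dot big1 // => j _; rewrite mxE mul0r.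
    by have := bb0 i; rewrite b0 r0 (_ : sq 0 = 0) ?mulr0 //; [lia|apply/eqP; rewrite sq_eq0].
  have := E2 i; have := b4le i; move: ri al0.
  move: (sq _) (bb i) (b4 i 0) (al) => S Bb bq a h1 h2 h3 h4.
  have h5 : a * (4 * bq ^+ 2) <= a * a ^+ 2 by rewrite ler_pM2l.
  have h6 : a ^+ 2 * a <= a ^+ 2 * S by rewrite ler_wpM2l ?sqr_ge0.
  by split; nia.
pose S1 := \sum_i x2 0 i ^+ 2 * sq (row i G4).
pose Zb := \sum_i x2 0 i ^+ 2 * bb i.
have F1 : 3 * al ^+ 2 * S1 <= 4 * Zb.
  rewrite !mulr_sumr; apply: ler_sum => i _.
  rewrite mulrCA [4 * _]mulrCA ler_wpM2l ?sqr_ge0 //; by have [] := E3 i.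
have F2 : 3 * (al * c ^+ 2) <= d%:Z * Zb.
  have -> : c = \sum_i x2 0 i * b4 i 0 by rewrite /c mxE.
  have := sqr_sum_le (fun i => x2 0 i * b4 i 0); rewrite card_ord => H.
  apply: (@le_trans _ _ (3 * (al * (d%:R * \sum_i (x2 0 i * b4 i 0) ^+ 2)))).
    by rewrite ler_pM2l // ler_pM2l.
  rewrite [X in X <= _](_ : _ = d%:Z * \sum_i (3 * (al * (x2 0 i * b4 i 0) ^+ 2))); last first.
    by rewrite -mulr_sumr -mulr_sumr natz; ring.
  rewrite ler_wpM2l //; apply: ler_sum => i _; have [_] := E3 i => H3.
  rewrite exprMn (_ : 3 * _ = x2 0 i ^+ 2 * (3 * (al * b4 i 0 ^+ 2))); last by ring.
  by rewrite ler_wpM2l ?sqr_ge0.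
have F3 : Zb <= (red_const d)%:Z * sq z := IHg x2.
rewrite big_ord_recl.
have -> : row 0 (col_mx w G4 : 'M_(d.+1, p)) = w.
  transitivity (row (lshift d (0 : 'I_1)) (col_mx w G4)).
    by congr row; exact/val_inj.
  by rewrite rowKu; apply/rowP => j; rewrite [LHS]mxE.
rewrite (_ : \sum_(i < d) _ = S1); last first.
  apply: eq_bigr => i _; congr (_ * _); [congr (_ ^+ 2)|congr sq].
    by rewrite mxE; congr (x _ _); apply/val_inj.
  transitivity (row (rshift 1 i) (col_mx w G4)); last by rewrite rowKd.
  by congr row; exact/val_inj.
rewrite -/x0 -/al.
have al2 : 0 < al ^+ 2 by rewrite exprn_gt0.
rewrite -(ler_pM2l al2) (mulrCA (al ^+ 2)) E1.
have C2 := red_const_ge2 d.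
have z0 := sq_ge0 z.
have y0 : 0 <= al * (al * x0 + c) ^+ 2 by rewrite mulr_ge0 ?sqr_ge0 // ltW.
(* The inequality (p - q)^2 <= 2 p^2 + 2 q^2 with p = al x0 + c and q = c. *)
have G1 : al ^+ 2 * (x0 ^+ 2 * al) <= 2 * (al * (al * x0 + c) ^+ 2) + 2 * (al * c ^+ 2).
  have : 0 <= al * (al * x0 + 2 * c) ^+ 2 by rewrite mulr_ge0 ?sqr_ge0 // ltW.
  lia.
rewrite /= PoszM PoszD.
have F4 : d%:Z * Zb <= d%:Z * ((red_const d)%:Z * sq z) by rewrite ler_wpM2l.
have F5 : 2 * (al * (al * x0 + c) ^+ 2) <=
    (red_const d)%:Z * (al * (al * x0 + c) ^+ 2) by rewrite ler_wpM2r // lez_nat.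
have F6 : 0 <= d%:Z * ((red_const d)%:Z * (al * (al * x0 + c) ^+ 2)).
  by rewrite mulr_ge0 // mulr_ge0.
have F7 : 0 <= d%:Z * ((red_const d)%:Z * sq z) by rewrite !mulr_ge0.
rewrite mulrDr.
lia.
Qed.

(** Dominates every power of t with exponent up to 100 t, so that the exponents arising below need
    only crude estimates. *)
Definition pow_grow (t : nat) : nat := (t.+1 ^ (100 * t))%N.

Lemma good_pow_grow : good pow_grow.
Proof. by apply: good_exp good_id _; apply: good_mulc => //; apply: good_id. Qed.

Lemma expn_le_pow_grow t k : (k <= 100 * t -> t ^ k <= pow_grow t)%N.
Proof.
case: k => [|k] kt; first by rewrite /pow_grow expn_gt0.
apply: (@leq_trans (t.+1 ^ k.+1)); first by rewrite leq_exp2r.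
by rewrite leq_pexp2l.
Qed.

Lemma mxle_mono B B' p q (M : 'M[int]_(p, q)) : mxle B M -> (B <= B')%N -> mxle B' M.
Proof. by move=> MB BB' i j; apply: leq_trans (MB i j) BB'. Qed.

Lemma mxle_mul t a b p q r (M : 'M[int]_(p, q)) (M' : 'M[int]_(q, r)) :
  (q <= t)%N -> mxle (t ^ a) M -> mxle (t ^ b) M' -> mxle (t ^ (1 + a + b)) (M *m M').
Proof.
move=> qt HM HM' i j; rewrite mxE.
have : (`|(\sum_k M i k * M' k j)%R| <= #|'I_q| * (t ^ a * t ^ b))%N.
  by apply: absz_sum_le => k; rewrite abszM leq_mul.
by move/leq_trans; apply; rewrite card_ord -!addnA expnD expn1 expnD leq_mul2r qt orbT.
Qed.

Lemma absz_add_le (x y : int) B :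
  (`|x| <= B -> `|y| <= B -> `|(x + y)%R| <= 2 * B)%N.
Proof. lia. Qed.

Lemma mxle_add t a p q (M M' : 'M[int]_(p, q)) :
  (1 < t)%N -> mxle (t ^ a) M -> mxle (t ^ a) M' -> mxle (t ^ (1 + a)) (M + M').
Proof.
move=> t1 HM HM' i j; rewrite mxE expnD expn1.
have : (2 * t ^ a <= t * t ^ a)%N by rewrite leq_mul2r t1 orbT.
by move/(leq_trans _); apply; apply: absz_add_le.
Qed.

Lemma mxle_opp B p q (M : 'M[int]_(p, q)) : mxle B M -> mxle B (- M).
Proof. by move=> HM i j; rewrite mxE abszN. Qed.

(** * Matrices bounded relative to successive minima *)

(** The bound obeyed by the coordinates of vectors of squared length about lam i in a nearly
    orthogonal basis of squared lengths about mu j. Such bounds compose ([lbd_mul]), as the lengths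
    in the middle cancel. *)
Definition lbd (K : nat) (lam mu : nat -> nat) p q (M : 'M[int]_(p, q)) : Prop :=
  forall i j, (`|M i j| ^ 2 * mu j <= K * lam i)%N.

Lemma lbd_mono K K' lam mu p q (M : 'M[int]_(p, q)) :
  lbd K lam mu M -> (K <= K')%N -> lbd K' lam mu M.
Proof. by move=> H KK' i j; apply: leq_trans (H i j) _; rewrite leq_mul2r KK' orbT. Qed.

Lemma sqrn_sum_le (I : finType) (F : I -> int) :
  (`|(\sum_i F i)%R| ^ 2 <= #|I| * \sum_i `|F i| ^ 2)%N.
Proof.
have := sqr_sum_le F.
have -> : \sum_i F i ^+ 2 = ((\sum_i `|F i| ^ 2)%N)%:Z.
  by rewrite -natz natr_sum; apply: eq_bigr => i _; rewrite natz -abszX gez0_abs ?sqr_ge0.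
have -> : (\sum_i F i) ^+ 2 = ((`|(\sum_i F i)%R| ^ 2)%N)%:Z.
  by rewrite -abszX gez0_abs ?sqr_ge0.
by rewrite natz -PoszM lez_nat.
Qed.

Lemma lbd_sum t a lam mu p q (I : finType) (M : I -> 'M[int]_(p, q)) :
  (#|I| <= t)%N -> (forall i, lbd (t ^ a) lam mu (M i)) ->
  lbd (t ^ (2 + a)) lam mu (\sum_i M i).
Proof.
move=> It HM i j; rewrite summxE.
apply: (@leq_trans ((#|I| * \sum_k `|M k i j| ^ 2) * mu j)%N).
  by rewrite leq_mul2r sqrn_sum_le orbT.
rewrite -mulnA big_distrl /=.
apply: (@leq_trans (#|I| * (#|I| * (t ^ a * lam i)))%N).
  rewrite leq_mul2l; apply/orP; right.
  apply: leq_trans (leq_sum _ (fun k _ => HM k i j)) _.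
  by rewrite sum_nat_const.
by rewrite expnD !mulnA leq_mul2r leq_mul2r expnS expn1 leq_mul ?orbT.
Qed.

Lemma lbd_mul t a b lam mu nu p q r (M : 'M[int]_(p, q)) (M' : 'M[int]_(q, r)) :
  (q <= t)%N -> lbd (t ^ a) lam mu M -> lbd (t ^ b) mu nu M' ->
  lbd (t ^ (2 + a + b)) lam nu (M *m M').
Proof.
move=> qt HM HM'.
have -> : M *m M' = \sum_k \matrix_(i, j) (M i k * M' k j).
  by apply/matrixP => i j; rewrite mxE summxE; apply: eq_bigr => k _; rewrite mxE.
rewrite -addnA; apply: lbd_sum; rewrite ?card_ord // => k i j; rewrite mxE abszM expnMn.
apply: (@leq_trans (`|M i k| ^ 2 * (t ^ b * mu k))%N).
  by rewrite -mulnA leq_mul2l HM' orbT.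
by rewrite mulnCA addnC expnD -mulnA leq_mul2l HM orbT.
Qed.

Lemma lbd_opp K lam mu p q (M : 'M[int]_(p, q)) : lbd K lam mu M -> lbd K lam mu (- M).
Proof. by move=> HM i j; rewrite mxE abszN. Qed.

Lemma lbd_scale t a c lam mu p q (M : 'M[int]_(p, q)) :
  (`|c| <= t)%N -> lbd (t ^ a) lam mu M -> lbd (t ^ (2 + a)) lam mu (c *: M).
Proof.
move=> ct HM i j; rewrite mxE abszM expnMn expnD -mulnA -[X in (_ <= X)%N]mulnA.
by apply: leq_mul; [rewrite leq_exp2r|exact: HM].
Qed.

Lemma lbd_one t lam p : (0 < t)%N -> lbd (t ^ 0) lam lam (1%:M : 'M[int]_p).
Proof. by move=> t0 i j; rewrite !mxE; case: eqP => [->|_]. Qed.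

Lemma lbd_zero K lam mu p q : lbd K lam mu (0 : 'M[int]_(p, q)).
Proof. by move=> i j; rewrite mxE. Qed.

Definition shiftf (d : nat) (lam : nat -> nat) : nat -> nat := fun i => lam (d + i)%N.

Lemma lbd_block K lam mu p1 p2 q1 q2 (A : 'M[int]_(p1, q1)) (B : 'M[int]_(p1, q2))
    (C : 'M[int]_(p2, q1)) (D : 'M[int]_(p2, q2)) :
  lbd K lam mu (block_mx A B C D) <->
  [/\ lbd K lam mu A, lbd K lam (shiftf q1 mu) B, lbd K (shiftf p1 lam) mu C &
      lbd K (shiftf p1 lam) (shiftf q1 mu) D].
Proof.
split=> [H|[HA HB HC HD] i j].
  split=> i j.
  - by have := H (lshift _ i) (lshift _ j); rewrite block_mxEul.
  - by have := H (lshift _ i) (rshift _ j); rewrite block_mxEur.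
  - by have := H (rshift _ i) (lshift _ j); rewrite block_mxEdl.
  - by have := H (rshift _ i) (rshift _ j); rewrite block_mxEdr.
rewrite -[i]splitK -[j]splitK; case: (split i) => i'; case: (split j) => j' /=.
- by rewrite block_mxEul.
- by rewrite block_mxEur.
- by rewrite block_mxEdl.
- by rewrite block_mxEdr.
Qed.

Lemma mxle_block K p1 p2 q1 q2 (A : 'M[int]_(p1, q1)) (B : 'M[int]_(p1, q2))
    (C : 'M[int]_(p2, q1)) (D : 'M[int]_(p2, q2)) :
  mxle K (block_mx A B C D) <-> [/\ mxle K A, mxle K B, mxle K C & mxle K D].
Proof.
split=> [H|[HA HB HC HD] i j].
  split=> i j.
  - by have := H (lshift _ i) (lshift _ j); rewrite block_mxEul.
  - by have := H (lshift _ i) (rshift _ j); rewrite block_mxEur.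
  - by have := H (rshift _ i) (lshift _ j); rewrite block_mxEdl.
  - by have := H (rshift _ i) (rshift _ j); rewrite block_mxEdr.
rewrite -[i]splitK -[j]splitK; case: (split i) => i'; case: (split j) => j' /=.
- by rewrite block_mxEul.
- by rewrite block_mxEur.
- by rewrite block_mxEdl.
- by rewrite block_mxEdr.
Qed.

Definition scale_seq (d : nat) (lam : nat -> nat) : Prop :=
  (forall i, (i < d)%N -> (0 < lam i)%N) /\
  (forall i j, (i <= j < d)%N -> (lam i <= lam j)%N).

Lemma scale_seq_shift d1 d2 lam :
  scale_seq (d1 + d2) lam -> scale_seq d2 (shiftf d1 lam).
Proof.
by case=> H1 H2; split=> [i Hi|i j Hij]; [apply: H1|apply: H2]; lia.
Qed.

(** Take the least place where the sequence grows by more than the factor K; before it at most d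
    factors K accumulate. *)
Lemma first_gap K d lam : (0 < d)%N -> scale_seq d lam -> (0 < K)%N ->
  exists d1, [/\ (0 < d1 <= d)%N, (forall i j, (i < d1 -> j < d1 -> lam i <= K ^ d * lam j)%N) &
    d1 = d \/ (forall i j, (i < d1 -> d1 <= j < d -> K * lam i < lam j)%N)].
Proof.
move=> d0 [pos mono] K0.
pose P k := (0 < k <= d)%N && ((k == d) || (K * lam k.-1 < lam k)%N).
have exP : exists k, P k by exists d; rewrite /P d0 leqnn eqxx.
case: (ex_minnP exP) => d1 /andP [Hd1 Pd1] d1min.
exists d1; split=> //.
  have step k : (k < d1)%N -> (lam k <= K ^ k * lam 0%N)%N.
    elim: k => [|k IH] Hk; first by rewrite mul1n.
    have Hk' := IH (ltnW Hk).
    have : ~~ P k.+1 by apply/negP => /d1min; lia.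
    rewrite /P; have -> : (0 < k.+1 <= d)%N by lia.
    rewrite negb_or -leqNgt => /andP [_ H]; apply: leq_trans H _.
    by rewrite expnS -mulnA leq_mul2l Hk' orbT.
  move=> i j Hi Hj; apply: leq_trans (step i Hi) _.
  apply: leq_mul; first by rewrite leq_pexp2l //; lia.
  by apply: mono; lia.
case/orP: Pd1 => [/eqP|gap]; [by left|right => i j Hi Hj].
apply: leq_ltn_trans (_ : K * lam d1.-1 < _)%N; last first.
  by apply: leq_trans gap _; apply: mono; lia.
by rewrite leq_mul2l mono ?orbT //; lia.
Qed.

Lemma lbd_mxle_comparable s d (lam : nat -> nat) p q (M : 'M[int]_(p, q)) : (0 < s)%N ->
  (forall i : 'I_p, (0 < lam i)%N) ->
  (forall (i : 'I_p) (j : 'I_q), (lam i <= s ^ d * lam j)%N) ->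
  lbd s lam lam M -> mxle (s ^ d.+1) M.
Proof.
move=> s0 pos comp HM i j.
have H : (`|M i j| ^ 2 * lam j <= s ^ d.+1 * lam j)%N.
  apply: leq_trans (HM i j) _; rewrite expnS -mulnA leq_mul2l comp orbT //.
have lj : (0 < lam j)%N.
  by have := comp i j; have := pos i; case: (lam j) => //; rewrite muln0; lia.
rewrite leq_pmul2r // in H; apply: leq_trans H.
by case: `|M i j|%N => // n; rewrite expnS expn1 leq_pmulr.
Qed.

(** A nonzero integer has square at least 1, too much for the bound across a gap. *)
Lemma lbd_gap_eq0 s (lam mu : nat -> nat) p q (M : 'M[int]_(p, q)) :
  (forall (i : 'I_p) (j : 'I_q), (s * lam i < mu j)%N) ->
  lbd s lam mu M -> M = 0.
Proof.
move=> gap HM; apply/matrixP => i j; rewrite mxE; apply/eqP/contraT => Mij.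
have := HM i j; have := gap i j.
have : (1 <= `|M i j| ^ 2)%N by rewrite expn_gt0; lia.
nia.
Qed.

(** * Casimir tensors and normalisation at gaps *)

(* [a j] is the matrix of right multiplication by the j-th basis element of   *)
(* an order, in row convention: e_i e_j = sum_k (a j i k) e_k; [eps] is 1.    *)
Definition is_rep e (a : 'I_e -> 'M[int]_e) (eps : 'rV[int]_e) n
    (R : 'I_e -> 'M[int]_n) : Prop :=
  (forall i j, R i *m R j = \sum_k a j i k *: R k) /\ \sum_k eps 0 k *: R k = 1%:M.

(* sum_ij c_ij e_i (x) e_j is a central tensor whose product is [del]. *)
Definition casimir e (a : 'I_e -> 'M[int]_e) (eps : 'rV[int]_e) (c : 'M[int]_e)
    (del : int) : Prop :=
  [/\ del != 0, forall k l j, \sum_i a i k l * c i j = \sum_i c l i * a k i j &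
    forall l, \sum_i \sum_j c i j * a j i l = del * eps 0 l].

(** Summing over the tensor plays the role of averaging over a finite group; centrality of the
    tensor carries R k across. *)
Lemma casimir_intertwines e a eps c del n1 n2 (R : 'I_e -> 'M[int]_n1)
    (R' : 'I_e -> 'M[int]_n2) (X : 'M[int]_(n1, n2)) k :
  casimir a eps c del -> is_rep a eps R -> is_rep a eps R' ->
  let P := \sum_i \sum_j c i j *: (R i *m X *m R' j) in
  R k *m P = P *m R' k.
Proof.
move=> [_ cas _] [RR _] [RR' _] P.
transitivity (\sum_l \sum_j (\sum_i a i k l * c i j) *: (R l *m X *m R' j)).
  rewrite /P mulmx_sumr.
  under eq_bigr => i _ do rewrite mulmx_sumr.
  transitivity (\sum_i \sum_j \sum_l (a i k l * c i j) *: (R l *m X *m R' j)).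
    apply: eq_bigr => i _; apply: eq_bigr => j _.
    rewrite -scalemxAr !mulmxA RR !mulmx_suml scaler_sumr.
    by apply: eq_bigr => l _; rewrite -!scalemxAl scalerA mulrC.
  under eq_bigr => i _ do rewrite exchange_big /=.
  rewrite exchange_big /=; apply: eq_bigr => l _.
  by rewrite exchange_big /=; apply: eq_bigr => j _; rewrite scaler_suml.
rewrite /P mulmx_suml; apply: eq_bigr => l _; rewrite mulmx_suml.
transitivity (\sum_i \sum_j (c l i * a k i j) *: (R l *m X *m R' j)).
  rewrite exchange_big /=; apply: eq_bigr => j _.
  by rewrite cas scaler_suml.
apply: eq_bigr => i _; rewrite -scalemxAl -mulmxA RR' mulmx_sumr scaler_sumr.
by apply: eq_bigr => j _; rewrite -scalemxAr scalerA.
Qed.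

Lemma casimir_id e a eps c del n (R : 'I_e -> 'M[int]_n) :
  casimir a eps c del -> is_rep a eps R ->
  \sum_i \sum_j c i j *: (R i *m R j) = del%:M.
Proof.
move=> [_ _ cas] [RR R1].
transitivity (\sum_l (\sum_i \sum_j c i j * a j i l) *: R l).
  transitivity (\sum_i \sum_j \sum_l (c i j * a j i l) *: R l).
    apply: eq_bigr => i _; apply: eq_bigr => j _; rewrite RR scaler_sumr.
    by apply: eq_bigr => l _; rewrite scalerA.
  under eq_bigr => i _ do rewrite exchange_big /=.
  rewrite exchange_big /=; apply: eq_bigr => l _; rewrite scaler_suml.
  by apply: eq_bigr => i _; rewrite scaler_suml.
under eq_bigr => l _ do rewrite cas -scalerA.
by rewrite -scaler_sumr R1 scalemx1.
Qed.

Lemma is_rep_conj e a eps n (R : 'I_e -> 'M[int]_n) (h h' : 'M[int]_n) :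
  h *m h' = 1%:M -> is_rep a eps R -> is_rep a eps (fun k => h *m R k *m h').
Proof.
move=> hh' [RR R1]; have h'h : h' *m h = 1%:M by apply: mulmx1C.
split=> [i j|].
  rewrite -!mulmxA (mulmxA h' h) h'h mul1mx (mulmxA (R i)) RR mulmx_suml mulmx_sumr.
  by apply: eq_bigr => k _; rewrite -scalemxAl -scalemxAr mulmxA.
under eq_bigr => k _ do rewrite scalemxAl scalemxAr.
by rewrite -mulmx_suml -mulmx_sumr R1 mulmx1.
Qed.

Lemma is_rep_block e a eps n1 n2 (T1 : 'I_e -> 'M[int]_n1)
    (R : 'I_e -> 'M[int]_(n2, n1)) (T2 : 'I_e -> 'M[int]_n2) :
  is_rep a eps (fun k => block_mx (T1 k) 0 (R k) (T2 k)) ->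
  is_rep a eps T1 /\ is_rep a eps T2.
Proof.
have sumE (x : 'I_e -> int) : \sum_k x k *: block_mx (T1 k) 0 (R k) (T2 k) =
  block_mx (\sum_k x k *: T1 k) 0 (\sum_k x k *: R k) (\sum_k x k *: T2 k).
  under eq_bigr => k _ do rewrite scale_block_mx scaler0.
  elim: (index_enum _) => [|k r IH]; first by rewrite !big_nil block_mx0.
  by rewrite !big_cons IH add_block_mx addr0.
case=> RR R1; split; split.
- move=> i j; have := RR i j; rewrite mulmx_block sumE !mul0mx !addr0.
  by case/eq_block_mx.
- by move: R1; rewrite sumE scalar_mx_block => /eq_block_mx [].
- move=> i j; have := RR i j; rewrite mulmx_block sumE !mulmx0 !add0r.
  by case/eq_block_mx.
- by move: R1; rewrite sumE scalar_mx_block => /eq_block_mx [].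
Qed.

(** An analogue of Maschke's theorem. The projection onto the coordinates of T1 averages to an
    intertwiner with blocks del and P, so del times the off-diagonal block is the coboundary of
    P. *)
Lemma casimir_split e a eps c del n1 n2 (T1 : 'I_e -> 'M[int]_n1)
    (R : 'I_e -> 'M[int]_(n2, n1)) (T2 : 'I_e -> 'M[int]_n2) k :
  casimir a eps c del ->
  is_rep a eps (fun k => block_mx (T1 k) 0 (R k) (T2 k)) ->
  let P := \sum_i \sum_j c i j *: (R i *m T1 j) in
  del *: R k = P *m T1 k - T2 k *m P.
Proof.
move=> cas rep P; have [rep1 _] := is_rep_block rep.
have := casimir_intertwines (col_mx 1%:M 0) k cas rep rep1 => /=.
rewrite [X in _ *m X = _](_ : _ = col_mx del%:M P).
  rewrite [X in _ = X *m _](_ : _ = col_mx del%:M P).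
    rewrite mul_block_col mul_col_mx mul0mx addr0 => /eq_col_mx [_ <-].
    by rewrite mul_mx_scalar addrK.
all: rewrite -(casimir_id cas rep1) /P.
all: transitivity (\sum_i col_mx (\sum_j c i j *: (T1 i *m T1 j)) (\sum_j c i j *: (R i *m T1 j)));
  last by elim/big_rec3: _ => [|i y1 y2 y3 _ ->]; rewrite ?col_mx0 // add_col_mx.
all: apply: eq_bigr => i _.
all: transitivity (\sum_j col_mx (c i j *: (T1 i *m T1 j)) (c i j *: (R i *m T1 j)));
  last by elim/big_rec3: _ => [|j y1 y2 y3 _ ->]; rewrite ?col_mx0 // add_col_mx.
all: apply: eq_bigr => j _.
all: by rewrite mul_block_col mulmx1 mul0mx addr0 mulmx1 mulmx0 addr0 mul_col_mx scale_col_mx.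
Qed.

Lemma zscalemx_inj p q (c : int) (M N : 'M[int]_(p, q)) : c != 0 -> c *: M = c *: N -> M = N.
Proof.
move=> c0 /matrixP H; apply/matrixP => i j; have := H i j; rewrite !mxE.
exact: mulfI.
Qed.

Lemma absz_divz_le (x y : int) : (`|(x %/ y)%Z| <= `|x|)%N.
Proof.
have [->|y0] := eqVneq y 0; first by rewrite divz0.
have := divz_eq x y; have := modz_ge0 x y0; have := ltz_mod x y0.
move: (_ %/ _)%Z (_ %% _)%Z => q r; nia.
Qed.

Lemma lbd_dom K lam mu p q (M M' : 'M[int]_(p, q)) :
  (forall i j, (`|M i j| <= `|M' i j|)%N) -> lbd K lam mu M' -> lbd K lam mu M.
Proof.
move=> dom H i j; apply: leq_trans (H i j).
by rewrite leq_mul2r leq_exp2r // dom orbT.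
Qed.

Lemma iter_good_le f k x : good f -> (x <= iter k f x)%N.
Proof.
by move=> gf; elim: k => //= k IH; apply: leq_trans IH (good_infl _ gf).
Qed.

Lemma block_rep_lower s d1 d2 lam e (R : 'I_e -> 'M[int]_(d1 + d2)) :
  (forall i j, (i < d1 -> d1 <= j < d1 + d2 -> s * lam i < lam j)%N) ->
  (forall k, lbd s lam lam (R k)) ->
  forall k, R k = block_mx (ulsubmx (R k)) 0 (dlsubmx (R k)) (drsubmx (R k)).
Proof.
move=> gap HR k; rewrite -[LHS]submxK; congr block_mx.
apply: (@lbd_gap_eq0 s lam (shiftf d1 lam)) => [i j|].
  apply: gap; first exact: ltn_ord.
  by rewrite leq_addr ltn_add2l ltn_ord.
by have := HR k; rewrite -{1}[R k]submxK => /lbd_block [].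
Qed.

(** At the first gap integrality makes the action block triangular; the first diagonal block has no
    gaps and is bounded, the second is normalised by recursion. The off-diagonal block is, up to
    del, the coboundary of P. A unipotent change of basis replaces P by its remainder modulo del,
    which is bounded; the quotient used for this obeys the same relative bound as P, so the basis
    stays reduced. *)
Lemma normalize_rep d : forall s e (a : 'I_e -> 'M[int]_e) eps c del
    (R : 'I_e -> 'M[int]_d) lam,
  (1 < s)%N -> (e <= s)%N -> (d <= s)%N -> casimir a eps c del -> mxle s c ->
  (`|del| <= s)%N -> is_rep a eps R -> scale_seq d lam ->
  (forall k, lbd s lam lam (R k)) ->
  let t := iter d pow_grow s in
  exists h h' : 'M[int]_d, [/\ h *m h' = 1%:M, lbd t lam lam h, lbd t lam lam h' &
    forall k, lbd t lam lam (h *m R k *m h') /\ mxle t (h *m R k *m h')].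
Proof.
elim/ltn_ind: d => d IH s e a eps c del R lam s1 es ds cas cs dels rep sc HR t.
have s0 : (0 < s)%N by lia.
have st : (s <= t)%N by apply: iter_good_le good_pow_grow.
case: (posnP d) => [d0|d0].
  by subst d; exists 1%:M, 1%:M; split=> [|[]|[]|k] //; rewrite ?mulmx1 //; split=> [[]|[]].
have [d1 [Hd1 comp gap]] := first_gap d0 sc s0.
have [Ed|Hdd1] := eqVneq d1 d.
  exists 1%:M, 1%:M; rewrite mulmx1.
  have t0 : (0 < t)%N by apply: leq_trans s0 st.
  have lone : lbd t lam lam (1%:M : 'M[int]_d) by apply: lbd_mono (lbd_one _ t0) t0.
  split=> // k; rewrite mul1mx mulmx1; split; first exact: lbd_mono (HR k) st.
  have H : mxle (s ^ d.+1) (R k).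
    apply: lbd_mxle_comparable (HR k) => //; first by case: sc => H _ i; apply: H.
    by move=> i j; apply: comp; rewrite Ed.
  apply: (mxle_mono H); rewrite /t -(prednK d0) iterSr.
  apply: leq_trans (iter_good_le _ _ good_pow_grow).
  by apply: expn_le_pow_grow; lia.
case: gap => [/eqP|gap]; first by rewrite (negPf Hdd1).
have [d2 Ed] : exists d2, d = (d1 + d2)%N by exists (d - d1)%N; lia.
subst d.
have RE := block_rep_lower gap HR.
move: RE; set T1 := fun k => ulsubmx (R k); set R21 := fun k => dlsubmx (R k).
set T2 := fun k => drsubmx (R k) => RE.
have rep' : is_rep a eps (fun k => block_mx (T1 k) 0 (R21 k) (T2 k)).
  by split=> [i j|]; [rewrite -!RE rep.1|rewrite -rep.2]; apply: eq_bigr => k _; rewrite RE.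
have [rep1 rep2] := is_rep_block rep'.
have HRb k : [/\ lbd s lam lam (T1 k), lbd s (shiftf d1 lam) lam (R21 k) &
   lbd s (shiftf d1 lam) (shiftf d1 lam) (T2 k)].
  by have := HR k; rewrite RE => /lbd_block [].
have d2lt : (d2 < d1 + d2)%N by lia.
have [||h2 [h2' [h22' bh2 bh2' bT2]]] :=
  IH d2 d2lt s e a eps c del T2 (shiftf d1 lam) s1 es _ cas cs dels rep2 (scale_seq_shift sc).
- lia.
- by move=> k; have [] := HRb k.
move: bh2 bh2' bT2; set t2 := iter d2 _ _ => bh2 bh2' bT2.
have st2 : (s <= t2)%N by apply: iter_good_le good_pow_grow.
have up K (K1 : (K <= 100 * t2)%N) : (t2 ^ K <= t)%N.
  apply: leq_trans (expn_le_pow_grow K1) _.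
  rewrite /t -[(d1 + d2)%N](@subnK d2.+1) // iterD.
  exact: iter_good_le good_pow_grow.
have h2'2 : h2' *m h2 = 1%:M by apply: mulmx1C.
pose T2' k := h2 *m T2 k *m h2'.
pose R' k := h2 *m R21 k.
pose P := \sum_i \sum_j c i j *: (R' i *m T1 j).
have repc : is_rep a eps (fun k => block_mx (T1 k) 0 (R' k) (T2' k)).
  pose D : 'M[int]_(d1 + d2) := block_mx 1%:M 0 0 h2.
  pose D' : 'M[int]_(d1 + d2) := block_mx 1%:M 0 0 h2'.
  have DD' : D *m D' = 1%:M.
    by rewrite mulmx_block !mulmx0 !mul0mx mulmx1 addr0 !add0r h22' -scalar_mx_block.
  have := is_rep_conj DD' rep'.
  have E k : D *m block_mx (T1 k) 0 (R21 k) (T2 k) *m D' = block_mx (T1 k) 0 (R' k) (T2' k).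
    by rewrite !mulmx_block !(mulmx0, mul0mx, mul1mx, mulmx1, addr0, add0r).
  case=> A B; split=> [i j|]; first by rewrite -!E A; apply: eq_bigr => k _; rewrite E.
  by rewrite -B; apply: eq_bigr => k _; rewrite E.
have PE k : del *: R' k = P *m T1 k - T2' k *m P := casimir_split k cas repc.
pose H : 'M_(d2, d1) := \matrix_(i, j) (- (P i j %/ del)%Z).
pose Q : 'M_(d2, d1) := \matrix_(i, j) (P i j %% del)%Z.
have QE : Q = P + del *: H.
  by apply/matrixP => i j; rewrite !mxE /modz mulrN mulrC.
have del0 : del != 0 by case: cas.
have t21 : (1 < t2)%N by apply: leq_trans s1 st2.
have Qle : mxle t2 Q.
  move=> i j; rewrite mxE.
  have := modz_ge0 (P i j) del0; have := ltz_mod (P i j) del0; lia.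
have et2 : (e <= t2)%N by lia.
have lR k : lbd (t2 ^ 1) lam lam (T1 k) by have [X _ _] := HRb k; apply: (lbd_mono X).
have lR' k : lbd (t2 ^ 4) (shiftf d1 lam) lam (R' k).
  apply: (@lbd_mul t2 1 1 _ (shiftf d1 lam)); [lia|exact: bh2|].
  by have [_ X _] := HRb k; apply: (lbd_mono X).
have lP : lbd (t2 ^ 13) (shiftf d1 lam) lam P.
  apply: (@lbd_sum t2 11); rewrite ?card_ord // => i.
  apply: (@lbd_sum t2 9); rewrite ?card_ord // => j.
  apply: (@lbd_scale t2 7); first exact: leq_trans (cs i j) st2.
  by apply: (@lbd_mul t2 4 1 _ lam) => //; lia.
have lH : lbd (t2 ^ 13) (shiftf d1 lam) lam H.
  by apply: lbd_dom lP => i j; rewrite mxE abszN; apply: absz_divz_le.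
have lone : lbd (t2 ^ 16) lam lam (1%:M : 'M[int]_d1).
  by apply: lbd_mono (lbd_one _ (ltnW t21)) _; rewrite leq_pexp2l //; lia.
exists (block_mx 1%:M 0 H h2), (block_mx 1%:M 0 (- (h2' *m H)) h2').
have lh : lbd (t2 ^ 16) lam lam (block_mx 1%:M 0 H h2).
  apply/lbd_block; split=> //; first exact: lbd_zero.
    by apply: (lbd_mono lH); rewrite leq_pexp2l //; lia.
  by apply: (lbd_mono bh2); rewrite -{1}[t2]expn1 leq_pexp2l //; lia.
have lh' : lbd (t2 ^ 16) lam lam (block_mx 1%:M 0 (- (h2' *m H)) h2').
  apply/lbd_block; split=> //; first exact: lbd_zero.
    by apply/lbd_opp/(@lbd_mul t2 1 13 _ (shiftf d1 lam)) => //; lia.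
  by apply: (lbd_mono bh2'); rewrite -{1}[t2]expn1 leq_pexp2l //; lia.
split.
- rewrite mulmx_block !(mulmx0, mul0mx, mul1mx, mulmx1, addr0, add0r).
  by rewrite mulmxN mulmxA h22' mul1mx subrr -scalar_mx_block.
- by apply: (lbd_mono lh); apply: up; lia.
- by apply: (lbd_mono lh'); apply: up; lia.
move=> k; split.
  apply: (@lbd_mono (t2 ^ 37)); last by apply: up; lia.
  apply: (@lbd_mul t2 19 16 _ lam) => //; first lia.
  apply: (@lbd_mul t2 16 1 _ lam) => //; first lia.
  exact: lbd_mono (HR k) st2.
rewrite RE !mulmx_block !(mulmx0, mul0mx, mul1mx, mulmx1, addr0, add0r).
rewrite mulmxN mulmxA -/(R' k) -/(T2' k).
have mT1 : mxle (t2 ^ (d1 + d2).+1) (T1 k).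
  have [X _ _] := HRb k.
  apply: (@mxle_mono (s ^ (d1 + d2).+1)); last by rewrite leq_exp2r.
  apply: lbd_mxle_comparable X => //.
    by case: sc => H0 _ i; apply: H0; have := ltn_ord i; lia.
  by move=> i j; apply: comp; apply: ltn_ord.
have [_ mT2] := bT2 k; rewrite -/(T2' k) in mT2.
apply/mxle_block; split=> //.
- by apply: (mxle_mono mT1); apply: up; lia.
- by move=> i j; rewrite mxE.
- set W := _ - _.
  have WE : del *: W = Q *m T1 k - T2' k *m Q.
    rewrite /W QE scalerBr scalerDr PE mulmxDl mulmxDr -!scalemxAl -!scalemxAr.
    by rewrite opprD !addrA -/(T1 k) (addrC (del *: _)) .
  have : mxle (t2 ^ (1 + (1 + 1 + (d1 + d2).+1))) (del *: W).
    rewrite WE; apply: mxle_add => //.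
      by apply: mxle_mul => //; lia.
    apply: mxle_opp; apply: (@mxle_mono (t2 ^ (1 + 1 + 1))); last first.
      by rewrite leq_pexp2l //; lia.
    by apply: mxle_mul => //; lia.
  move=> X i j; apply: (@leq_trans (`|(del *: W) i j|)%N).
    by rewrite [(del *: W) i j]mxE abszM leq_pmull //; lia.
  by apply: leq_trans (X i j) _; apply: up; lia.
- by apply: (mxle_mono mT2); rewrite -{1}[t2]expn1; apply: up; lia.
Qed.

(** * Unipotent automorphisms that make intertwiners bounded *)

Definition unipotent n (u : 'M[int]_n) : Prop := exists k, (u - 1) ^+ k = 0.

Lemma unipotent1 n : unipotent (1%:M : 'M[int]_n).
Proof. by exists 1%N; rewrite expr1; apply/eqP; rewrite subr_eq0. Qed.

Lemma unipotent_block n1 n2 (y : 'M[int]_(n2, n1)) (u : 'M[int]_n2) :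
  unipotent u -> unipotent (block_mx 1%:M 0 y u).
Proof.
case=> k uk; exists k.+1.
have -> : block_mx 1%:M 0 y u - 1 = block_mx 0 0 y (u - 1).
  by rewrite -[1 : 'M_(n1 + n2)]/(1%:M) scalar_mx_block opp_block_mx add_block_mx !subrr !subr0.
have -> : block_mx 0 0 y (u - 1) ^+ k.+1 =
    block_mx 0 0 ((u - 1) ^+ k *m y) ((u - 1) ^+ k.+1) :> 'M_(n1 + n2).
  elim: k {uk} => [|k IH]; first by rewrite expr0 !expr1 mul1mx.
  rewrite exprS IH -[_ * _]/(_ *m _) mulmx_block !(mulmx0, mul0mx, add0r, addr0).
  by rewrite !mulmxA -![_ *m _ ^+ _]/((u - 1) * _) -!exprS.
by rewrite exprS uk mulr0 mul0mx block_mx0.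
Qed.

Definition trans_grow (s : nat) : nat := lin_bound (pow_grow s).

Lemma good_trans_grow : good trans_grow.
Proof. exact: good_comp good_lin_bound good_pow_grow. Qed.

Lemma absz_subn_le (x y : int) s (b b' : bool) :
  (`|x| <= s %/ 2 -> `|y| <= s %/ 2 -> `|(x *+ b - y *+ b')%R| <= s)%N.
Proof. by case: b; case: b' => *; lia. Qed.

(* Solve X R1 - R2' X = const with X prescribed modulo D. *)
Lemma sylvester_solve s D e d1 d2 (R1 : 'I_e -> 'M[int]_d1) (R2 : 'I_e -> 'M[int]_d2)
    (H : 'M[int]_(d2, d1)) :
  (0 < D <= s)%N -> (d2 * d1 <= s)%N -> (forall k, mxle (s %/ 2) (R1 k)) ->
  (forall k, mxle (s %/ 2) (R2 k)) -> (forall k, mxle s (H *m R1 k - R2 k *m H)) ->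
  exists N, (forall k, (D%:Z *: N) *m R1 k = R2 k *m (D%:Z *: N)) /\
    mxle (lin_bound s) (H + D%:Z *: N).
Proof.
move=> Ds ds mR1 mR2 mH.
pose F (kij : 'I_e * ('I_d2 * 'I_d1)) (X : 'M[int]_(d2, d1)) :=
  (X *m R1 kij.1 - R2 kij.1 *m X) kij.2.1 kij.2.2.
have delta_l i j k (M : 'M[int]_d1) l : ((delta_mx i j : 'M_(d2, d1)) *m M) k l = M j l *+ (k == i).
  rewrite mxE (bigD1 j) //= big1 ?addr0 => [|x xj]; rewrite !mxE ?eqxx ?andbT.
    by case: (k == i); rewrite ?mul1r ?mul0r.
  by rewrite (negPf xj) andbF mul0r.
have delta_r i j k (M : 'M[int]_d2) l : (M *m (delta_mx i j : 'M_(d2, d1))) k l = M k i *+ (l == j).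
  rewrite mxE (bigD1 i) //= big1 ?addr0 => [|x xj]; rewrite !mxE ?eqxx.
    by case: (l == j); rewrite ?mulr1 ?mulr0.
  by rewrite (negPf xj) mulr0.
have [kij|kij i j|kij|X [HX BX DX]] := @mx_solve _ d2 d1 s F H D _ ds Ds.
- move=> c X Y; rewrite /F mulmxDl mulmxDr -scalemxAl -scalemxAr opprD addrACA -scalerBr.
  by rewrite 2!mxE.
- rewrite /F mxE delta_l mxE delta_r.
  by apply: absz_subn_le; [apply: mR1|apply: mR2].
- exact: mH.
exists (\matrix_(i, j) ((X i j - H i j) %/ D%:Z)%Z).
have -> : D%:Z *: (\matrix_(i, j) ((X i j - H i j) %/ D%:Z)%Z) = X - H.
  by apply/matrixP => i j; rewrite !mxE mulrC divzK.
split; last by rewrite addrC subrK.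
move=> k; have HXk : X *m R1 k - R2 k *m X = H *m R1 k - R2 k *m H.
  by apply/matrixP => i j; apply: (HX (k, (i, j))).
rewrite mulmxBl mulmxBr; apply/eqP; rewrite subr_eq addrAC -addrA addrC -subr_eq.
by rewrite HXk addrC.
Qed.

(** At the first gap g is block triangular with bounded first diagonal block. Recursion gives u2 for
    the second block; it extends to an automorphism of the whole because it is 1 modulo D del, which
    makes the correction (1 - u2) P / del integral and divisible by D. An intertwiner divisible by D
    is then added to make the off-diagonal block of g u bounded. The modulus is carried for the
    recursion, which is entered with D |del| in place of D. *)
Lemma transition d : forall s e (a : 'I_e -> 'M[int]_e) eps c del
    (R R' : 'I_e -> 'M[int]_d) (g g' : 'M[int]_d) lam D,
  (1 < s)%N -> (e <= s)%N -> (d <= s)%N -> casimir a eps c del -> mxle s c ->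
  (`|del| <= s)%N -> is_rep a eps R -> is_rep a eps R' -> scale_seq d lam ->
  (forall k, lbd s lam lam (R k)) -> (forall k, lbd s lam lam (R' k)) ->
  (forall k, mxle s (R k)) -> (forall k, mxle s (R' k)) ->
  g *m g' = 1%:M -> lbd s lam lam g -> lbd s lam lam g' ->
  (forall k, g *m R k = R' k *m g) -> (0 < D <= s)%N ->
  exists u u' : 'M[int]_d, [/\ u *m u' = 1%:M, forall k, u *m R k = R k *m u,
    unipotent u, exists N, u - 1%:M = D%:Z *: N &
    mxle (iter (2 * d) trans_grow s) (g *m u)].
Proof.
elim/ltn_ind: d => d IH s e a eps c del R R' g g' lam D s1 es ds cas cs dels rep rep'
  sc lR lR' mR mR' gg' lg lg' gR Ds.
have s0 : (0 < s)%N by lia.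
case: (posnP d) => [d0|d0].
  subst d; exists 1%:M, 1%:M; split; rewrite ?mulmx1 //.
  - by move=> k; rewrite mul1mx mulmx1.
  - exact: unipotent1.
  - by exists 0; rewrite subrr scaler0.
  - by case.
have [d1 [Hd1 comp gap]] := first_gap d0 sc s0.
have [Ed|Hdd1] := eqVneq d1 d.
  exists 1%:M, 1%:M; split; rewrite ?mulmx1 //.
  - by move=> k; rewrite mul1mx mulmx1.
  - exact: unipotent1.
  - by exists 0; rewrite subrr scaler0.
  have H : mxle (s ^ d.+1) g.
    apply: lbd_mxle_comparable lg => //; first by case: sc => H _ i; apply: H.
    by move=> i j; apply: comp; rewrite Ed.
  apply: (mxle_mono H); rewrite -(prednK d0) mulnS iterSr.
  apply: leq_trans (iter_good_le _ _ good_trans_grow).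
  apply: leq_trans (good_infl _ good_lin_bound).
  by apply: expn_le_pow_grow; lia.
case: gap => [/eqP|gap]; first by rewrite (negPf Hdd1).
have [d2 Ed] : exists d2, d = (d1 + d2)%N by exists (d - d1)%N; lia.
subst d.
have low (M : 'M[int]_(d1 + d2)) : lbd s lam lam M ->
    M = block_mx (ulsubmx M) 0 (dlsubmx M) (drsubmx M).
  by move=> lM; apply: (@block_rep_lower s d1 d2 lam 1 (fun=> M) gap (fun=> lM) ord0).
have low_mono (M : 'M[int]_(d1 + d2)) K : lbd K lam lam M ->
    [/\ lbd K lam lam (ulsubmx M), lbd K (shiftf d1 lam) lam (dlsubmx M) &
      lbd K (shiftf d1 lam) (shiftf d1 lam) (drsubmx M)].
  by rewrite -{1}[M]submxK => /lbd_block [].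
have low_mxle (M : 'M[int]_(d1 + d2)) K : mxle K M ->
    [/\ mxle K (ulsubmx M), mxle K (dlsubmx M) & mxle K (drsubmx M)].
  by rewrite -{1}[M]submxK => /mxle_block [].
set R1 := fun k => ulsubmx (R k); set R21 := fun k => dlsubmx (R k).
set R2 := fun k => drsubmx (R k).
set R1' := fun k => ulsubmx (R' k); set R21' := fun k => dlsubmx (R' k).
set R2' := fun k => drsubmx (R' k).
have RE k : R k = block_mx (R1 k) 0 (R21 k) (R2 k) := low _ (lR k).
have R'E k : R' k = block_mx (R1' k) 0 (R21' k) (R2' k) := low _ (lR' k).
have repb : is_rep a eps (fun k => block_mx (R1 k) 0 (R21 k) (R2 k)).
  by split=> [i j|]; [rewrite -!RE rep.1|rewrite -rep.2]; apply: eq_bigr => k _; rewrite RE.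
have repb' : is_rep a eps (fun k => block_mx (R1' k) 0 (R21' k) (R2' k)).
  by split=> [i j|]; [rewrite -!R'E rep'.1|rewrite -rep'.2]; apply: eq_bigr => k _; rewrite R'E.
have [rep1 rep2] := is_rep_block repb; have [rep1' rep2'] := is_rep_block repb'.
have gE := low _ lg; have g'E := low _ lg'.
move: gE g'E; set g1 := ulsubmx g; set h := dlsubmx g; set g2 := drsubmx g.
set g1' := ulsubmx g'; set h'' := dlsubmx g'; set g2' := drsubmx g' => gE g'E.
have [lg1 lh lg2] := low_mono _ _ lg; have [_ _ lg2'] := low_mono _ _ lg'.
have [gg1 gg2] : g1 *m g1' = 1%:M /\ g2 *m g2' = 1%:M.
  move: gg'; rewrite gE g'E mulmx_block !(mulmx0, mul0mx, add0r, addr0) scalar_mx_block.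
  by case/eq_block_mx.
have gRk k : [/\ g1 *m R1 k = R1' k *m g1,
    h *m R1 k + g2 *m R21 k = R21' k *m g1 + R2' k *m h & g2 *m R2 k = R2' k *m g2].
  have := gR k; rewrite gE RE R'E !mulmx_block !(mulmx0, mul0mx, add0r, addr0).
  by case/eq_block_mx.
have d2lt : (d2 < d1 + d2)%N by lia.
have del0 : del != 0 by case: cas.
pose s1' := trans_grow s.
have ss1 : (s <= s1')%N by apply: good_infl good_trans_grow.
have Dd : (0 < D * `|del| <= s1')%N.
  rewrite muln_gt0; apply/andP; split; first by lia.
  apply: (@leq_trans (s ^ 2)); first by rewrite expnS expn1 leq_mul //; lia.
  apply: leq_trans (good_infl _ good_lin_bound).
  by apply: expn_le_pow_grow; lia.
have lR2 k : lbd s1' (shiftf d1 lam) (shiftf d1 lam) (R2 k).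
  by have [_ _ X] := low_mono _ _ (lR k); apply: (lbd_mono X).
have lR2' k : lbd s1' (shiftf d1 lam) (shiftf d1 lam) (R2' k).
  by have [_ _ X] := low_mono _ _ (lR' k); apply: (lbd_mono X).
have mRk k := low_mxle _ _ (mR k); have mRk' k := low_mxle _ _ (mR' k).
have mR2 k : mxle s1' (R2 k) by have [_ _ X] := mRk k; apply: (mxle_mono X).
have mR2' k : mxle s1' (R2' k) by have [_ _ X] := mRk' k; apply: (mxle_mono X).
have gR2 k : g2 *m R2 k = R2' k *m g2 by have [] := gRk k.
have [u2 [u2' [uu2 u2R u2u [N2 u2N] u2le]]] := IH d2 d2lt s1' e a eps c del R2 R2' g2 g2'
  (shiftf d1 lam) (D * `|del|)%N (leq_trans s1 ss1) (leq_trans es ss1)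
  (leq_trans (ltnW (leq_trans d2lt ds)) ss1) cas (mxle_mono cs ss1) (leq_trans dels ss1)
  rep2 rep2' (scale_seq_shift sc) lR2 lR2' mR2 mR2' gg2 (lbd_mono lg2 ss1)
  (lbd_mono lg2' ss1) gR2 Dd.
move: u2le; set t2 := iter _ _ _ => u2le.
have s1t2 : (s1' <= t2)%N by apply: iter_good_le good_trans_grow.
have st2 : (s <= t2)%N := leq_trans ss1 s1t2.
pose P := \sum_i \sum_j c i j *: (R21 i *m R1 j).
have PE k : del *: R21 k = P *m R1 k - R2 k *m P := casimir_split k cas repb.
pose sg := sgz del.
(* This is (1 - u2) P / del written without division, using u2 = 1 + D |del| N2 and |del| = sg
   del. *)
pose h0 := (- (D%:Z * sg)) *: (N2 *m P).
have delE : `|del|%N%:Z = sg * del by rewrite abszEsg.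
have h0E : del *: h0 = (1%:M - u2) *m P.
  rewrite -opprB u2N mulNmx -scalemxAl scalerA -scaleNr; congr (_ *: _).
  by rewrite PoszM delE; ring.
have u2R' k : (1%:M - u2) *m R2 k = R2 k *m (1%:M - u2).
  by rewrite mulmxBl mulmxBr mul1mx mulmx1 u2R.
have h0R k : h0 *m R1 k - R2 k *m h0 = R21 k - u2 *m R21 k.
  apply: (zscalemx_inj del0).
  rewrite scalerBr scalemxAl scalemxAr h0E -mulmxA [R2 k *m _]mulmxA -u2R' -mulmxA -mulmxBr -PE.
  by rewrite -scalemxAr mulmxBl mul1mx.
pose H := h + g2 *m h0.
have HE k : H *m R1 k - R2' k *m H = R21' k *m g1 - g2 *m u2 *m R21 k.
  have [_ E _] := gRk k.
  rewrite /H mulmxDl mulmxDr mulmxA -gR2 -!mulmxA opprD addrACA -mulmxBr h0R mulmxBr addrA.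
  by congr (_ - _); rewrite addrAC E addrK.
pose s2 := pow_grow t2.
have t21 : (1 < t2)%N := leq_trans s1 st2.
have up2 K (K1 : (K <= 100 * t2)%N) : (t2 ^ K <= s2)%N := expn_le_pow_grow K1.
have mg1 : mxle (s ^ (d1 + d2).+1) g1.
  apply: lbd_mxle_comparable lg1 => //.
    by case: sc => H0 _ i; apply: H0; have := ltn_ord i; lia.
  by move=> i j; apply: comp; apply: ltn_ord.
have [||k|k|k|N [NR Nle]] := @sylvester_solve s2 D e d1 d2 R1 R2' H.
- have := up2 1%N; rewrite expn1; lia.
- apply: (@leq_trans (t2 ^ 2)); last by apply: up2; lia.
  by rewrite expnS expn1 leq_mul //; lia.
- have [X _ _] := mRk k; apply: (mxle_mono X).
  have := up2 2%N; rewrite expnS expn1; nia.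
- have [_ _ X] := mRk' k; apply: (mxle_mono X).
  have := up2 2%N; rewrite expnS expn1; nia.
- rewrite HE; apply: (@mxle_mono (t2 ^ (1 + (1 + 1 + (d1 + d2).+1)))); last by apply: up2; lia.
  apply: mxle_add => //.
    apply: mxle_mul; first lia.
      by have [_ X _] := mRk' k; apply: (mxle_mono X).
    by apply: (mxle_mono mg1); rewrite leq_exp2r.
  apply: mxle_opp; apply: (@mxle_mono (t2 ^ (1 + 1 + 1))); last by rewrite leq_pexp2l; lia.
  apply: mxle_mul => //; first lia.
  by have [_ X _] := mRk k; apply: (mxle_mono X).
have u2'2 : u2' *m u2 = 1%:M by apply: mulmx1C.
have g2'2 : g2' *m g2 = 1%:M by apply: mulmx1C.
(* Chosen so that g2 u2 h' is the solution D N of the Sylvester system. *)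
pose h' := u2' *m (g2' *m (D%:Z *: N)).
have gh' : g2 *m (u2 *m h') = D%:Z *: N.
  by rewrite /h' (mulmxA u2) uu2 mul1mx mulmxA gg2 mul1mx.
have h'R k : h' *m R1 k = R2 k *m h'.
  rewrite -[LHS]mul1mx -[RHS]mul1mx -u2'2 -2!mulmxA; congr (u2' *m _).
  rewrite -[LHS]mul1mx -[RHS]mul1mx -g2'2 -2![g2' *m _ *m _]mulmxA; congr (g2' *m _).
  rewrite [u2 *m (h' *m _)]mulmxA [g2 *m _]mulmxA gh' NR.
  by rewrite (mulmxA u2) u2R (mulmxA g2) (mulmxA g2) gR2 -!mulmxA gh'.
pose y := h0 + u2 *m h'.
exists (block_mx 1%:M 0 y u2), (block_mx 1%:M 0 (- (u2' *m y)) u2'); split.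
- rewrite mulmx_block !(mulmx0, mul0mx, mul1mx, mulmx1, addr0, add0r).
  by rewrite mulmxN mulmxA uu2 mul1mx subrr -scalar_mx_block.
- move=> k; rewrite RE !mulmx_block !(mulmx0, mul0mx, mul1mx, mulmx1, addr0, add0r) u2R.
  have E : h0 *m R1 k = R2 k *m h0 + (R21 k - u2 *m R21 k) by rewrite -h0R addrC subrK.
  congr block_mx; rewrite /y mulmxDl mulmxDr -[u2 *m h' *m _]mulmxA h'R.
  rewrite [R2 k *m (u2 *m _)]mulmxA -u2R -mulmxA E.
  by rewrite addrAC -(addrA (R2 k *m h0)) subrK (addrC (R2 k *m h0)) -addrA.
- exact: unipotent_block.
- have [Y yE] : exists Y, y = D%:Z *: Y.
    exists (- (sg *: (N2 *m P)) + u2 *m (u2' *m (g2' *m N))).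
    by rewrite scalerDr scalerN scalerA -scaleNr -/h0 /y /h' -!scalemxAr.
  exists (block_mx 0 0 Y (`|del|%N%:Z *: N2)).
  rewrite scale_block_mx !scaler0 scalerA -PoszM -u2N -yE.
  by rewrite scalar_mx_block opp_block_mx add_block_mx !subrr !subr0.
rewrite gE mulmx_block !(mulmx0, mul0mx, mul1mx, mulmx1, addr0, add0r).
have -> : h + g2 *m y = H + D%:Z *: N.
  by rewrite /H /y mulmxDr gh' addrA.
(* One application of [trans_grow] went into [s1'], 2 d2 into the recursion, and one bounds the
   Sylvester solution. *)
have upt : (lin_bound s2 <= iter (2 * (d1 + d2)) trans_grow s)%N.
  rewrite -[lin_bound s2]/(trans_grow t2) /t2 -iterSr -iterS.
  rewrite -[(2 * (d1 + d2))%N](@subnK (2 * d2).+2); last lia.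
  by rewrite iterD; apply: iter_good_le good_trans_grow.
have t2s2 : (t2 <= s2)%N := good_infl _ good_pow_grow.
have s2l : (s2 <= lin_bound s2)%N := good_infl _ good_lin_bound.
apply/mxle_block; split.
- apply: (mxle_mono mg1); apply: leq_trans upt; apply: leq_trans s2l.
  by apply: leq_trans (up2 (d1 + d2).+1 _); [rewrite leq_exp2r|lia].
- by move=> i j; rewrite mxE.
- exact: (mxle_mono Nle).
- by apply: (mxle_mono u2le); apply: leq_trans t2s2 (leq_trans s2l upt).
Qed.

Lemma lbdZ K lam mu p q (M : 'M[int]_(p, q)) :
  lbd K lam mu M <-> forall i j, M i j ^+ 2 * (mu j)%:Z <= K%:Z * (lam i)%:Z.
Proof.
have E i j : (M i j ^+ 2 * (mu j)%:Z <= K%:Z * (lam i)%:Z) =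
    (`|M i j| ^ 2 * mu j <= K * lam i)%N.
  by rewrite -[M i j ^+ 2]gez0_abs ?sqr_ge0 // abszX -!PoszM lez_nat.
by split=> H i j; [rewrite E|rewrite -E].
Qed.

Lemma sq_mulmx_le d p (x : 'rV[int]_d) (G : 'M[int]_(d, p)) :
  sq (x *m G) <= d%:Z * \sum_i x 0 i ^+ 2 * sq (row i G).
Proof.
rewrite /sq /dot.
have -> : d%:Z * (\sum_i x 0 i ^+ 2 * (\sum_j row i G 0 j * row i G 0 j)) =
    \sum_j d%:Z * (\sum_i (x 0 i * G i j) ^+ 2).
  rewrite -mulr_sumr; congr (_ * _).
  under eq_bigr => i _ do rewrite mulr_sumr.
  rewrite exchange_big /=; apply: eq_bigr => j _; apply: eq_bigr => i _.
  by rewrite !mxE; ring.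
apply: ler_sum => j _; rewrite -expr2 mxE.
by have := sqr_sum_le (fun i => x 0 i * G i j); rewrite card_ord natz.
Qed.

Lemma sq_row_mx p1 p2 (u : 'rV[int]_p1) (v : 'rV[int]_p2) :
  sq (row_mx u v) = sq u + sq v.
Proof.
rewrite /sq /dot big_split_ord /=.
by congr (_ + _); apply: eq_bigr => j _; rewrite ?row_mxEl ?row_mxEr.
Qed.

Lemma sq_mulmx_bound d p B (x : 'rV[int]_d) (G : 'M[int]_(d, p)) :
  mxle B G -> sq (x *m G) <= ((d * p * B ^ 2)%N)%:Z * sq x.
Proof.
move=> GB; apply: le_trans (sq_mulmx_le x G) _.
rewrite -mulnA PoszM -mulrA ler_wpM2l // mulr_sumr; apply: ler_sum => i _.
rewrite -expr2 mulrC ler_wpM2r ?sqr_ge0 //.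
rewrite /sq /dot PoszM (_ : p%:Z * _ = \sum_(j < p) ((B ^ 2)%N)%:Z); last first.
  by rewrite sumr_const card_ord -mulr_natl natz.
apply: ler_sum => j _; rewrite mxE -expr2.
rewrite -[G i j ^+ 2]gez0_abs ?sqr_ge0 // abszX lez_nat leq_exp2r //; exact: GB.
Qed.

Lemma row_perm_mul d p (s : 'S_d) (g : 'M[int]_d) (G : 'M[int]_(d, p)) i :
  row i (row_perm s g *m G) = row (s i) (g *m G).
Proof. by rewrite !row_mul; congr (_ *m _); apply/rowP => j; rewrite !mxE. Qed.

Lemma sorted_basis d p (G : 'M[int]_(d, p)) : (forall x : 'rV_d, x *m G = 0 -> x = 0) ->
  exists (b b' : 'M[int]_d) lam, [/\ b *m b' = 1%:M, scale_seq d lam,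
    forall i : 'I_d, (lam i)%:Z = sq (row i (b *m G)) &
    forall (x : 'rV_d) i, x 0 i ^+ 2 * (lam i)%:Z <= (red_const d)%:Z * sq (x *m b *m G)].
Proof.
move=> Ginj; have [g [g' [gg' g'g Hg]]] := reduced_basis G.
pose t := [tuple `|sq (row i (g *m G))|%N | i < d].
have st : size (sort leq t) == d by rewrite size_sort size_tuple.
have /tuple_permP [s Es] : perm_eq (Tuple st) t by rewrite perm_sort.
have Hnth (i : 'I_d) : nth 0%N (sort leq t) i = `|sq (row (s i) (g *m G))|%N.
  transitivity (nth 0%N [tuple tnth t (s i) | i < d] i).
    exact: (congr1 (fun r : seq nat => nth 0%N r i) Es).
  by rewrite -tnth_nth !tnth_mktuple.
pose lam := nth 0%N (sort leq t).
have lamE (i : 'I_d) : (lam i)%:Z = sq (row (s i) (g *m G)).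
  by rewrite /lam Hnth gez0_abs ?sq_ge0.
exists (row_perm s g), (g' *m perm_mx s^-1%g), lam; split.
- rewrite row_permE mulmxA -(mulmxA _ g) gg' mulmx1 -perm_mxM.
  by rewrite (_ : (s * s^-1 = 1)%g) ?perm_mx1 // mulgV.
- split=> [i Hi|i j /andP [ij jd]].
    rewrite -ltz_nat (lamE (Ordinal Hi)) sq_gt0; apply/eqP => r0.
    have /Ginj : (row (s (Ordinal Hi)) g) *m G = 0 by rewrite -row_mul.
    move/(congr1 (mulmx^~ g')); rewrite /= -row_mul gg' mul0mx.
    move/rowP/(_ (s (Ordinal Hi))); rewrite !mxE eqxx => /eqP; by rewrite oner_eq0.
  apply: (sorted_leq_nth leq_trans leqnn) => //.
  - by apply: sort_sorted; exact: leq_total.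
  - by rewrite inE (eqP st); apply: leq_ltn_trans ij jd.
  - by rewrite inE (eqP st).
- by move=> i; rewrite lamE row_perm_mul.
- move=> x i; rewrite lamE.
  pose y : 'rV_d := x *m perm_mx s.
  have yE : x 0 i = y 0 (s i).
    rewrite /y mxE (bigD1 i) //= big1 ?addr0 => [|j ji]; rewrite !mxE ?eqxx ?mulr1 //.
    by rewrite (inj_eq perm_inj) (negPf ji) mulr0.
  rewrite yE row_permE mulmxA -/y; apply: le_trans (Hg y).
  rewrite (bigD1 (s i)) //= lerDl; apply: sumr_ge0 => j _.
  by rewrite mulr_ge0 ?sqr_ge0 ?sq_ge0.
Qed.

Lemma scale_seq_compare d K (lam lam' : nat -> nat) (g g' : 'M[int]_d) :
  g *m g' = 1%:M -> scale_seq d lam -> scale_seq d lam' -> lbd K lam' lam g ->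
  forall i, (i < d)%N -> (lam i <= K * lam' i)%N.
Proof.
move=> gg' [_ mono] [_ mono'] lg i Hi.
have : \det g != 0.
  have : \det g * \det g' = 1 by rewrite -det_mulmx gg' det1.
  by move=> H; apply/eqP => d0; move: H; rewrite d0 mul0r.
have [s Hs _|H] := pickP (fun s : 'S_d => [forall j, g j (s j) != 0]); last first.
  rewrite /determinant big1 ?eqxx // => s _.
  have /negbT := H s; rewrite negb_forall => /existsP [j]; rewrite negbK => /eqP gj.
  by rewrite (bigD1 j) //= gj mul0r mulr0.
have [j ji sj] : exists2 j : 'I_d, (j <= i)%N & (i <= s j)%N.
  apply/exists_inP/contraT; rewrite negb_exists_in => /forall_inP H.
  have : (#|[set s j | j : 'I_d & (j <= i)%N]| <= #|[set j : 'I_d | (j < i)%N]|)%N.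
    by apply/subset_leq_card/subsetP => x /imsetP [j]; rewrite !inE => /H;
       rewrite -ltnNge => ? ->.
  rewrite card_imset; last exact: perm_inj.
  suff : (#|[set j : 'I_d | (j < i)%N]| < #|[set j : 'I_d | (j <= i)%N]|)%N by lia.
  apply: proper_card; apply/properP; split.
    by apply/subsetP => x; rewrite !inE => /ltnW.
  by exists (Ordinal Hi); rewrite !inE //= ltnn.
have gj : g j (s j) != 0 by move/forallP: Hs.
apply: (@leq_trans (lam (s j))); first by apply: mono; rewrite sj ltn_ord.
apply: (@leq_trans (`|g j (s j)| ^ 2 * lam (s j))).
  by rewrite leq_pmull // expn_gt0 absz_gt0 gj.
apply: leq_trans (lg j (s j)) _; rewrite leq_mul2l mono' ?orbT //.
by rewrite ji.
Qed.

(** * Walking along a chain of forms *)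

(** Normalisation destroys the exact lengths, so lam gives the squared lengths only up to the factor
    K. *)
Definition good_basis K e d (R : 'I_e -> 'M[int]_d) p (G : 'M[int]_(d, p)) (b : 'M[int]_d) :=
  exists b' lam, [/\ b *m b' = 1%:M, scale_seq d lam,
    forall (x : 'rV_d) i, x 0 i ^+ 2 * (lam i)%:Z <= K%:Z * sq (x *m b *m G),
    forall i : 'I_d, sq (row i (b *m G)) <= K%:Z * (lam i)%:Z &
    forall k, lbd K lam lam (b *m R k *m b') /\ mxle K (b *m R k *m b')].

Lemma red_const_le d s : (d <= s)%N -> (red_const d <= 2 * s.+1 ^ d)%N.
Proof.
elim: d => [|d IH] ds; first by rewrite expn0.
rewrite /= expnS mulnCA; apply: leq_mul; first lia.
by apply: IH; lia.
Qed.

Definition basis_grow (s : nat) : nat :=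
  pow_grow (iter (pow_grow s) pow_grow (pow_grow s)).

Lemma good_basis_grow : good basis_grow.
Proof.
apply: (good_comp good_pow_grow).
exact: (good_comp (good_iter good_pow_grow good_id) good_pow_grow).
Qed.

Lemma iter_leq_good f k k' x : good f -> (k <= k')%N -> (iter k f x <= iter k' f x)%N.
Proof.
by move=> gf kk'; rewrite -(subnK kk') iterD; apply: iter_good_le.
Qed.

(** An action of bounded norm for the form is bounded relative to the lengths of a reduced basis,
    and [normalize_rep] makes it bounded absolutely. *)
Lemma good_basis_exists s e a eps c del d (R : 'I_e -> 'M[int]_d) p (G : 'M[int]_(d, p)) :
  (1 < s)%N -> (e <= s)%N -> (d <= s)%N -> casimir a eps c del -> mxle s c ->
  (`|del| <= s)%N -> is_rep a eps R ->
  (forall x : 'rV_d, x *m G = 0 -> x = 0) ->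
  (forall k (v : 'rV_d), sq (v *m R k *m G) <= ((s ^ 4)%N)%:Z * sq (v *m G)) ->
  exists b, good_basis (basis_grow s) R G b.
Proof.
move=> s1 es ds cas cs dels rep Ginj RG.
have [b0 [b0' [lam [bb' sc lamE Hb]]]] := sorted_basis Ginj.
have b'b : b0' *m b0 = 1%:M by apply: mulmx1C.
pose s1' := pow_grow s.
have ss1 : (s <= s1')%N := good_infl _ good_pow_grow.
have redle : (red_const d * s ^ 4 <= s1')%N.
  apply: (@leq_trans (s.+1 ^ 1 * s.+1 ^ s * s.+1 ^ 4)).
    apply: leq_mul; last by rewrite leq_exp2r.
    apply: leq_trans (red_const_le ds) _; apply: leq_mul; first by rewrite expn1; lia.
    by rewrite leq_pexp2l.
  by rewrite -!expnD /s1' /pow_grow leq_pexp2l //; lia.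
have red0 := red_const_ge2 d.
have lR k : lbd s1' lam lam (b0 *m R k *m b0').
  apply/lbdZ => i j.
  have := Hb (row i (b0 *m R k *m b0')) j; rewrite [row _ _ 0 _]mxE => /le_trans; apply.
  have -> : row i (b0 *m R k *m b0') *m b0 *m G = row i b0 *m R k *m G.
    by rewrite -!row_mul -(mulmxA (b0 *m _)) b'b mulmx1.
  apply: (@le_trans _ _ ((red_const d)%:Z * (((s ^ 4)%N)%:Z * sq (row i b0 *m G)))).
    by rewrite ler_wpM2l // RG.
  by rewrite -row_mul -lamE mulrA -PoszM ler_wpM2r // lez_nat.
have [h [h' [hh' lh lh' nR]]] := normalize_rep (leq_trans s1 ss1) (leq_trans es ss1)
  (leq_trans ds ss1) cas (mxle_mono cs ss1) (leq_trans dels ss1) (is_rep_conj bb' rep) sc lR.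
move: lh lh' nR; set t0 := iter _ _ _ => lh lh' nR.
pose t := iter s1' pow_grow s1'.
have t0t : (t0 <= t)%N by apply: iter_leq_good good_pow_grow (leq_trans ds ss1).
have st : (s1' <= t)%N by apply: iter_good_le good_pow_grow.
have tg K : (K <= 100 * t)%N -> (t ^ K <= basis_grow s)%N by exact: expn_le_pow_grow.
have h'h : h' *m h = 1%:M by apply: mulmx1C.
have dt : (d <= t)%N by lia.
have rt : (red_const d <= t)%N.
  by apply: leq_trans st; apply: leq_trans redle; rewrite leq_pmulr // expn_gt0; lia.
have tK : (t0 <= basis_grow s)%N by apply: leq_trans t0t _; rewrite -[t]expn1; apply: tg; lia.
exists (h *m b0), (b0' *m h'), lam; split=> //.
- by rewrite mulmxA -(mulmxA h) bb' mulmx1.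
- move=> x i; pose y := x *m h.
  have -> : x *m (h *m b0) *m G = y *m b0 *m G by rewrite !mulmxA.
  have -> : x 0 i = \sum_j y 0 j * h' j i.
    by have := congr1 (fun M : 'rV_d => M 0 i) (mulmx1 x); rewrite -hh' mulmxA mxE => <-.
  apply: (@le_trans _ _ (d%:Z * (\sum_j (y 0 j * h' j i) ^+ 2) * (lam i)%:Z)).
    rewrite ler_wpM2r //; have := sqr_sum_le (fun j => y 0 j * h' j i).
    by rewrite card_ord natz.
  rewrite -mulrA mulr_suml.
  apply: (@le_trans _ _ (d%:Z * \sum_(j < d) t%:Z * (t%:Z * sq (y *m b0 *m G)))).
    rewrite ler_wpM2l //; apply: ler_sum => j _.
    apply: (@le_trans _ _ (t%:Z * (y 0 j ^+ 2 * (lam j)%:Z))).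
      rewrite exprMn -mulrA [t%:Z * _]mulrCA; apply: ler_wpM2l; first exact: sqr_ge0.
      move/lbdZ: lh' => /(_ j i) /le_trans; apply.
      by rewrite ler_wpM2r // lez_nat.
    rewrite ler_wpM2l //; apply: le_trans (Hb y j) _.
    by rewrite ler_wpM2r ?sq_ge0 // lez_nat.
  rewrite sumr_const card_ord -mulr_natl natz !mulrA ler_wpM2r ?sq_ge0 // -!PoszM lez_nat.
  apply: leq_trans (tg 4%N _); last by lia.
  by rewrite !expnS expn0 muln1 !mulnA !leq_mul.
- move=> i; rewrite -mulmxA row_mul; apply: le_trans (sq_mulmx_le _ _) _.
  apply: (@le_trans _ _ (d%:Z * \sum_(j < d) t%:Z * (lam i)%:Z)).
    rewrite ler_wpM2l //; apply: ler_sum => j _; rewrite -lamE mxE.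
    by move/lbdZ: lh => /(_ i j) /le_trans; apply; rewrite ler_wpM2r // lez_nat.
  rewrite sumr_const card_ord -mulr_natl natz !mulrA ler_wpM2r // -!PoszM lez_nat.
  apply: leq_trans (tg 3%N _); last by lia.
  by rewrite !expnS expn0 muln1 !mulnA !leq_mul.
- move=> k; have [lk mk] := nR k.
  have -> : h *m b0 *m R k *m (b0' *m h') = h *m (b0 *m R k *m b0') *m h' by rewrite !mulmxA.
  by split; [apply: (lbd_mono lk)|apply: (mxle_mono mk)].
Qed.

Definition rep_aut e d (R : 'I_e -> 'M[int]_d) (u : 'M[int]_d) : Prop :=
  (forall k, u *m R k = R k *m u) /\ exists u', u *m u' = 1%:M.

Lemma rep_aut1 e d (R : 'I_e -> 'M[int]_d) : rep_aut R 1%:M.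
Proof. by split=> [k|]; [rewrite mul1mx mulmx1|exists 1%:M; rewrite mulmx1]. Qed.

Lemma rep_autM e d (R : 'I_e -> 'M[int]_d) u v : rep_aut R u -> rep_aut R v -> rep_aut R (u *m v).
Proof.
case=> uR [u' uu'] [vR [v' vv']]; split=> [k|]; first by rewrite -mulmxA vR !mulmxA uR.
by exists (v' *m u'); rewrite mulmxA -(mulmxA u) vv' mulmx1.
Qed.

Lemma rep_autV e d (R : 'I_e -> 'M[int]_d) u u' : rep_aut R u -> u *m u' = 1%:M -> rep_aut R u'.
Proof.
case=> uR _ uu'; have u'u : u' *m u = 1%:M by apply: mulmx1C.
split=> [k|]; last by exists u.
by rewrite -[LHS]mulmx1 -uu' mulmxA -(mulmxA u') -uR mulmxA u'u mul1mx.
Qed.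

Definition step_grow (s : nat) : nat := iter (2 * pow_grow s) trans_grow (pow_grow s).

Lemma good_step_grow : good step_grow.
Proof.
apply: (@good_comp (fun x => iter (2 * x) trans_grow x)); last exact: good_pow_grow.
by apply: good_iter good_trans_grow _; apply: good_mulc => //; apply: good_id.
Qed.

(* Adjacent forms have reduced bases that differ by a bounded matrix, after   *)
(* a unipotent automorphism which makes up for unbounded gaps.                *)
Lemma good_basis_step s e a eps c del d (R : 'I_e -> 'M[int]_d) p p'
    (G : 'M[int]_(d, p)) (G' : 'M[int]_(d, p')) b b1 :
  (1 < s)%N -> (e <= s)%N -> (d <= s)%N -> casimir a eps c del -> mxle s c ->
  (`|del| <= s)%N -> is_rep a eps R ->
  (forall v : 'rV_d, sq (v *m G) <= 4 * sq (v *m G')) ->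
  (forall v : 'rV_d, sq (v *m G') <= 4 * sq (v *m G)) ->
  good_basis s R G b -> good_basis s R G' b1 ->
  exists u w, [/\ rep_aut R u, unipotent u, mxle (step_grow s) w & b1 *m u = w *m b].
Proof.
move=> s1 es ds cas cs dels rep adj adj'.
case=> b' [lam [bb' sc Hb Hb2 Rb]] [b1' [lam' [bb1' sc' Hb' Hb2' Rb']]].
have b'b : b' *m b = 1%:M by apply: mulmx1C.
have b1'b : b1' *m b1 = 1%:M by apply: mulmx1C.
pose g := b1 *m b'; pose g' := b *m b1'.
have gg' : g *m g' = 1%:M by rewrite /g /g' mulmxA -(mulmxA b1) b'b mulmx1.
have g'g : g' *m g = 1%:M by apply: mulmx1C.
pose K := (4 * (s * s))%N.
have lg : lbd K lam' lam g.
  apply/lbdZ => i j; have := Hb (row i g) j; rewrite [row i g 0 j]mxE => /le_trans; apply.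
  have -> : row i g *m b *m G = row i (b1 *m G).
    by rewrite -!row_mul /g -(mulmxA b1) b'b mulmx1.
  apply: (@le_trans _ _ (s%:Z * (4 * sq (row i (b1 *m G'))))).
    by rewrite ler_wpM2l // !row_mul; apply: adj.
  apply: (@le_trans _ _ (s%:Z * (4 * (s%:Z * (lam' i)%:Z)))).
    by rewrite ler_wpM2l // ler_wpM2l.
  by rewrite /K !PoszM; lia.
have lg' : lbd K lam lam' g'.
  apply/lbdZ => i j; have := Hb' (row i g') j; rewrite [row i g' 0 j]mxE => /le_trans; apply.
  have -> : row i g' *m b1 *m G' = row i (b *m G').
    by rewrite -!row_mul /g' -(mulmxA b) b1'b mulmx1.
  apply: (@le_trans _ _ (s%:Z * (4 * sq (row i (b *m G))))).
    by rewrite ler_wpM2l // !row_mul; apply: adj'.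
  apply: (@le_trans _ _ (s%:Z * (4 * (s%:Z * (lam i)%:Z)))).
    by rewrite ler_wpM2l // ler_wpM2l.
  by rewrite /K !PoszM; lia.
(* Comparable sequences of lengths allow both actions, g and its inverse to be measured by lam
   alone. *)
have lam_le i : (i < d)%N -> (lam i <= K * lam' i)%N.
  exact: scale_seq_compare gg' sc sc' lg i.
have lam'_le i : (i < d)%N -> (lam' i <= K * lam i)%N.
  exact: scale_seq_compare g'g sc' sc lg' i.
pose S := pow_grow s.
have KKS : (K * K <= S)%N.
  apply: (@leq_trans (s ^ 8)); last by apply: expn_le_pow_grow; lia.
  have H4 : (4 <= s ^ 2)%N by rewrite (@leq_trans (2 ^ 2)) // leq_exp2r.
  rewrite (_ : 8 = 4 + 4)%N // expnD.
  have KH : (K <= s ^ 4)%N by rewrite (_ : 4 = 2 + 2)%N // expnD leq_mul // expnS expn1.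
  exact: leq_mul.
have KS : (K <= S)%N by apply: leq_trans KKS; rewrite leq_pmulr // /K; lia.
have KKsS : (s * (K * K) <= S)%N.
  apply: (@leq_trans (s ^ 9)); last by apply: expn_le_pow_grow; lia.
  rewrite expnS leq_mul //.
  have H4 : (4 <= s ^ 2)%N by rewrite (@leq_trans (2 ^ 2)) // leq_exp2r.
  rewrite (_ : 8 = 4 + 4)%N // expnD.
  have KH : (K <= s ^ 4)%N by rewrite (_ : 4 = 2 + 2)%N // expnD leq_mul // expnS expn1.
  exact: leq_mul.
have sS : (s <= S)%N := good_infl _ good_pow_grow.
have lgS : lbd S lam lam g.
  move=> i j; apply: leq_trans (lg i j) _.
  apply: (@leq_trans (K * (K * lam i))); first by rewrite leq_mul2l lam'_le ?orbT.
  by rewrite mulnA leq_mul2r KKS orbT.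
have lg'S : lbd S lam lam g'.
  move=> i j; apply: (@leq_trans (`|g' i j| ^ 2 * (K * lam' j))).
    by rewrite leq_mul2l lam_le ?orbT.
  rewrite mulnCA; apply: (@leq_trans (K * (K * lam i))).
    by rewrite leq_mul2l lg' orbT.
  by rewrite mulnA leq_mul2r KKS orbT.
pose T k := b *m R k *m b'; pose T1 k := b1 *m R k *m b1'.
have lT k : lbd S lam lam (T k) by have [X _] := Rb k; apply: (lbd_mono X).
have lT1 k : lbd S lam lam (T1 k).
  have [X _] := Rb' k; move=> i j.
  apply: (@leq_trans (`|T1 k i j| ^ 2 * (K * lam' j))).
    by rewrite leq_mul2l lam_le ?orbT.
  rewrite mulnCA; apply: (@leq_trans (K * (s * (K * lam i)))).
    rewrite leq_mul2l; apply/orP; right; apply: leq_trans (X i j) _.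
    by rewrite leq_mul2l lam'_le ?orbT.
  by rewrite mulnCA [(K * (K * _))%N]mulnA mulnA leq_mul2r KKsS orbT.
have mT k : mxle S (T k) by have [_ X] := Rb k; apply: (mxle_mono X).
have mT1 k : mxle S (T1 k) by have [_ X] := Rb' k; apply: (mxle_mono X).
have gT k : g *m T k = T1 k *m g.
  by rewrite /g /T /T1 !mulmxA -(mulmxA b1) b'b mulmx1 -(mulmxA _ b1') b1'b mulmx1.
have D1 : (0 < 1 <= S)%N by lia.
have [u [u' [uu' uT unip _ gu]]] := transition (leq_trans s1 sS) (leq_trans es sS)
  (leq_trans ds sS) cas (mxle_mono cs sS) (leq_trans dels sS) (is_rep_conj bb' rep)
  (is_rep_conj bb1' rep) sc lT lT1 mT mT1 gg' lgS lg'S gT D1.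
exists (b' *m u *m b), (g *m u); split.
- split; last first.
    exists (b' *m u' *m b); rewrite !mulmxA -(mulmxA _ b b') bb' mulmx1 -(mulmxA b') uu' mulmx1.
    exact: b'b.
  move=> k; have RT : R k = b' *m T k *m b.
    by rewrite /T !mulmxA b'b mul1mx -mulmxA b'b mulmx1.
  have uTk : u *m T k = T k *m u := uT k.
  rewrite RT; move: (T k) uTk => X uX.
  rewrite !mulmxA -(mulmxA (b' *m u) b b') bb' mulmx1 -(mulmxA b' u) uX.
  by rewrite -(mulmxA (b' *m X) b b') bb' mulmx1 !mulmxA.
- case: unip => k uk; exists k.
  have E : b' *m u *m b - 1 = b' *m (u - 1) *m b.
    by rewrite mulmxBr mulmxBl mulmx1 b'b.
  rewrite E; have -> : (b' *m (u - 1) *m b) ^+ k = b' *m (u - 1) ^+ k *m b.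
    elim: k {uk} => [|k IH]; first by rewrite !expr0 mulmx1 b'b.
    rewrite exprS IH -[_ * _]/(_ *m _) !mulmxA -(mulmxA _ b b') bb' mulmx1.
    by rewrite -(mulmxA b') -[(u - 1) *m _]exprS.
  by rewrite uk mulmx0 mul0mx.
- apply: mxle_mono gu _; apply: iter_leq_good good_trans_grow _.
  by rewrite leq_mul2l (leq_trans ds sS).
- by rewrite /g !mulmxA.
Qed.

(** The inverse is the only solution of a bounded linear system, hence equals the bounded
    solution. *)
Lemma inverse_bound n s (M M' : 'M[int]_n) :
  (0 < n * n <= s)%N -> mxle s M -> M *m M' = 1%:M -> mxle (lin_bound s) M'.
Proof.
move=> ns mM MM'.
pose F (ij : 'I_n * 'I_n) (X : 'M[int]_n) := (M *m X) ij.1 ij.2.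
have [ij|||ij i j|ij|X [HX BX _]] := @mx_solve _ n n s F M' 1.
- by move=> c X Y; rewrite /F mulmxDr -scalemxAr 2!mxE.
- by case/andP: ns.
- by rewrite /= (leq_trans _ (proj2 (andP ns))) //; case/andP: ns.
- rewrite /F mxE (bigD1 i) //= big1 ?addr0 => [|x xi]; rewrite !mxE ?eqxx.
    by case: (_ == j); rewrite ?mulr1 ?mulr0 //; apply: mM.
  by rewrite (negPf xi) mulr0.
- by rewrite /F MM' mxE; case: eqP => //=; case/andP: ns; lia.
have MX : M *m X = 1%:M by rewrite -MM'; apply/matrixP => i j; apply: (HX (i, j)).
suff -> : M' = X by [].
by rewrite -[M']mulmx1 -MX mulmxA (mulmx1C MM') mul1mx.
Qed.

(** * Chains of bases and the removal of loops *)

Definition chain B e d (R : 'I_e -> 'M[int]_d) (l : nat) (b : 'M[int]_d) : Prop :=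
  exists be : nat -> 'M[int]_d, [/\ be 0%N = 1%:M, be l = b,
    forall k, (k < l)%N -> exists2 w, mxle B w & be k.+1 = w *m be k &
    forall k, (k <= l)%N -> exists b', be k *m b' = 1%:M /\
       forall j, mxle B (be k *m R j *m b')].

Lemma chain_rcons B e d (R : 'I_e -> 'M[int]_d) l b w b1 b1' :
  chain B R l b -> mxle B w -> b1 = w *m b -> b1 *m b1' = 1%:M ->
  (forall j, mxle B (b1 *m R j *m b1')) -> chain B R l.+1 b1.
Proof.
case=> be [be0 bel step inv] mw b1E bb1 mb1.
exists (fun k => if (k <= l)%N then be k else b1); split=> //.
- by rewrite ltnn.
- move=> k kl1; have [->|kl] : k = l \/ (k < l)%N by lia.
    by exists w => //; rewrite ltnn leqnn bel.
  by have [w' mw' E] := step k kl; exists w'; rewrite // kl (ltnW kl).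
- move=> k _; case: (leqP k l) => [kl|_]; first exact: inv.
  by exists b1'.
Qed.

Lemma chain_mxle t B e d (R : 'I_e -> 'M[int]_d) l b :
  (1 < t)%N -> (d <= t)%N -> (B <= t)%N -> chain B R l b -> mxle (t ^ (2 * l)) b.
Proof.
move=> t1 dt Bt [be [be0 <- step _]].
elim: l step => [|l IH] step.
  by rewrite be0 => i j; rewrite !mxE; case: eqP.
have [w mw ->] := step l (leqnn _).
rewrite (_ : 2 * l.+1 = 1 + 1 + 2 * l)%N; last by lia.
apply: mxle_mul => //; first by rewrite expn1; apply: mxle_mono mw Bt.
by apply: IH => k kl; apply: step; lia.
Qed.

Lemma invmxP n (M M' : 'M[int]_n) : M *m M' = 1%:M -> invmx M = M'.
Proof.
move=> MM'; have [uM _] := mulmx1_unit MM'.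
by rewrite -[RHS]mul1mx -(mulVmx uM) -mulmxA MM' mulmx1.
Qed.

(** Abstracts a block determinant on automorphisms; by [sign_charV] its values there are 1 and
    -1. *)
Definition is_sign_char e d (R : 'I_e -> 'M[int]_d) (chi : 'M[int]_d -> int) : Prop :=
  (forall u v, rep_aut R u -> rep_aut R v -> chi (u *m v) = chi u * chi v) /\
  (forall u, rep_aut R u -> unipotent u -> chi u = 1).

Lemma sign_charV e d (R : 'I_e -> 'M[int]_d) chi u u' :
  is_sign_char R chi -> rep_aut R u -> u *m u' = 1%:M -> chi u * chi u' = 1.
Proof.
case=> chiM chi1 au uu'; rewrite -chiM //; last exact: rep_autV uu'.
by rewrite uu' chi1 //; [apply: rep_aut1|apply: unipotent1].
Qed.

(** The number of e-tuples of d by d matrices bounded by B, each with a vector of K signs. *)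
Definition chain_bound (B e d K : nat) : nat := ((2 * B).+1 ^ (e * (d * d)) * 2 ^ K)%N.

(* Two visits to the same tuple of matrices differ by an automorphism; if it  *)
(* has trivial signs, the part of the chain in between can be cut out.        *)
Lemma chain_shorten B e d (R : 'I_e -> 'M[int]_d) (K : finType)
    (chi : K -> 'M[int]_d -> int) (b : 'M[int]_d) l :
  (forall k, is_sign_char R (chi k)) ->
  (exists u, [/\ rep_aut R u, forall k, chi k u = 1 & chain B R l (b *m u)]) ->
  exists2 l', (l' <= chain_bound B e d #|K|)%N &
    exists u, [/\ rep_aut R u, forall k, chi k u = 1 & chain B R l' (b *m u)].
Proof.
move=> chiP; elim/ltn_ind: l => l IH [u [au chu [be [be0 bel step inv]]]].
have [lV|Vl] := leqP l (chain_bound B e d #|K|).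
  by exists l => //; exists u; split=> //; exists be.
pose tau k j := be k *m R j *m invmx (be k).
have bV k : (k <= l)%N -> be k *m invmx (be k) = 1%:M.
  by move=> /inv [b' [bb' _]]; rewrite (invmxP bb').
have Vb k : (k <= l)%N -> invmx (be k) *m be k = 1%:M by move=> /bV /mulmx1C.
have tauB k j : (k <= l)%N -> mxle B (tau k j).
  by move=> /inv [b' [bb' mb]]; rewrite /tau (invmxP bb'); apply: mb.
pose code1 (k : nat) : {ffun 'I_e * ('I_d * 'I_d) -> 'I_(2 * B).+1} :=
  [ffun x => inord `|(tau k x.1 x.2.1 x.2.2 + B%:Z)%R|%N].
have code1P k k' : (k <= l)%N -> (k' <= l)%N -> code1 k = code1 k' -> tau k =1 tau k'.
  move=> kl kl' /ffunP E j; apply/matrixP => x y.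
  have := E (j, (x, y)); rewrite !ffunE /= => /(congr1 val) /=.
  have := tauB k j kl x y; have := tauB k' j kl' x y.
  move: (tau k j x y) (tau k' j x y) => z z' h h'.
  by rewrite !inordK; lia.
(* The earliest visit to the same tuple is a common reference; the automorphism [a k] moves basis k
   to it, and the signs of [a k] join the code for the pigeonhole. *)
pose first k := index (code1 k) [seq code1 i | i <- iota 0 l.+1].
have firstP k : (k <= l)%N -> (first k <= l)%N /\ code1 (first k) = code1 k.
  move=> kl; have cin : code1 k \in [seq code1 i | i <- iota 0 l.+1].
    by apply/map_f; rewrite mem_iota.
  have := cin; rewrite -index_mem size_map size_iota ltnS -/(first k) => fl.
  split=> //; have := nth_index (code1 0%N) cin; rewrite -/(first k).
  by rewrite (nth_map 0%N) ?size_iota // nth_iota.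
pose a k := invmx (be k) *m be (first k).
have ba k : (k <= l)%N -> be k *m a k = be (first k).
  by move=> kl; rewrite mulmxA bV // mul1mx.
have aa k : (k <= l)%N -> rep_aut R (a k).
  move=> kl; have [fl cE] := firstP k kl; have tE := code1P _ _ fl kl cE.
  split; last by exists (invmx (be (first k)) *m be k);
    rewrite mulmxA -(mulmxA _ (be (first k))) bV // mulmx1 Vb.
  have RE i k0 : (k0 <= l)%N -> R i = invmx (be k0) *m tau k0 i *m be k0.
    by move=> h; rewrite /tau !mulmxA Vb // mul1mx -mulmxA Vb // mulmx1.
  move=> i; rewrite {1}(RE i _ fl) (RE i _ kl) tE /a.
  move: (tau k i) => X.
  rewrite !mulmxA -(mulmxA (invmx (be k)) (be (first k))) bV // mulmx1.
  by rewrite -(mulmxA (_ *m X) (be k)) bV // mulmx1.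
pose code k := (code1 k, [ffun x => chi x (a k) == 1]).
have [i [j [ij jl cE]]] : exists i j, [/\ (i < j)%N, (j <= l)%N & code i = code j].
  have : ~~ injectiveb (fun k : 'I_l.+1 => code k).
    apply/negP => /injectiveP /leq_card.
    rewrite card_ord card_prod !card_ffun card_bool !card_prod !card_ord.
    by apply/negP; rewrite -ltnNge ltnS; apply: ltnW.
  case/injectivePn => x [y xy E].
  have [lxy|lxy] : (x < y)%N \/ (y < x)%N.
    by move: xy; rewrite neq_ltn => /orP.
  - by exists x, y; split=> //; rewrite -ltnS.
  - by exists y, x; split=> //; rewrite -ltnS.
have il : (i <= l)%N by lia.
case: cE => c1E /ffunP c2E.
have [[_ [ai' aai]] fE] : rep_aut R (a i) /\ first i = first j.
  by split; [apply: aa|rewrite /first c1E].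
pose v := a j *m ai'.
have av : rep_aut R v by apply: rep_autM; [apply: aa|apply: rep_autV aai; apply: aa].
have bv : be j *m v = be i.
  by rewrite /v mulmxA ba // -fE -ba // -mulmxA aai mulmx1.
(* The signs of [a i] and [a j] agree and are 1 or -1, so they cancel. *)
have chv k : chi k v = 1.
  have [chM _] := chiP k.
  rewrite /v chM; [|exact: aa|by apply: rep_autV aai; apply: aa].
  have := c2E k; rewrite !ffunE.
  have := sign_charV (chiP k) (aa i il) aai.
  have [_ [aj' aaj]] := aa j jl; have := sign_charV (chiP k) (aa j jl) aaj.
  move: (chi k _) (chi k _) (chi k _) (chi k _) => x1 x2 x3 x4.
  have sgn (y z : int) : y * z = 1 -> (y = 1 /\ z = 1) \/ (y = -1 /\ z = -1).
    move=> yz; have : (`|y| * `|z| == 1)%N by rewrite -abszM yz.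
    rewrite muln_eq1 => /andP [/eqP h1 _]; have [yE|yE] : y = 1 \/ y = -1 by lia.
      by left; move: yz; rewrite yE mul1r.
    by right; move: yz; rewrite yE; lia.
  by move=> /sgn [[-> _]|[-> _]] /sgn [[-> ->]|[-> ->]].
have [v' vv'] := av.2.
clearbody v.
apply: (IH (l - (j - i))%N); first lia.
exists (u *m v); split; first exact: rep_autM.
  by move=> k; have [chM _] := chiP k; rewrite chM // chu chv.
(* The times from i to j are skipped and all later bases are multiplied by v, which commutes with
   the action and so leaves the action matrices unchanged. *)
exists (fun k => if (k <= i)%N then be k else be (k + (j - i))%N *m v); split.
- by [].
- case: leqP => lE.
    have -> : (l - (j - i) = i)%N by lia.
    by rewrite -bv (_ : j = l) ?bel ?mulmxA //; lia.
  by rewrite subnK ?bel ?mulmxA //; lia.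
- move=> k kl; case: (ltngtP k i) => [ki|ki|ki].
  + by apply: step; lia.
  + have [w mw wE] := step (k + (j - i))%N (ltac:(lia)).
    by exists w => //; rewrite addSn wE mulmxA.
  + subst k.
    have [w mw wE] := step j (ltac:(lia)).
    exists w => //; rewrite addSn subnKC; last by lia.
    by rewrite wE -mulmxA bv.
- move=> k kl; case: (leqP k i) => ki; first by apply: inv; lia.
  have [b' [bb' mb]] := inv (k + (j - i))%N (ltac:(lia)).
  exists (v' *m b'); split; first by rewrite mulmxA -(mulmxA _ v) vv' mulmx1.
  move=> x; rewrite -(mulmxA _ v) (av.1 x) !mulmxA -(mulmxA _ v v') vv' mulmx1.
  exact: mb.
Qed.

(** The entries of a product along a loop-free chain, followed by those of its inverse. *)
Definition walk_grow (B : nat) : nat :=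
  lin_bound (B.+1 ^ (2 * (2 * B).+1 ^ (B * (B * B) + B)) + B * B).

Definition iso_grow (s : nat) : nat := walk_grow (step_grow (basis_grow s)).

Lemma good_iso_grow : good iso_grow.
Proof.
apply: (@good_comp walk_grow); last exact: good_comp good_step_grow good_basis_grow.
have gid := good_id; have g2 : good (fun x => 2 * x)%N by apply: good_mulc.
apply: (@good_comp lin_bound _ good_lin_bound); apply: good_add; last exact: good_mul.
apply: good_exp => //; apply: good_mulc => //; apply: good_exp => //.
by apply: good_add => //; do 2!apply: good_mul => //.
Qed.

Lemma sq_delta d (i : 'I_d) : sq (delta_mx 0 i : 'rV_d) = 1.
Proof.
rewrite /sq /dot (bigD1 i) //= big1 ?addr0 => [|j ji]; rewrite !mxE eqxx ?eqxx //=.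
by rewrite (negPf ji) mul0r.
Qed.

Lemma sq_entry_le d (x : 'rV[int]_d) i : x 0 i ^+ 2 <= sq x.
Proof.
rewrite /sq /dot (bigD1 i) //= -expr2 lerDl; apply: sumr_ge0 => j _.
by rewrite -expr2 sqr_ge0.
Qed.

(** * The path of forms from |v|^2 to |v g|^2 *)

Section FormChain.
Variables (s e d : nat) (a : 'I_e -> 'M[int]_e) (eps : 'rV[int]_e) (c : 'M[int]_e).
Variables (del : int) (R R' : 'I_e -> 'M[int]_d) (g g' : 'M[int]_d).
Hypotheses (s1 : (1 < s)%N) (es : (e <= s)%N) (ds : (d <= s)%N).
Hypotheses (cas : casimir a eps c del) (cs : mxle s c) (dels : (`|del| <= s)%N).
Hypothesis (rep : is_rep a eps R).
Hypotheses (mR : forall k, mxle s (R k)) (mR' : forall k, mxle s (R' k)).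
Hypotheses (gg' : g *m g' = 1%:M) (gR : forall k, R k *m g = g *m R' k).

(** Realises the form 4^(2m-j) |v|^2 + 4^j |v g|^2 as a Euclidean squared length, to which lattice
    reduction applies. *)
Definition form_mx (m j : nat) : 'M[int]_(d, d + d) :=
  row_mx (2 ^+ (2 * m - j))%:M (2 ^+ j *: g).

Lemma form_mxE m j (v : 'rV_d) :
  sq (v *m form_mx m j) = 4 ^+ (2 * m - j) * sq v + 4 ^+ j * sq (v *m g).
Proof.
rewrite /form_mx mul_mx_row sq_row_mx mul_mx_scalar -scalemxAr !sqZ -!exprM.
by rewrite ![(_ * 2)%N]mulnC !exprM.
Qed.

Lemma form_mx_inj m j (x : 'rV_d) : x *m form_mx m j = 0 -> x = 0.
Proof.
move=> x0; have := form_mxE m j x; rewrite x0 (_ : sq 0 = 0); last first.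
  by apply/eqP; rewrite sq_eq0.
have h1 : 0 < (4 : int) ^+ (2 * m - j) by rewrite exprn_gt0.
have h2 : 0 <= (4 : int) ^+ j * sq (x *m g) by rewrite mulr_ge0 ?sq_ge0 // exprn_ge0.
move=> h3; apply/eqP; rewrite -sq_eq0; apply/eqP.
have h4 := sq_ge0 x; move: (sq x) (4 ^+ _) (4 ^+ j * _) h1 h2 h3 h4 => y z w *; nia.
Qed.

Lemma sq_mulR k (v : 'rV_d) : sq (v *m R k) <= ((s ^ 4)%N)%:Z * sq v.
Proof.
apply: le_trans (sq_mulmx_bound v (mR k)) _; rewrite ler_wpM2r ?sq_ge0 // lez_nat.
by rewrite !expnS expn0 muln1 -!mulnA !leq_mul.
Qed.

Lemma sq_mulR' k (v : 'rV_d) : sq (v *m R' k) <= ((s ^ 4)%N)%:Z * sq v.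
Proof.
apply: le_trans (sq_mulmx_bound v (mR' k)) _; rewrite ler_wpM2r ?sq_ge0 // lez_nat.
by rewrite !expnS expn0 muln1 -!mulnA !leq_mul.
Qed.

(** Since R k g = g R' k, the term |v|^2 is controlled by the bound on R k and the term |v g|^2 by
    the bound on R' k. *)
Lemma form_mx_bound m j k (v : 'rV_d) :
  sq (v *m R k *m form_mx m j) <= ((s ^ 4)%N)%:Z * sq (v *m form_mx m j).
Proof.
rewrite !form_mxE mulrDr -(mulmxA v) gR mulmxA !(mulrCA _ (4 ^+ _)).
by apply: lerD; rewrite ler_wpM2l ?exprn_ge0 ?sq_mulR ?sq_mulR'.
Qed.

Lemma form_mx_adj m j (v : 'rV_d) : (j < 2 * m)%N ->
  sq (v *m form_mx m j) <= 4 * sq (v *m form_mx m j.+1) /\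
  sq (v *m form_mx m j.+1) <= 4 * sq (v *m form_mx m j).
Proof.
move=> jm; rewrite !form_mxE (_ : 2 * m - j = (2 * m - j.+1).+1)%N; last by lia.
rewrite !exprS.
have h1 : 0 <= (4 : int) ^+ (2 * m - j.+1) * sq v by rewrite mulr_ge0 ?sq_ge0 ?exprn_ge0.
have h2 : 0 <= (4 : int) ^+ j * sq (v *m g) by rewrite mulr_ge0 ?sq_ge0 ?exprn_ge0.
rewrite -!mulrA; move: (4 ^+ _ * _) (4 ^+ _ * _) h1 h2 => x y h1 h2.
by split; lia.
Qed.

(** For large m one term dominates at either end and gives all vectors of a suitable basis about the
    same length: the standard basis at the start, the rows of the inverse of g at the end. Hence lam
    is constant. *)
Lemma form_mx_end : exists2 m, (0 < m)%N &
  good_basis (basis_grow s) R (form_mx m 0) 1%:M /\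
  good_basis (basis_grow s) R (form_mx m (2 * m)) g'.
Proof.
have g'g : g' *m g = 1%:M by apply: mulmx1C.
have [L [L0 Lg Lg']] : exists L : nat, [/\ (0 < L)%N, forall i, sq (row i g) <= L%:Z &
    forall i, sq (row i g') <= L%:Z].
  exists (1 + \sum_i `|sq (row i g)| + \sum_i `|sq (row i g')|)%N; split=> // i.
    by rewrite (bigD1 i) //=; have := sq_ge0 (row i g); lia.
  by rewrite addnC (bigD1 i) //=; have := sq_ge0 (row i g'); lia.
have LE : L%:Z <= 4 ^+ (2 * L).
  rewrite -natrX natz lez_nat; apply: ltnW; apply: leq_trans (ltn_expl L (isT : 1 < 4)%N) _.
  by rewrite leq_exp2l //; lia.
have K1 : (s ^ 2 <= basis_grow s)%N.
  apply: (@leq_trans (pow_grow s)); first by apply: expn_le_pow_grow; lia.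
  apply: leq_trans (good_infl _ good_pow_grow).
  exact: iter_good_le good_pow_grow.
have K2 : (2 <= basis_grow s)%N by apply: leq_trans K1; rewrite expnS expn1; nia.
set K := basis_grow s in K1 K2 *.
have scst : scale_seq d (fun=> 4 ^ (2 * L))%N by split=> // i _; rewrite expn_gt0.
have cstE : ((4 ^ (2 * L))%N)%:Z = 4 ^+ (2 * L) by rewrite -natrX natz.
have pos : 0 < (4 : int) ^+ (2 * L) by rewrite exprn_gt0.
have lcst (M : 'M[int]_d) : mxle s M ->
    lbd K (fun=> 4 ^ (2 * L))%N (fun=> 4 ^ (2 * L))%N M /\ mxle K M.
  move=> mM; split=> i j.
    by rewrite leq_mul2r (leq_trans _ K1) ?orbT // leq_exp2r.
  by apply: leq_trans (mM i j) (leq_trans _ K1); rewrite expnS expn1 leq_pmulr //; lia.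
exists L => //; split.
- exists 1%:M, (fun=> 4 ^ (2 * L))%N; split=> //; rewrite ?mulmx1 //.
  + move=> x i; rewrite mulmx1 form_mxE subn0 cstE mulrC.
    apply: (@le_trans _ _ (1 * (4 ^+ (2 * L) * sq x + 4 ^+ 0 * sq (x *m g)))).
      by rewrite mul1r ler_wpDr ?mulr_ge0 ?sq_ge0 // ler_wpM2l ?sq_entry_le // ltW.
    by rewrite ler_wpM2r ?lez_nat ?addr_ge0 ?mulr_ge0 ?sq_ge0 ?exprn_ge0 //; lia.
  + move=> i; rewrite mul1mx rowE form_mxE subn0 expr0 mul1r sq_delta mulr1 cstE -rowE.
    have := Lg i; have : 2 * 4 ^+ (2 * L) <= K%:Z * 4 ^+ (2 * L).
      by rewrite ler_wpM2r ?lez_nat // ltW.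
    move: LE; move: (4 ^+ _) (sq _) => x y; lia.
  + by move=> k; rewrite mul1mx mulmx1; apply: lcst.
- exists g, (fun=> 4 ^ (2 * L))%N; split=> //.
  + move=> x i; rewrite form_mxE subnn expr0 mul1r -(mulmxA x) g'g mulmx1 cstE mulrC.
    apply: (@le_trans _ _ (1 * (sq (x *m g') + 4 ^+ (2 * L) * sq x))).
      by rewrite mul1r ler_wpDl ?sq_ge0 // ler_wpM2l ?sq_entry_le // ltW.
    by rewrite ler_wpM2r ?lez_nat ?addr_ge0 ?mulr_ge0 ?sq_ge0 ?exprn_ge0 //; lia.
  + move=> i; rewrite row_mul form_mxE subnn expr0 mul1r -row_mul g'g.
    rewrite row1 sq_delta mulr1 cstE.
    have := Lg' i; have : 2 * 4 ^+ (2 * L) <= K%:Z * 4 ^+ (2 * L).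
      by rewrite ler_wpM2r ?lez_nat // ltW.
    move: LE; move: (4 ^+ _) (sq _) => x y; lia.
  + by move=> k; rewrite -mulmxA gR mulmxA g'g mul1mx; apply: lcst.
Qed.

Variables (K : finType) (chi : K -> 'M[int]_d -> int).
Hypotheses (Ks : (#|K| <= s)%N) (chiP : forall k, is_sign_char R (chi k)).

Let B := step_grow (basis_grow s).

Let s_basis : (s <= basis_grow s)%N := good_infl _ good_basis_grow.
Let basis_B : (basis_grow s <= B)%N := good_infl _ good_step_grow.

Lemma form_chain_step m j b u b1 : (j < 2 * m)%N ->
  good_basis (basis_grow s) R (form_mx m j) b ->
  rep_aut R u -> (forall k, chi k u = 1) -> chain B R j (b *m u) ->
  good_basis (basis_grow s) R (form_mx m j.+1) b1 ->
  exists u1, [/\ rep_aut R u1, forall k, chi k u1 = 1 & chain B R j.+1 (b1 *m u1)].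
Proof.
move=> jm gb au chu ch gb1.
have [v [w [av unip mw E]]] := good_basis_step (leq_trans s1 s_basis) (leq_trans es s_basis)
  (leq_trans ds s_basis) cas (mxle_mono cs s_basis) (leq_trans dels s_basis) rep
  (fun v => proj1 (form_mx_adj v jm)) (fun v => proj2 (form_mx_adj v jm)) gb gb1.
have avu := rep_autM av au; exists (v *m u); split=> // [k|].
  by have [chM ch1] := chiP k; rewrite chM // chu mulr1 ch1.
have [vu' vuE] := avu.2; have [b1' [lam [bb1 _ _ _ mb1]]] := gb1.
apply: (chain_rcons ch mw (b1' := vu' *m b1')).
- by rewrite !mulmxA E.
- by rewrite mulmxA -(mulmxA b1) vuE mulmx1.
move=> k; rewrite -(mulmxA b1 (v *m u)) avu.1 !mulmxA -(mulmxA _ v u) -(mulmxA _ (v *m u)).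
rewrite vuE mulmx1; apply: mxle_mono basis_B; by have [] := mb1 k.
Qed.

Lemma form_chain m j : (j <= 2 * m)%N ->
  good_basis (basis_grow s) R (form_mx m 0) 1%:M ->
  exists b u, [/\ good_basis (basis_grow s) R (form_mx m j) b, rep_aut R u,
    forall k, chi k u = 1 & chain B R j (b *m u)].
Proof.
move=> jm gb0; elim: j jm => [_|j IH jm].
  exists 1%:M, 1%:M; split=> //; first exact: rep_aut1.
    by move=> k; case: (chiP k) => _; apply; [apply: rep_aut1|apply: unipotent1].
  exists (fun=> 1%:M); split; rewrite ?mulmx1 // => k _.
  exists 1%:M; rewrite mulmx1; split=> // j; rewrite mul1mx mulmx1.
  by apply: (mxle_mono (mR j)); apply: leq_trans s_basis basis_B.
have [b [u [gb au chu ch]]] := IH (ltnW jm).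
have [b1 gb1] := good_basis_exists s1 es ds cas cs dels rep
  (@form_mx_inj m j.+1) (@form_mx_bound m j.+1).
have [u1 [au1 chu1 ch1]] := form_chain_step jm gb au chu ch gb1.
by exists b1, u1.
Qed.

(** The last step of the walk is made to end at the basis g' rather than at one found by reduction.
    After shortening, g' u is bounded for an automorphism u with trivial signs; its inverse is h,
    and g h' = u. *)
Theorem bounded_isomorphism : exists h h' : 'M[int]_d, [/\ h *m h' = 1%:M,
  forall k, R k *m h = h *m R' k, mxle (iso_grow s) h & forall k, chi k (g *m h') = 1].
Proof.
have [m m0 [gb0 gbe]] := form_mx_end.
have [l lE] : exists l, (2 * m)%N = l.+1 by exists (2 * m).-1; lia.
have [b [u [gb au chu ch]]] := @form_chain m l (ltac:(lia)) gb0.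
rewrite lE in gbe.
have lm : (l < 2 * m)%N by rewrite lE.
have [u1 [au1 chu1 ch1]] := form_chain_step lm gb au chu ch gbe.
have [l' l'V [u2 [au2 chu2 ch2]]] :=
  chain_shorten chiP (ex_intro _ u1 (And3 au1 chu1 ch1)).
have [u2' uu2] := au2.2.
have sB : (s <= B)%N := leq_trans s_basis basis_B.
have B1 : (1 < B)%N := leq_trans s1 sB.
have g'g : g' *m g = 1%:M by apply: mulmx1C.
have hh' : (g' *m u2) *m (u2' *m g) = 1%:M by rewrite mulmxA -(mulmxA g') uu2 mulmx1.
exists (u2' *m g), (g' *m u2); split.
- exact: mulmx1C.
- move=> k; rewrite mulmxA -(rep_autV au2 uu2).1 -!mulmxA.
  by rewrite gR.
- have := chain_mxle B1 (leq_trans ds sB) (leqnn B) ch2 => mb.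
  case: (posnP d) => [d0|d0]; first by move=> i; exfalso; have := ltn_ord i; lia.
  apply: inverse_bound hh'.
    rewrite muln_gt0 d0 /=; apply: leq_trans (leq_addl _ _).
    by apply: leq_mul; apply: leq_trans ds sB.
  apply: (mxle_mono mb); apply: leq_trans (leq_addr _ _).
  apply: (@leq_trans (B.+1 ^ (2 * l'))); first by case: (2 * l')%N => // n; rewrite leq_exp2r.
  rewrite leq_pexp2l // leq_mul2l; apply: leq_trans l'V _; rewrite /chain_bound expnD.
  apply: leq_mul.
    rewrite leq_pexp2l // leq_mul ?(leq_trans es sB) //.
    by rewrite leq_mul ?(leq_trans ds sB).
  apply: (@leq_trans ((2 * B).+1 ^ #|K|)); last by rewrite leq_pexp2l ?(leq_trans Ks sB).
  by case: #|K| => // n; rewrite leq_exp2r //; lia.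
- by move=> k; rewrite mulmxA gg' mul1mx.
Qed.
End FormChain.

(** * The radical of the trace form *)

(** Factor e = C D through its rank; idempotence gives D C = 1, and tr (C D) = tr (D C). *)
Lemma mxtrace_idem (F : fieldType) n (e : 'M[F]_n) : e *m e = e -> \tr e = (\rank e)%:R.
Proof.
move=> ee; rewrite -{1}(mulmx_base e) mxtrace_mulC.
suff -> : row_base e *m col_base e = 1%:M by rewrite mxtrace1.
apply: (row_full_inj (col_base_full e)); apply: (row_free_inj (row_base_free e)).
by rewrite /mulmxr /= mulmx1 mulmxA mulmx_base -mulmxA mulmx_base.
Qed.

(* Fitting: if A is not nilpotent then some polynomial in A without constant  *)
(* term is a nonzero idempotent, and its trace is its rank.                   *)
Lemma trace_nilpotent_rat n (A : 'M[rat]_n.+1) :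
  (forall k, \tr (A ^+ k.+1) = 0) -> exists k, A ^+ k = 0.
Proof.
move=> trA; set p := char_poly A.
have p0 : p != 0 by rewrite monic_neq0 ?char_poly_monic.
have [m [q Hq pE]] := multiplicity_XsubC p 0.
rewrite p0 subr0 /= in Hq pE.
have cop : coprimep q 'X^(m.+1).
  rewrite coprimep_expr // -['X]subr0 -polyC0 coprimep_XsubC.
  exact: Hq.
have /Bezout_eq1_coprimepP [[u v] /= uv] := cop.
have annih : horner_mx A (q * 'X^(m.+1)) = 0.
  by rewrite exprSr mulrA -pE rmorphM /= Cayley_Hamilton mul0r.
pose e := horner_mx A (v * 'X^(m.+1)).
have e1 : 1 = horner_mx A (u * q) + e by rewrite /e -rmorphD uv rmorph1.
have ee : e *m e = e.
  have : e * (1 - e) = 0.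
    rewrite {1}e1 addrK /e -rmorphM /=.
    rewrite (_ : v * 'X^(m.+1) * (u * q) = v * u * (q * 'X^(m.+1))); last by ring.
    by rewrite rmorphM /= annih mulr0.
  by rewrite mulrBr mulr1 => /eqP; rewrite subr_eq0 => /eqP E; apply: esym E.
have tre : \tr e = 0.
  have hornerE (w : {poly rat}) : horner_mx A w = \sum_(i < size w) w`_i *: A ^+ i.
    rewrite -{1}[w]coefK poly_def rmorph_sum; apply: eq_bigr => i _.
    by rewrite /= -mul_polyC rmorphM /= horner_mx_C rmorphXn /= horner_mx_X
       -[_ * _]/(_ *m _) mul_scalar_mx.
  rewrite /e exprSr mulrA rmorphM /= horner_mx_X hornerE mulr_suml linear_sum big1 // => i _.
  by rewrite /= -scalerAl -exprSr linearZ /= trA mulr0.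
have e0 : e = 0.
  apply/eqP; rewrite -mxrank_eq0; move/eqP: tre; rewrite mxtrace_idem //.
  by rewrite pnatr_eq0.
have XA : A ^+ m.+1 = horner_mx A 'X^(m.+1) by rewrite rmorphXn /= horner_mx_X.
exists m.+1; rewrite -[LHS]mulr1 e1 e0 addr0 XA -rmorphM /=.
rewrite (_ : 'X^(m.+1) * (u * q) = u * (q * 'X^(m.+1))); last by ring.
by rewrite rmorphM /= annih mulr0.
Qed.

Lemma trace_nilpotent n (z : 'M[int]_n) :
  (forall k, \tr (z ^+ k.+1) = 0) -> exists k, z ^+ k = 0.
Proof.
case: n z => [|n] z trz; first by exists 0%N; apply: flatmx0.
pose f : int -> rat := intr.
have mapX k : map_mx intr (z ^+ k) = (map_mx intr z : 'M[rat]_n.+1) ^+ k.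
  elim: k => [|k IH]; first by rewrite !expr0 [LHS]map_mx1.
  by rewrite !exprS -IH -[_ * _]/(_ *m _) map_mxM.
have [k Hk] : exists k, (map_mx intr z : 'M[rat]_n.+1) ^+ k = 0.
  apply: trace_nilpotent_rat => k; rewrite -mapX trace_map_mx.
  by move: (trz k) => -> .
exists k; apply/matrixP => i j; have := congr1 (fun M : 'M_n.+1 => M i j) (mapX k).
by rewrite Hk !mxE => /eqP; rewrite intr_eq0 => /eqP.
Qed.

(** * The category of patterned matrices and the radical of its trace pairing *)

Section Hom.
Variables (m : nat) (r : rel 'I_m).
Hypotheses (r_refl : reflexive r) (r_trans : transitive r).

Definition mxhom (A B x : 'M[int]_m) : Prop :=
  (forall i j, ~~ r i j -> x i j = 0) /\ x *m A = B *m x.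

Lemma mxhom1 A : mxhom A A 1%:M.
Proof.
split; last by rewrite mul1mx mulmx1.
by move=> i j rij; rewrite mxE; case: eqP => // ij; rewrite ij r_refl in rij.
Qed.

Lemma mxhom_comp A B C x y : mxhom A B x -> mxhom B C y -> mxhom A C (y *m x).
Proof.
move=> [rx xA] [ry yB]; split; last by rewrite -mulmxA xA !mulmxA yB.
move=> i j rij; rewrite mxE big1 // => k _.
have [rik|/ry ->] := boolP (r i k); last by rewrite mul0r.
have [rkj|/rx ->] := boolP (r k j); last by rewrite mulr0.
by rewrite (r_trans rik rkj) in rij.
Qed.

Lemma mxhom0 A B : mxhom A B 0.
Proof. by split=> [i j _|]; rewrite ?mxE // mul0mx mulmx0. Qed.

Lemma mxhomD A B x y : mxhom A B x -> mxhom A B y -> mxhom A B (x + y).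
Proof.
move=> [rx xA] [ry yA]; split=> [i j rij|]; first by rewrite mxE rx ?ry ?addr0.
by rewrite mulmxDl mulmxDr xA yA.
Qed.

Lemma mxhomZ A B c x : mxhom A B x -> mxhom A B (c *: x).
Proof.
move=> [rx xA]; split=> [i j rij|]; first by rewrite mxE rx ?mulr0.
by rewrite -scalemxAl -scalemxAr xA.
Qed.

Lemma mxhomN A B x : mxhom A B x -> mxhom A B (- x).
Proof. by move=> hx; rewrite -scaleN1r; apply: mxhomZ. Qed.

Lemma mxhomB A B x y : mxhom A B x -> mxhom A B y -> mxhom A B (x - y).
Proof. by move=> hx hy; apply: mxhomD => //; apply: mxhomN. Qed.

Lemma mxhom_sum A B (I : finType) (x : I -> 'M[int]_m) :
  (forall i, mxhom A B (x i)) -> mxhom A B (\sum_i x i).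
Proof. by move=> hx; elim/big_ind: _ => //; [exact: mxhom0|move=> *; exact: mxhomD]. Qed.

Lemma mxhomX A x k : mxhom A A x -> mxhom A A (x ^+ k).
Proof.
by move=> hx; elim: k => [|k IH]; [exact: mxhom1|rewrite exprS; apply: mxhom_comp IH hx].
Qed.

(** The kernel of the pairing of Hom(A, B) with Hom(B, A), a two-sided ideal of the category. *)
Definition mxrad (A B x : 'M[int]_m) : Prop :=
  mxhom A B x /\ forall y, mxhom B A y -> \tr (y *m x) = 0.

Lemma mxrad_compl A B C x z : mxrad A B x -> mxhom B C z -> mxrad A C (z *m x).
Proof.
move=> [hx trx] hz; split; first exact: mxhom_comp hx hz.
by move=> y hy; rewrite mulmxA; apply/trx/mxhom_comp/hy.
Qed.

Lemma mxrad_compr A B C x w : mxrad A B x -> mxhom C A w -> mxrad C B (x *m w).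
Proof.
move=> [hx trx] hw; split; first exact: mxhom_comp hw hx.
by move=> y hy; rewrite mulmxA mxtrace_mulC mulmxA; apply/trx/mxhom_comp/hw.
Qed.

Lemma mxrad0 A B : mxrad A B 0.
Proof. by split=> [|y _]; [exact: mxhom0|rewrite mulmx0 mxtrace0]. Qed.

Lemma mxradD A B x y : mxrad A B x -> mxrad A B y -> mxrad A B (x + y).
Proof.
move=> [hx trx] [hy try_]; split=> [|z hz]; first exact: mxhomD.
by rewrite mulmxDr mxtraceD trx // try_ // addr0.
Qed.

Lemma mxradZ A B c x : mxrad A B x -> mxrad A B (c *: x).
Proof.
move=> [hx trx]; split=> [|z hz]; first exact: mxhomZ.
by rewrite -scalemxAr mxtraceZ trx // mulr0.
Qed.

Lemma mxradN A B x : mxrad A B x -> mxrad A B (- x).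
Proof. by move=> hx; rewrite -scaleN1r; apply: mxradZ. Qed.

Lemma mxrad_sum A B (I : finType) (x : I -> 'M[int]_m) :
  (forall i, mxrad A B (x i)) -> mxrad A B (\sum_i x i).
Proof. by move=> hx; elim/big_ind: _ => //; [exact: mxrad0|move=> *; exact: mxradD]. Qed.

(** Pairing x with its own powers shows that all positive powers have trace 0. *)
Lemma mxrad_nilpotent A x : mxrad A A x -> exists k, x ^+ k = 0.
Proof.
by move=> [hx trx]; apply: trace_nilpotent => k; rewrite exprSr; apply/trx/mxhomX.
Qed.
End Hom.

Lemma mxtrace_mul_delta n (y : 'M[int]_n) i j : \tr (y *m delta_mx i j) = y j i.
Proof.
rewrite /mxtrace (bigD1 j) //= big1 ?addr0 => [|k kj]; rewrite mxE (bigD1 i) //= big1 ?addr0.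
- by rewrite mxE !eqxx mulr1.
- by move=> l li; rewrite mxE (negPf li) mulr0.
- by rewrite mxE eqxx (negPf kj) mulr0.
- by move=> l li; rewrite mxE (negPf li) mulr0.
Qed.

Lemma absz_sum_ord_le n (F : 'I_n -> int) B :
  (forall i, (`|F i| <= B)%N) -> (`|(\sum_i F i)%R| <= n * B)%N.
Proof. by move=> /(absz_sum_le xpredT); rewrite card_ord. Qed.

Lemma mxtrace_mul_le n s t (y z : 'M[int]_n) :
  mxle s y -> mxle t z -> (`|\tr (y *m z)| <= n * (n * (s * t)))%N.
Proof.
move=> my mz; apply: absz_sum_ord_le => i; rewrite mxE; apply: absz_sum_ord_le => j.
by rewrite abszM leq_mul.
Qed.

Lemma sq_le p B (v : 'rV[int]_p) : mxle B v -> (`|sq v| <= p * (B * B))%N.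
Proof.
move=> mv; apply: absz_sum_ord_le => i.
by rewrite abszM leq_mul.
Qed.

(** * Bounded generators of Hom and a bounded basis modulo the radical *)

Section HomBasis.
Variables (m : nat) (r : rel 'I_m).
Hypotheses (r_refl : reflexive r) (r_trans : transitive r).

(** Pattern and intertwining conditions as one family of linear functionals, as [mx_solve] wants
    them. *)
Definition mxhom_eq (A B : 'M[int]_m) (k : ('I_m * 'I_m) + ('I_m * 'I_m)) (X : 'M[int]_m) : int :=
  match k with
  | inl ij => if r ij.1 ij.2 then 0 else X ij.1 ij.2
  | inr ij => (X *m A - B *m X) ij.1 ij.2
  end.

Lemma mxhom_eqP A B X : mxhom r A B X <-> forall k, mxhom_eq A B k X = 0.
Proof.
split=> [[rX XA] [[i j]|[i j]]|H] /=.
- by case: ifP => // /negbT /rX.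
- by rewrite XA subrr mxE.
split=> [i j rij|]; first by have := H (inl (i, j)); rewrite /= (negPf rij).
apply/eqP; rewrite -subr_eq0; apply/eqP/matrixP => i j; rewrite [RHS]mxE.
exact: (H (inr (i, j))).
Qed.

Lemma mxhom_eq_linear A B k : linear (mxhom_eq A B k : 'M[int]_m -> int^o).
Proof.
move=> c X Y; case: k => [[i j]|[i j]] /=.
  by case: ifP => _; rewrite ?scaler0 ?addr0 // 2!mxE.
by rewrite mulmxDl mulmxDr -scalemxAl -scalemxAr opprD addrACA -scalerBr 2!mxE.
Qed.

Lemma mxhom_eq_delta A B s k i j : (0 < s)%N -> mxle s A -> mxle s B ->
  (`|mxhom_eq A B k (delta_mx i j)| <= 2 * s)%N.
Proof.
move=> s0 mA mB; case: k => [[i' j']|[i' j']] /=.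
  by case: ifP => _ //; rewrite mxE; case: (_ && _) => //=; lia.
rewrite mxE [X in (`|(_ + X)%R|)%N]mxE; apply: absz_add_le; last rewrite abszN.
  rewrite mxE (bigD1 j) //= big1 ?addr0 => [|x xj]; rewrite !mxE ?eqxx ?andbT.
    by case: (i' == i); rewrite ?mul1r ?mul0r //; apply: mA.
  by rewrite (negPf xj) andbF mul0r.
rewrite mxE (bigD1 i) //= big1 ?addr0 => [|x xi]; rewrite !mxE ?eqxx.
  by case: (j' == j); rewrite ?mulr1 ?mulr0 //; apply: mB.
by rewrite (negPf xi) mulr0.
Qed.

Lemma half_diff (x y q : int) : q * 2 = y - x -> x = y + (- q + - q).
Proof. lia. Qed.

Lemma half_absz (x y z : int) L N : z + z = x - y ->
  (`|x| <= L + N -> `|y| <= L -> 0 < N -> `|z| <= L + N.-1)%N.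
Proof. lia. Qed.

(* Modulo 2 every element agrees with a bounded one; halving the difference   *)
(* gives a descent.                                                           *)
Lemma mxhom_ind A B s (P : 'M[int]_m -> Prop) :
  (1 < s)%N -> (m * m <= s)%N -> mxle s A -> mxle s B ->
  P 0 -> (forall x y, P x -> P y -> P (x + y)) ->
  (forall x, mxhom r A B x -> mxle (lin_bound (2 * s)) x -> P x) ->
  forall x, mxhom r A B x -> P x.
Proof.
move=> s1 ms mA mB P0 PD Pb.
set L := lin_bound _ in Pb.
suff H N x : mxhom r A B x -> mxle (L + N) x -> P x.
  move=> x hx; apply: (H (\sum_i \sum_j `|x i j|)%N x hx) => i j.
  by apply: leq_trans (leq_addl _ _); rewrite (bigD1 i) //= (bigD1 j) //= -addnA leq_addr.
elim/ltn_ind: N x => N IH x hx mx.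
case: (posnP N) => [N0|N0]; first by apply: Pb => //; rewrite N0 addn0 in mx.
have [k i j|k|x' [Hx' Bx' Dx']] := @mx_solve _ m m (2 * s) (mxhom_eq A B) x 2
  (@mxhom_eq_linear A B) (ltac:(lia)) (ltac:(lia)).
- by apply: mxhom_eq_delta => //; lia.
- by move/mxhom_eqP: hx => ->.
have hx' : mxhom r A B x' by apply/mxhom_eqP => k; rewrite Hx'; move/mxhom_eqP: hx => ->.
pose y : 'M[int]_m := \matrix_(i, j) (- ((x' i j - x i j) %/ 2)%Z).
have yE : x = x' + (y + y).
  apply/matrixP => i j; rewrite !mxE.
  exact: half_diff (divzK (Dx' i j)).
have y2 : y + y = x - x' by rewrite {1}yE [RHS]addrC addKr.
have hy : mxhom r A B y.
  have [ry yA] : mxhom r A B (y + y) by rewrite y2; apply: mxhomB.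
  split=> [i j /ry|]; first by rewrite mxE -mulr2n => /eqP; rewrite mulrn_eq0 /= => /eqP.
  apply: (zscalemx_inj (c := 2)) => //; by rewrite !scaler_nat !mulr2n -mulmxDl -mulmxDr.
have my : mxle (L + N.-1) y.
  move=> i j; apply: half_absz (mx i j) (Bx' i j) N0.
  by have := congr1 (fun M : 'M_m => M i j) y2; rewrite [LHS]mxE [RHS]mxE [(- x') i j]mxE.
have Py : P y by apply: IH my => //; lia.
by rewrite yE; apply: (PD x' (y + y)); [exact: Pb|exact: (PD y y)].
Qed.
End HomBasis.

Definition box_bound (s : nat) : nat := lin_bound (2 * s).

Definition hom_grow (s : nat) : nat := lin_bound (pow_grow (pow_grow (box_bound s))).

Lemma good_hom_grow : good hom_grow.
Proof.
apply: (good_comp good_lin_bound); do 2!apply: (good_comp good_pow_grow).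
by apply: (good_comp good_lin_bound); apply: good_mulc => //; apply: good_id.
Qed.

Lemma sq_mulmx_delta d p (h : 'M[int]_d) (G : 'M[int]_(d, p)) n (f : 'I_n -> 'I_d)
    (c : 'rV[int]_n) :
  (\sum_k c 0 k *: delta_mx 0 (f k) : 'rV_d) *m h *m G =
    \sum_k c 0 k *: row (f k) (h *m G).
Proof.
rewrite -mulmxA mulmx_suml; apply: eq_bigr => k _.
by rewrite -scalemxAl -rowE.
Qed.

Lemma box_digit_le L (n : 'I_(2 * L).+1) : (`|((n : nat)%:Z - L%:Z)%R| <= L)%N.
Proof. by have := ltn_ord n; lia. Qed.

Lemma box_digitK (z : int) L : (`|z| <= L)%N ->
  (nat_of_ord (inord `|(z + L%:Z)%R|%N : 'I_(2 * L).+1))%:Z - L%:Z = z.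
Proof. by move=> zL; rewrite inordK; lia. Qed.

Section HomBasis.
Variables (m : nat) (r : rel 'I_m) (s : nat).
Hypotheses (r_refl : reflexive r) (r_trans : transitive r).
Hypotheses (s1 : (1 < s)%N) (ms : (m * m <= s)%N).

Let L := box_bound s.

Definition box := {ffun 'I_m * 'I_m -> 'I_(2 * L).+1}.
Definition box_mx (f : box) : 'M[int]_m := \matrix_(i, j) ((f (i, j) : nat)%:Z - L%:Z).
Definition is_mxhom (A B x : 'M[int]_m) : bool :=
  [forall i, forall j, ~~ r i j ==> (x i j == 0)] && (x *m A == B *m x).
(** The matrices of the box that are no morphisms are replaced by 0, so that the index set does not
    depend on A and B. *)
Definition box_hom A B (q : 'I_#|box|) : 'M[int]_m :=
  if is_mxhom A B (box_mx (enum_val q)) then box_mx (enum_val q) else 0.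

Lemma is_mxhomP A B x : reflect (mxhom r A B x) (is_mxhom A B x).
Proof.
apply: (iffP andP) => [[/'forall_forallP rx /eqP xA]|[rx xA]]; split=> //.
- by move=> i j rij; apply/eqP; move/implyP: (rx i j); apply.
- by apply/'forall_forallP => i j; apply/implyP => /rx ->.
- by rewrite xA.
Qed.

Lemma box_hom_mxhom A B q : mxhom r A B (box_hom A B q).
Proof. by rewrite /box_hom; case: is_mxhomP => // _; apply: mxhom0. Qed.

Lemma box_hom_le A B q : mxle L (box_hom A B q).
Proof.
rewrite /box_hom; case: ifP => _ i j; last by rewrite mxE.
by rewrite mxE; apply: box_digit_le.
Qed.

Lemma box_hom_surj A B x : mxhom r A B x -> mxle L x -> exists q, box_hom A B q = x.
Proof.
move=> hx mx.
pose f : box := [ffun ij => inord `|(x ij.1 ij.2 + L%:Z)%R|%N].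
have fE : box_mx f = x.
  by apply/matrixP => i j; rewrite mxE ffunE; apply: box_digitK (mx i j).
by exists (enum_rank f); rewrite /box_hom enum_rankK fE; case: is_mxhomP.
Qed.

(** Traces against generators of Hom(B, A). This embeds Hom(A, B) modulo its radical in a lattice of
    bounded rank ([mxradP]). *)
Definition trace_row (A B x : 'M[int]_m) : 'rV[int]_#|box| :=
  \row_q \tr (box_hom B A q *m x).

Lemma trace_rowD A B x y : trace_row A B (x + y) = trace_row A B x + trace_row A B y.
Proof. by apply/rowP => q; rewrite !mxE mulmxDr mxtraceD. Qed.

Lemma trace_rowZ A B c x : trace_row A B (c *: x) = c *: trace_row A B x.
Proof. by apply/rowP => q; rewrite !mxE -scalemxAr mxtraceZ. Qed.

Lemma trace_row0 A B : trace_row A B 0 = 0.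
Proof. by apply/rowP => q; rewrite !mxE mulmx0 mxtrace0. Qed.

Lemma trace_row_sum A B n (c : 'rV[int]_n) (x : 'I_n -> 'M[int]_m) :
  trace_row A B (\sum_i c 0 i *: x i) = \sum_i c 0 i *: trace_row A B (x i).
Proof.
rewrite (big_morph _ (trace_rowD A B) (trace_row0 A B)).
by apply: eq_bigr => i _; rewrite trace_rowZ.
Qed.

Variables (A B : 'M[int]_m).
Hypotheses (mA : mxle s A) (mB : mxle s B).

Lemma mxradP x : mxhom r A B x -> (mxrad r A B x <-> trace_row A B x = 0).
Proof.
move=> hx; split=> [[_ trx]|trx].
  by apply/rowP => q; rewrite !mxE trx //; apply: box_hom_mxhom.
split=> // y; apply: (@mxhom_ind _ r B A s (fun y => \tr (y *m x) = 0) s1 ms mB mA).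
- by rewrite mul0mx mxtrace0.
- by move=> y1 y2 h1 h2; rewrite mulmxDl mxtraceD h1 h2 addr0.
move=> y' hy my; have [q <-] := box_hom_surj hy my.
by have := congr1 (fun v : 'rV_#|box| => v 0 q) trx; rewrite !mxE.
Qed.

Let p := #|box|.
Let gram : 'M[int]_p := \matrix_q trace_row A B (box_hom A B q).
Let T := pow_grow L.

Let sL : (2 * s <= L)%N := good_infl _ good_lin_bound.
Let L1 : (1 < L)%N. Proof. by apply: leq_trans sL; lia. Qed.
Let LT : (L <= T)%N := good_infl _ good_pow_grow.

Let sL' : (s <= L)%N. Proof. by apply: leq_trans sL; rewrite leq_pmull. Qed.

Let pow_le_T K : (K <= 100 * L)%N -> (L.+1 ^ K <= T)%N.
Proof. by move=> KL; rewrite /T /pow_grow leq_pexp2l. Qed.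

Let pT : (p <= T)%N.
Proof.
rewrite /p card_ffun card_prod !card_ord.
apply: (@leq_trans ((L.+1 ^ 2) ^ s)).
  apply: (@leq_trans ((2 * L).+1 ^ s)); first by rewrite leq_pexp2l.
  have H : ((2 * L).+1 <= L.+1 ^ 2)%N by rewrite expnS expn1; nia.
  by case: s => // n; rewrite leq_exp2r.
by rewrite -expnM; apply: pow_le_T; lia.
Qed.

Let m_s : (m <= s)%N. Proof. by apply: leq_trans ms; case: m => // n; rewrite leq_pmulr. Qed.

Let red_le t K : (T <= t)%N -> (K <= t ^ 20)%N -> (red_const p * K <= pow_grow t)%N.
Proof.
move=> Tt Kt; have pt : (p <= t)%N := leq_trans pT Tt.
have t1 : (1 < t)%N by apply: leq_trans Tt; apply: leq_trans LT.
apply: (@leq_trans (2 * t.+1 ^ t * t.+1 ^ 20)).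
  apply: leq_mul; last by apply: leq_trans Kt _; rewrite leq_exp2r.
  apply: leq_trans (red_const_le (leqnn p)) _; rewrite leq_mul2l /=.
  apply: (@leq_trans (t.+1 ^ p)); last by rewrite leq_pexp2l.
  by case: p pt => // n nt; rewrite leq_exp2r // ltnS ltnW // ltnS in nt *; lia.
apply: (@leq_trans (t.+1 ^ 1 * t.+1 ^ t * t.+1 ^ 20)).
  by rewrite !leq_mul2r expn1 ltnS (ltnW t1) !orbT.
by rewrite -!expnD /pow_grow leq_pexp2l //; lia.
Qed.

Let trace_row_le x t : (L <= t)%N -> mxle t x -> mxle (t ^ 4) (trace_row A B x).
Proof.
move=> Lt mx i q; rewrite mxE.
apply: leq_trans (mxtrace_mul_le (box_hom_le _ _ _) mx) _.
have mt : (m <= t)%N by apply: leq_trans m_s (leq_trans sL' Lt).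
by rewrite !expnS expn0 muln1 !leq_mul.
Qed.

(** The map [trace_row] sends Hom(A, B) onto the lattice spanned by the rows of [gram], with the
    radical as kernel. The nonzero vectors of a reduced basis of that lattice are bounded,
    [mx_solve] lifts them to bounded morphisms, and the inequality of [reduced_basis] bounds
    coordinates. *)
Lemma hom_basis : exists (d : nat) (x : 'I_d -> 'M[int]_m),
  [/\ (d <= hom_grow s)%N, forall i, mxhom r A B (x i) /\ mxle (hom_grow s) (x i),
    forall z, mxhom r A B z -> exists c : 'rV_d, mxrad r A B (z - \sum_i c 0 i *: x i),
    forall c : 'rV_d, mxrad r A B (\sum_i c 0 i *: x i) -> c = 0 &
    forall (c : 'rV_d) z t, (hom_grow s <= t)%N -> mxhom r A B z -> mxle t z ->
      mxrad r A B (z - \sum_i c 0 i *: x i) -> mxle (pow_grow t) c].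
Proof.
have [h [h' [hh' h'h red]]] := reduced_basis gram.
pose b i := row i (h *m gram).
pose nz := [pred i | b i != 0].
pose C := (red_const p)%:Z.
have gramE : h' *m (h *m gram) = gram by rewrite mulmxA h'h mul1mx.
(* As h' is invertible, b i has a nonzero coefficient in some row of [gram], whose length then
   bounds that of b i. *)
have sq_b i : b i != 0 -> sq (b i) <= C * ((p * (T ^ 4 * T ^ 4))%N)%:Z.
  move=> bi.
  have [q hq] : exists q, h' q i != 0.
    apply/existsP/contraT; rewrite negb_exists => /forallP H.
    have := congr1 (fun M : 'M_p => M i i) hh'; rewrite !mxE eqxx big1 // => q _.
    by have := H q; rewrite negbK => /eqP ->; rewrite mulr0.
  have := red (row q h'); rewrite (bigD1 i) //= => H.
  have H2 : row q h' 0 i ^+ 2 * sq (b i) <= C * sq (row q h' *m h *m gram).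
    by apply: le_trans H; rewrite lerDl; apply: sumr_ge0 => j _; rewrite mulr_ge0 ?sqr_ge0 ?sq_ge0.
  rewrite mxE -row_mul h'h in H2.
  have H3 : sq (b i) <= h' q i ^+ 2 * sq (b i).
    have : 0 < h' q i ^+ 2 by rewrite exprn_even_gt0.
    by move=> h0; rewrite ler_peMl ?sq_ge0 //; lia.
  apply: le_trans H3 (le_trans H2 _); rewrite ler_wpM2l //.
  rewrite -row_mul mul1mx rowK -[sq _]gez0_abs ?sq_ge0 // lez_nat; apply: sq_le.
  apply: trace_row_le => // i' j; exact: leq_trans (box_hom_le _ _ _ _ _) LT.
have entry_b i : mxle (pow_grow T) (b i).
  have [->|bi] := eqVneq (b i) 0; first by move=> ? ?; rewrite mxE.
  move=> o j; rewrite ord1.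
  have : (`|b i ord0 j| ^ 2 <= red_const p * (p * (T ^ 4 * T ^ 4)))%N.
    rewrite -lez_nat -abszX gez0_abs ?sqr_ge0 // PoszM.
    exact: le_trans (sq_entry_le _ _) (sq_b i bi).
  have Tle : (red_const p * (p * (T ^ 4 * T ^ 4)) <= pow_grow T)%N.
    apply: red_le => //.
    apply: (@leq_trans (T ^ 1 * (T ^ 4 * T ^ 4))); first by rewrite leq_mul2r expn1 pT orbT.
    by rewrite -!expnD leq_pexp2l //; lia.
  move=> H; apply: leq_trans Tle; apply: leq_trans H.
  by case: `|_|%N => // n; rewrite expnS expn1 leq_pmulr.
have lift i : exists x, [/\ mxhom r A B x, mxle (hom_grow s) x & trace_row A B x = b i].
  pose X := \sum_q (row i h) 0 q *: box_hom A B q.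
  have hX : mxhom r A B X by apply: mxhom_sum => q; apply/mxhomZ/box_hom_mxhom.
  have trX : trace_row A B X = b i.
    rewrite /b row_mul mulmx_sum_row /X trace_row_sum.
    by apply: eq_bigr => q _; rewrite rowK.
  (* The conditions for being a morphism, together with the prescribed traces. *)
  pose F (k : (('I_m * 'I_m) + ('I_m * 'I_m)) + 'I_p) (Y : 'M[int]_m) : int :=
    match k with inl k' => mxhom_eq r A B k' Y | inr q => \tr (box_hom B A q *m Y) end.
  have FE (Y : 'M_m) q : F (inr q) Y = trace_row A B Y 0 q by rewrite mxE.
  have S2 : (2 * s <= pow_grow T)%N.
    by apply: leq_trans sL (leq_trans LT (good_infl _ good_pow_grow)).
  have [k|||k i' j'|k|X' [HX' BX' _]] := @mx_solve _ m m (pow_grow T) F X 1.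
  - case: k => [k|q]; first exact: mxhom_eq_linear.
    by move=> c Y Z; rewrite /F mulmxDr mxtraceD -scalemxAr mxtraceZ.
  - by lia.
  - by lia.
  - case: k => [k|q] /=.
      by apply: leq_trans S2; apply: mxhom_eq_delta => //; lia.
    rewrite mxtrace_mul_delta; apply: leq_trans (box_hom_le _ _ _ _ _) _.
    exact: leq_trans LT (good_infl _ good_pow_grow).
  - case: k => [k|q]; first by rewrite /F; move/mxhom_eqP: hX => ->.
    by rewrite FE trX; apply: entry_b.
  exists X'; split=> //.
    apply/mxhom_eqP => k; have := HX' (inl k); rewrite /F => ->.
    by move/mxhom_eqP: hX => ->.
  by rewrite -trX; apply/rowP => q; have := HX' (inr q); rewrite !FE.
have [xx xxP] : exists xx : 'I_p -> 'M[int]_m, forall i,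
    [/\ mxhom r A B (xx i), mxle (hom_grow s) (xx i) & trace_row A B (xx i) = b i].
  have [f fP] := fin_all_exists lift.
  by exists f.
pose d := #|nz|.
pose x (k : 'I_d) := xx (enum_val k).
have trsum (c : 'rV_d) : trace_row A B (\sum_k c 0 k *: x k) =
    \sum_k c 0 k *: b (enum_val k).
  rewrite trace_row_sum; apply: eq_bigr => k _.
  by rewrite /x; case: (xxP (enum_val k)) => _ _ ->.
have hsum (c : 'rV_d) : mxhom r A B (\sum_k c 0 k *: x k).
  by apply: mxhom_sum => k; apply: mxhomZ; case: (xxP (enum_val k)).
have coord (c : 'rV_d) k : c 0 k ^+ 2 <= C * sq (\sum_k c 0 k *: b (enum_val k)).
  pose y : 'rV_p := \sum_k c 0 k *: delta_mx 0 (enum_val k).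
  have yE : y 0 (enum_val k) = c 0 k.
    rewrite /y summxE (bigD1 k) //= big1 ?addr0 => [|j jk]; rewrite !mxE eqxx ?eqxx ?mulr1 //=.
    by rewrite (inj_eq enum_val_inj) eq_sym (negPf jk) mulr0.
  have := red y; rewrite sq_mulmx_delta (bigD1 (enum_val k)) //= yE => H.
  apply: (le_trans _ H).
  apply: (@le_trans _ _ (c 0 k ^+ 2 * sq (b (enum_val k)))).
    have bk : b (enum_val k) != 0 by have := enum_valP k.
    by rewrite ler_peMr ?sqr_ge0 //; have := sq_gt0 (b (enum_val k)); rewrite bk; lia.
  by rewrite lerDl; apply: sumr_ge0 => j _; rewrite mulr_ge0 ?sqr_ge0 ?sq_ge0.
have hgT : (T <= hom_grow s)%N.
  apply: leq_trans (good_infl _ good_pow_grow) (good_infl _ good_lin_bound).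
exists d, x; split.
- by apply: leq_trans hgT; apply: leq_trans pT; rewrite -[p]card_ord max_card.
- by move=> i; rewrite /x; case: (xxP (enum_val i)).
- move=> z hz.
  have [v vE] : exists v : 'rV_p, trace_row A B z = v *m gram.
    move: z hz; apply: (mxhom_ind s1 ms mA mB).
    + by exists 0; rewrite mul0mx trace_row0.
    + by move=> y z [v vE] [w wE]; exists (v + w); rewrite trace_rowD vE wE mulmxDl.
    + move=> y hy my; have [q <-] := box_hom_surj hy my.
      by exists (delta_mx 0 q); rewrite -rowE rowK.
  exists (\row_k (v *m h') 0 (enum_val k)).
  apply/mxradP; first by apply: mxhomB.
  rewrite trace_rowD -scaleN1r trace_rowZ scaleN1r trsum vE -gramE mulmxA mulmx_sum_row.
  apply/eqP; rewrite subr_eq0; apply/eqP.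
  rewrite (bigID nz) /= [X in _ + X]big1 ?addr0 => [|i]; last first.
    by rewrite negbK => /eqP bi; rewrite -/(b i) bi scaler0.
  transitivity (\sum_(k < d) (v *m h') 0 (enum_val k) *: b (enum_val k)).
    exact: (big_enum_val (A := nz) (fun i => (v *m h') 0 i *: b i)).
  by apply: eq_bigr => k _; rewrite [X in _ = X *: _]mxE.
- move=> c /(mxradP (hsum c)) tr0; apply/rowP => k; rewrite mxE.
  have := coord c k; rewrite -trsum tr0 (_ : sq 0 = 0); last by apply/eqP; rewrite sq_eq0.
  by rewrite mulr0 => h0; apply/eqP; rewrite -sqrf_eq0 eq_le h0 sqr_ge0.
- move=> c z t ht hz mz radz o k; rewrite ord1.
  have hzs : mxhom r A B (z - \sum_i c 0 i *: x i) by case: radz.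
  move/(mxradP hzs): radz; rewrite trace_rowD -scaleN1r trace_rowZ scaleN1r trsum.
  move/eqP; rewrite subr_eq0 => /eqP trz.
  have := coord c k; rewrite -trz => H.
  have Tt : (T <= t)%N := leq_trans hgT ht.
  have H2 : (`|c ord0 k| ^ 2 <= red_const p * (p * (t ^ 4 * t ^ 4)))%N.
    rewrite -lez_nat -abszX gez0_abs ?sqr_ge0 // PoszM; apply: le_trans H _.
    rewrite ler_wpM2l // -[sq _]gez0_abs ?sq_ge0 // lez_nat; apply: sq_le.
    by apply: trace_row_le => //; apply: leq_trans Tt.
  apply: (@leq_trans (red_const p * (p * (t ^ 4 * t ^ 4)))).
    apply: leq_trans H2.
    by case: `|_|%N => // n; rewrite expnS expn1 leq_pmulr.
  apply: red_le => //.
  have t0 : (0 < t)%N by apply: leq_trans Tt; apply: leq_trans LT; lia.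
  apply: (@leq_trans (t ^ 1 * (t ^ 4 * t ^ 4))).
    by rewrite leq_mul2r expn1 (leq_trans pT Tt) orbT.
  by rewrite -!expnD leq_pexp2l //; lia.
Qed.
End HomBasis.

(** * Nilpotent and unipotent matrices; bounds for determinants *)

Lemma nilpotent_inv (S : pzRingType) (z : S) k : z ^+ k = 0 ->
  (1 + z) * (\sum_(i < k) (- z) ^+ i) = 1.
Proof.
move=> zk; have := subrX1 (- z) k.
have -> : (- z) ^+ k = 0 by rewrite exprNn zk mulr0.
rewrite sub0r -opprD [z + 1]addrC mulNr => /eqP; rewrite eqr_opp => /eqP <- //.
Qed.

Lemma expr_mulmx_swap (R : pzRingType) n q (C : 'M[R]_(n, q)) (D : 'M[R]_(q, n)) l :
  (D *m C) ^+ l.+1 = D *m (C *m D) ^+ l *m C.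
Proof.
elim: l => [|l IH]; first by rewrite expr1 expr0 mulmx1.
by rewrite exprS IH [in RHS]exprS -![_ * _]/(_ *m _) !mulmxA.
Qed.

(** A singular z factors as C D through its rank; D C has the same trace, is again nilpotent and is
    smaller. If z is both nilpotent and invertible then 1 = 0. *)
Lemma trace_of_nilpotent_rat n (z : 'M[rat]_n) k : z ^+ k = 0 -> \tr z = 0.
Proof.
elim/ltn_ind: n => n IH in z k *; move=> zk.
have [rn|nr] := ltnP (\rank z) n; last first.
  have : row_free z by rewrite /row_free eqn_leq rank_leq_row.
  move=> zf; have : z ^+ k *m z ^+ 0 = 0 by rewrite zk mul0mx.
  suff H l : z ^+ l = 0 -> (1 : 'M[rat]_n) = 0.
    move=> _; have := H k zk => /(congr1 (mulmx z)); rewrite mulmx1 mulmx0 => ->.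
    by rewrite mxtrace0.
  elim: l => [|l IHl]; first by rewrite expr0.
  rewrite exprSr => Hl; apply: IHl; apply: (row_free_inj zf); rewrite /mulmxr mul0mx.
  exact: Hl.
rewrite -(mulmx_base z) mxtrace_mulC; apply: (IH _ rn _ k.+1).
by rewrite expr_mulmx_swap mulmx_base zk mulmx0 mul0mx.
Qed.

Lemma map_mxX (R1 R2 : pzRingType) (f : {rmorphism R1 -> R2}) n (z : 'M[R1]_n) k :
  map_mx f (z ^+ k) = (map_mx f z) ^+ k.
Proof.
elim: k => [|k IH]; first by rewrite !expr0 [LHS]map_mx1.
by rewrite !exprS -IH -[_ * _]/(_ *m _) map_mxM.
Qed.

Lemma trace_of_nilpotent n (z : 'M[int]_n) k : z ^+ k = 0 -> \tr z = 0.
Proof.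
move=> zk; apply/eqP; rewrite -(intr_eq0 rat) -trace_map_mx; apply/eqP.
by apply: (@trace_of_nilpotent_rat _ _ k); rewrite -map_mxX zk map_mx0.
Qed.

(* det (1 + t z) is a unit of Z[t], hence constant. *)
Lemma det_unipotent n (u : 'M[int]_n) : unipotent u -> \det u = 1.
Proof.
case=> k uk; set z := u - 1 in uk.
pose Z : 'M[{poly int}]_n := 'X *: map_mx polyC z.
have Zk : Z ^+ k = 0.
  have -> : Z ^+ k = 'X ^+ k *: map_mx polyC (z ^+ k).
    rewrite map_mxX /Z; elim: k {uk} => [|k IH]; first by rewrite !expr0 scale1r.
    by rewrite !exprS IH -[LHS]/(_ *m _) -scalemxAl -scalemxAr scalerA.
  by rewrite uk map_mx0 scaler0.
have dU : \det (1 + Z) \is a GRing.unit.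
  have := congr1 determinant (nilpotent_inv Zk); rewrite -[_ * _]/(_ *m _) det_mulmx det1.
  by move=> H; apply/unitrP; exists (\det (\sum_(i < k) (- Z) ^+ i)); rewrite mulrC H.
have ev (t : int) : (\det (1 + Z)).[t] = \det (1 + t *: z).
  rewrite -horner_evalE -det_map_mx; congr (\det _).
  apply/matrixP => i j; rewrite !mxE /= horner_evalE !hornerE /=.
  by rewrite hornerMn hornerE.
move: dU; rewrite poly_unitE => /andP [/size_poly1P [c c0 cE] _].
have := ev 0; have := ev 1; rewrite cE !hornerC scale0r addr0 scale1r.
by rewrite [1 + z]addrC subrK => <- ->; rewrite [LHS]det1.
Qed.

Lemma det_absz_le n B (M : 'M[int]_n) : mxle B M -> (`|\det M| <= n ^ n * B ^ n)%N.
Proof.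
move=> mM; rewrite /determinant.
have : (`|(\sum_(s : 'S_n) (-1) ^+ s * \prod_i M i (s i))%R| <= #|{perm 'I_n}| * B ^ n)%N.
  apply: absz_sum_le => s; rewrite abszM.
  have -> : `|((-1 : int) ^+ s)%R|%N = 1%N by rewrite abszX exp1n.
  rewrite mul1n -[X in (_ <= B ^ X)%N]card_ord -prod_nat_const.
  elim/big_rec2: _ => // i y x _ IH; rewrite abszM; exact: leq_mul.
move/leq_trans; apply; rewrite leq_mul2r; apply/orP; right.
have -> : #|{perm 'I_n}| = n`!.
  rewrite (_ : n`! = #|[set: 'I_n]|`!); last by rewrite cardsT card_ord.
  rewrite -card_perm; apply: eq_card => s; rewrite inE [RHS]unfold_in.
  by apply/esym/subsetP => x; rewrite !inE.
elim: n {M mM} => // n IH; rewrite factS expnS leq_mul2l /=.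
by apply: leq_trans IH _; case: n => // n; rewrite leq_exp2r.
Qed.

Lemma adj_absz_le n B (M : 'M[int]_n) : (0 < B)%N -> mxle B M ->
  mxle (n ^ n * B ^ n)%N (\adj M).
Proof.
case: n M => [|n] M B0 mM i j; first by case: i.
rewrite mxE /cofactor abszM.
have -> : `|((-1 : int) ^+ (j + i))%R|%N = 1%N by rewrite abszX exp1n.
rewrite mul1n; apply: leq_trans (det_absz_le (_ : mxle B _)) _.
  by move=> x y; rewrite !mxE; apply: mM.
apply: leq_mul; last by rewrite leq_pexp2l.
apply: (@leq_trans (n.+1 ^ n)); last by rewrite leq_pexp2l.
by case: n {M mM i j} => // n; rewrite leq_exp2r.
Qed.

Definition lincomb m d (x : 'I_d -> 'M[int]_m) (c : 'rV[int]_d) : 'M[int]_m :=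
  \sum_i c 0 i *: x i.

Lemma lincombD m d (x : 'I_d -> 'M[int]_m) c c' :
  lincomb x (c + c') = lincomb x c + lincomb x c'.
Proof. by rewrite -big_split; apply: eq_bigr => i _; rewrite mxE scalerDl. Qed.

Lemma lincombZ m d (x : 'I_d -> 'M[int]_m) k c : lincomb x (k *: c) = k *: lincomb x c.
Proof. by rewrite scaler_sumr; apply: eq_bigr => i _; rewrite mxE scalerA. Qed.

Lemma lincomb0 m d (x : 'I_d -> 'M[int]_m) : lincomb x 0 = 0.
Proof. by rewrite /lincomb big1 // => i _; rewrite mxE scale0r. Qed.

Lemma lincombB m d (x : 'I_d -> 'M[int]_m) c c' :
  lincomb x (c - c') = lincomb x c - lincomb x c'.
Proof. by rewrite lincombD -scaleN1r lincombZ scaleN1r. Qed.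

Lemma lincomb_mul m d d' (x : 'I_d -> 'M[int]_m) (c : 'rV_d') (M : 'M_(d', d)) :
  lincomb x (c *m M) = \sum_i c 0 i *: lincomb x (row i M).
Proof.
rewrite mulmx_sum_row (big_morph _ (@lincombD m d x) (lincomb0 x)).
by apply: eq_bigr => i _; rewrite lincombZ.
Qed.

Lemma lincomb_le t a b m d (x : 'I_d -> 'M[int]_m) c : (d <= t)%N ->
  mxle (t ^ a) c -> (forall i, mxle (t ^ b) (x i)) -> mxle (t ^ (1 + a + b)) (lincomb x c).
Proof.
move=> dt mc mx i j; rewrite summxE.
apply: leq_trans (_ : d * (t ^ a * t ^ b) <= _)%N.
  by apply: absz_sum_ord_le => k; rewrite mxE abszM leq_mul //; apply: mx.
by rewrite -addnA expnD expn1 expnD leq_mul2r dt orbT.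
Qed.

(** * The order End(A) modulo its radical and its Casimir tensor *)

Section Order.
Variables (m : nat) (r : rel 'I_m).
Hypotheses (r_refl : reflexive r) (r_trans : transitive r).

Definition eqm (A B x y : 'M[int]_m) : Prop := mxrad r A B (x - y).

Lemma eqm_refl A B x : eqm A B x x.
Proof. by rewrite /eqm subrr; apply: mxrad0. Qed.

Lemma eqm_sym A B x y : eqm A B x y -> eqm A B y x.
Proof. by move=> h; rewrite /eqm -opprB; apply: mxradN. Qed.

Lemma eqm_trans A B x y z : eqm A B x y -> eqm A B y z -> eqm A B x z.
Proof. by move=> h h'; rewrite /eqm -(subrK y x) -addrA; apply: mxradD. Qed.

Lemma eqm_compl A B C x y z : mxhom r B C z -> eqm A B x y -> eqm A C (z *m x) (z *m y).
Proof. by move=> hz h; rewrite /eqm -mulmxBr; apply: mxrad_compl h hz. Qed.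

Lemma eqm_compr A B C x y w : mxhom r C A w -> eqm A B x y -> eqm C B (x *m w) (y *m w).
Proof. by move=> hw h; rewrite /eqm -mulmxBl; apply: mxrad_compr h hw. Qed.

Lemma eqm_sum A B n (c : 'rV[int]_n) (x y : 'I_n -> 'M[int]_m) :
  (forall i, eqm A B (x i) (y i)) ->
  eqm A B (\sum_i c 0 i *: x i) (\sum_i c 0 i *: y i).
Proof.
move=> h; rewrite /eqm -sumrB; apply: mxrad_sum => i.
by rewrite -scalerBr; apply: mxradZ; exact: h.
Qed.

Definition is_basis A B d (x : 'I_d -> 'M[int]_m) : Prop :=
  [/\ forall i, mxhom r A B (x i),
    forall z, mxhom r A B z -> exists c, eqm A B z (lincomb x c) &
    forall c, mxrad r A B (lincomb x c) -> c = 0].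

Lemma is_basis_inj A B d (x : 'I_d -> 'M[int]_m) c c' :
  is_basis A B x -> eqm A B (lincomb x c) (lincomb x c') -> c = c'.
Proof.
case=> _ _ inj h; apply/eqP; rewrite -subr_eq0; apply/eqP/inj.
by rewrite lincombB.
Qed.

Lemma lincomb_mxhom A B d (x : 'I_d -> 'M[int]_m) c :
  is_basis A B x -> mxhom r A B (lincomb x c).
Proof. by case=> hx _ _; apply: mxhom_sum => i; apply: mxhomZ. Qed.

Definition acts_by A B d d' (e : 'I_d -> 'M[int]_m) (x : 'I_d' -> 'M[int]_m)
    (R : 'I_d -> 'M[int]_d') : Prop :=
  forall i j, eqm A B (x i *m e j) (lincomb x (row i (R j))).

Lemma acts_by_row A B d d' (e : 'I_d -> 'M[int]_m) (x : 'I_d' -> 'M[int]_m) R c j :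
  acts_by A B e x R -> eqm A B (lincomb x c *m e j) (lincomb x (c *m R j)).
Proof.
move=> act; rewrite lincomb_mul /lincomb mulmx_suml.
by under eq_bigr => i _ do rewrite -scalemxAl; apply: eqm_sum => i; apply: act.
Qed.

Lemma acts_by_lincomb A B d d' (e : 'I_d -> 'M[int]_m) (x : 'I_d' -> 'M[int]_m) R c w :
  acts_by A B e x R ->
  eqm A B (lincomb x c *m lincomb e w) (lincomb x (c *m \sum_j w 0 j *: R j)).
Proof.
move=> act; rewrite [lincomb e w]/lincomb !mulmx_sumr.
under eq_bigr => j _ do rewrite -scalemxAr.
rewrite (big_morph _ (@lincombD m d' x) (lincomb0 x)).
under [X in eqm _ _ _ X]eq_bigr => j _ do rewrite -scalemxAr lincombZ.
by apply: eqm_sum => j; apply: acts_by_row.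
Qed.

(** Associativity and the unit law, read in coordinates modulo the radical. *)
Lemma acts_by_rep A B d d' (e : 'I_d -> 'M[int]_m) (x : 'I_d' -> 'M[int]_m) a R eps :
  is_basis A A e -> is_basis A B x -> acts_by A A e e a -> acts_by A B e x R ->
  eqm A A 1%:M (lincomb e eps) -> is_rep a eps R.
Proof.
move=> be bx acta actR eps1; split=> [i j|].
  apply/row_matrixP => p; rewrite !rowE; set c := delta_mx 0 p.
  apply: (is_basis_inj bx); rewrite mulmxA.
  have [he _ _] := be.
  apply: (eqm_trans (eqm_sym (acts_by_row (c *m R i) j actR))).
  apply: (eqm_trans (eqm_compr (he j) (eqm_sym (acts_by_row c i actR)))).
  rewrite -mulmxA.
  apply: (eqm_trans (eqm_compl (lincomb_mxhom c bx) (acta i j))).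
  apply: eqm_trans (acts_by_lincomb _ _ actR) _.
  under eq_bigr => k _ do rewrite mxE.
  exact: eqm_refl.
apply/row_matrixP => p; rewrite !rowE mulmx1; set c := delta_mx 0 p.
apply: (is_basis_inj bx).
apply: (eqm_trans (eqm_sym (acts_by_lincomb c eps actR))).
apply: (eqm_trans (eqm_compl (lincomb_mxhom c bx) (eqm_sym eps1))).
rewrite mulmx1; exact: eqm_refl.
Qed.

Section TraceForm.
Variables (A : 'M[int]_m) (d : nat) (e : 'I_d -> 'M[int]_m).
Variables (a : 'I_d -> 'M[int]_d) (eps : 'rV[int]_d).
Hypotheses (be : is_basis A A e) (acta : acts_by A A e e a).
Hypothesis (eps1 : eqm A A 1%:M (lincomb e eps)).

Let rep : is_rep a eps a := acts_by_rep be be acta acta eps1.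

Definition right_mx (w : 'rV[int]_d) : 'M[int]_d := \sum_j w 0 j *: a j.

Lemma right_mxM v w : right_mx v *m right_mx w = right_mx (v *m right_mx w).
Proof.
rewrite {1 3}/right_mx mulmx_suml.
under eq_bigr => i _ do rewrite /right_mx mulmx_sumr.
transitivity (\sum_i \sum_j \sum_k (v 0 i * (w 0 j * a j i k)) *: a k).
  apply: eq_bigr => i _; apply: eq_bigr => j _.
  rewrite -scalemxAl -scalemxAr rep.1 !scaler_sumr.
  by apply: eq_bigr => k _; rewrite !scalerA mulrA.
under eq_bigr => i _ do rewrite exchange_big /=.
rewrite exchange_big /=; apply: eq_bigr => k _.
rewrite mxE scaler_suml; apply: eq_bigr => i _.
rewrite summxE mulr_sumr scaler_suml; apply: eq_bigr => j _.
by rewrite mxE.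
Qed.

Lemma right_mx_delta j : right_mx (delta_mx 0 j) = a j.
Proof.
rewrite /right_mx (bigD1 j) //= big1 ?addr0 => [|i ij]; rewrite mxE eqxx ?eqxx ?scale1r //=.
by rewrite (negPf ij) scale0r.
Qed.

(** The trace is that of the regular representation, whereas the radical was defined by traces of
    the m by m matrices themselves. *)
Definition trace_gram : 'M[int]_d := \matrix_(i, j) \tr (a i *m a j).

Lemma mul_trace_gram v j : (v *m trace_gram) 0 j = \tr (right_mx v *m a j).
Proof.
rewrite mxE /right_mx mulmx_suml linear_sum; apply: eq_bigr => i _.
by rewrite !mxE -scalemxAl linearZ.
Qed.

Lemma trace_gram_kernel v w : v *m trace_gram = 0 -> \tr (right_mx v *m right_mx w) = 0.
Proof.
move=> v0; rewrite /right_mx mulmx_sumr linear_sum big1 // => j _.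
rewrite -scalemxAr linearZ /= -/(right_mx v) -mul_trace_gram v0 mxE.
exact: mulr0.
Qed.

Lemma trace_gram_nilpotent v V : v *m trace_gram = 0 -> mxhom r A A V ->
  eqm A A V (lincomb e v) -> exists k, V ^+ k = 0.
Proof.
move=> v0 hV VE.
have [k Hk] : exists k, right_mx v ^+ k = 0.
  apply: trace_nilpotent => k; rewrite exprS -[_ * _]/(_ *m _).
  have [w ->] : exists w, right_mx v ^+ k = right_mx w.
    elim: k => [|k [w IH]]; first by exists eps; rewrite expr0; apply: esym rep.2.
    by exists (w *m right_mx v); rewrite exprSr IH -right_mxM.
  exact: trace_gram_kernel.
have VX l : eqm A A (V ^+ l) (lincomb e (eps *m right_mx v ^+ l)).
  elim: l => [|l IH]; first by rewrite !expr0 mulmx1.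
  rewrite !exprSr -![_ * _]/(_ *m _) mulmxA.
  apply: eqm_trans (eqm_compr hV IH) _.
  apply: eqm_trans (eqm_compl (lincomb_mxhom _ be) VE) _.
  exact: acts_by_lincomb.
have := VX k; rewrite Hk mulmx0 lincomb0 /eqm subr0 => /(mxrad_nilpotent r_refl r_trans).
by case=> l Hl; exists (k * l)%N; rewrite exprM.
Qed.

(** The kernel is stable under multiplication by every y in End(A), and its elements are nilpotent.
    So v y has trace 0 as an m by m matrix, which puts v in the radical. *)
Lemma trace_gram_inj (v : 'rV_d) : v *m trace_gram = 0 -> v = 0.
Proof.
move=> v0; have [_ _ inj] := be; apply: inj; split; first exact: lincomb_mxhom.
have [_ gen _] := be => y hy; have [w yw] := gen y hy.
rewrite mxtrace_mulC.
suff [k] : exists k, (lincomb e v *m y) ^+ k = 0 by apply: trace_of_nilpotent.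
apply: (@trace_gram_nilpotent (v *m right_mx w)).
- apply/rowP => j; rewrite mul_trace_gram -right_mxM -mulmxA -(right_mx_delta j) right_mxM mxE.
  exact: trace_gram_kernel.
- exact: mxhom_comp hy (lincomb_mxhom _ be).
- apply: eqm_trans (eqm_compl (lincomb_mxhom _ be) yw) _.
  exact: acts_by_lincomb.
Qed.

(** The tensor pairing a basis with its dual basis for the trace form, cleared of denominators by
    the determinant. Invariance of the form makes it central; nondegeneracy identifies its product
    with del times 1, as both have the same traces against every basis element. *)
Lemma trace_form_casimir : casimir a eps (\adj trace_gram) (\det trace_gram).
Proof.
set G := trace_gram; set c := \adj G; set del := \det G.
have del0 : del != 0.
  by apply/negP => /det0P [v v0 /trace_gram_inj vE]; rewrite vE eqxx in v0.
have cG : c *m G = del%:M by apply: mul_adj_mx.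
have Gc : G *m c = del%:M by apply: mul_mx_adj.
split=> //.
- move=> k l j.
  pose Lk : 'M[int]_d := \matrix_(i, l) a i k l.
  suff H : Lk^T *m c = c *m a k.
    have := congr1 (fun M : 'M_d => M l j) H; rewrite !mxE => <-.
    by apply: eq_bigr => i _; rewrite !mxE.
  have aG : a k *m G = G *m Lk^T.
    apply/matrixP => i q; rewrite !mxE.
    transitivity (\tr (a i *m a k *m a q)).
      by rewrite rep.1 mulmx_suml linear_sum; apply: eq_bigr => l' _; rewrite mxE -scalemxAl linearZ.
    rewrite -mulmxA rep.1 mulmx_sumr linear_sum; apply: eq_bigr => l' _.
    by rewrite !mxE -scalemxAr linearZ mulrC.
  apply: (zscalemx_inj del0).
  rewrite -mul_scalar_mx -cG -mulmxA (mulmxA G) -aG.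
  by rewrite -(mulmxA (a k)) Gc mulmxA mul_mx_scalar.
- pose z : 'rV[int]_d := \row_l \sum_i \sum_j c i j * a j i l.
  suff H : z - del *: eps = 0.
    by move=> l; have := congr1 (fun v : 'rV_d => v 0 l) H; rewrite !mxE => /eqP;
      rewrite subr_eq0 => /eqP.
  apply: trace_gram_inj; rewrite mulmxBl; apply/eqP; rewrite subr_eq0; apply/eqP/rowP => q.
  rewrite -scalemxAl [RHS]mxE !mul_trace_gram.
  have -> : right_mx eps = 1%:M := rep.2.
  rewrite mul1mx -mxtraceZ -mul_mx_scalar -Gc mulmxA [RHS]mxtrace_mulC.
  have -> : right_mx z = \sum_i \sum_j c i j *: (a i *m a j).
    rewrite /right_mx; under eq_bigr => l _ do rewrite mxE scaler_suml.
    rewrite exchange_big /=; apply: eq_bigr => i _.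
    under eq_bigr => l _ do rewrite scaler_suml.
    rewrite exchange_big /=; apply: eq_bigr => j _.
    by rewrite rep.1 scaler_sumr; apply: eq_bigr => l _; rewrite scalerA.
  rewrite mulmx_suml linear_sum; apply: eq_bigr => i _ /=.
  rewrite mulmx_suml linear_sum mxE; apply: eq_bigr => j _ /=.
  rewrite -scalemxAl mxtraceZ; congr (_ * _).
  rewrite -mulmxA mxtrace_mulC rep.1 mulmx_suml linear_sum mxE; apply: eq_bigr => l _.
  by rewrite /= !mxE -scalemxAl mxtraceZ.
Qed.
End TraceForm.
End Order.

(** * Block determinants as sign characters *)

Section Order.
Variables (m : nat) (r : rel 'I_m).
Hypotheses (r_refl : reflexive r) (r_trans : transitive r).

Definition patterned (x : 'M[int]_m) : Prop := forall i j, ~~ r i j -> x i j = 0.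

Definition is_det (f : 'M[int]_m -> int) : Prop :=
  (forall x y, patterned x -> patterned y -> f (x *m y) = f x * f y) /\
  (forall x, patterned x -> unipotent x -> f x = 1).

Lemma mxhom_patterned A B x : mxhom r A B x -> patterned x.
Proof. by case. Qed.

(** As y inverts x and x' modulo the radical, x y and x' y are unipotent, so f x and f x' are both
    inverse to f y. *)
Lemma is_det_eqm f A x x' y : is_det f -> mxhom r A A x -> mxhom r A A x' ->
  mxhom r A A y -> eqm r A A x x' -> eqm r A A (x *m y) 1%:M -> f x = f x'.
Proof.
case=> fM f1 hx hx' hy xx' xy.
have inv z : mxhom r A A z -> eqm r A A (z *m y) 1%:M -> f z * f y = 1.
  move=> hz zy; rewrite -fM; [|exact: mxhom_patterned hz|exact: mxhom_patterned hy].
  rewrite f1 //; first by apply: mxhom_patterned (mxhom_comp r_trans hy hz).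
  have [k Hk] := mxrad_nilpotent r_refl r_trans zy.
  by exists k.
have e1 := inv x hx xy.
have e2 := inv x' hx' (eqm_trans (eqm_compr r_trans hy (eqm_sym xx')) xy).
have y0 : f y != 0 by apply/eqP => y0; move: e1; rewrite y0 mulr0.
by apply: (mulIf y0); rewrite e1 e2.
Qed.

Section Units.
Variables (A : 'M[int]_m) (d : nat) (e : 'I_d -> 'M[int]_m).
Variables (a : 'I_d -> 'M[int]_d) (eps : 'rV[int]_d).
Hypotheses (be : is_basis r A A e) (acta : acts_by r A A e e a).
Hypothesis (eps1 : eqm r A A 1%:M (lincomb e eps)).

Let rep : is_rep a eps a := acts_by_rep r_trans be be acta acta eps1.

(* An automorphism of the right regular module is left multiplication by its  *)
(* value at 1.                                                                *)
Definition unit_of (u : 'M[int]_d) : 'M[int]_m := lincomb e (eps *m u).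

Lemma unit_of_mxhom u : mxhom r A A (unit_of u).
Proof. exact: lincomb_mxhom. Qed.

Lemma unit_ofE u c : (forall k, u *m a k = a k *m u) ->
  eqm r A A (unit_of u *m lincomb e c) (lincomb e (c *m u)).
Proof.
move=> ua; apply: (eqm_trans (acts_by_lincomb _ _ acta)).
rewrite -/(right_mx a c) -mulmxA.
have -> : u *m right_mx a c = right_mx a c *m u.
  rewrite /right_mx mulmx_sumr mulmx_suml; apply: eq_bigr => k _.
  by rewrite -scalemxAr -scalemxAl ua.
rewrite mulmxA; suff -> : eps *m right_mx a c = c by exact: eqm_refl.
apply: (is_basis_inj be); apply: (eqm_trans (eqm_sym (acts_by_lincomb _ _ acta))).
apply: (eqm_trans (eqm_compr r_trans (lincomb_mxhom c be) (eqm_sym eps1))).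
by rewrite mul1mx; apply: eqm_refl.
Qed.

Lemma unit_ofM u v : (forall k, v *m a k = a k *m v) ->
  eqm r A A (unit_of (u *m v)) (unit_of v *m unit_of u).
Proof.
by move=> va; apply: eqm_sym; rewrite [unit_of (u *m v)]/unit_of mulmxA; apply: unit_ofE.
Qed.

Lemma unit_of1 : eqm r A A (unit_of 1%:M) 1%:M.
Proof. by rewrite /unit_of mulmx1; apply: eqm_sym. Qed.

(** Modulo the radical, which f ignores on units, [unit_of] reverses products, and integers commute.
    If u - 1 is nilpotent then so is [unit_of (u - 1)], and f is 1 on 1 plus a nilpotent. *)
Lemma unit_of_is_sign_char f : is_det f -> is_sign_char a (fun u => f (unit_of u)).
Proof.
move=> fdet; have [fM f1] := fdet; split=> [u v au av|u au [k uk]].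
  have [u' uu'] := au.2; have au' := rep_autV au uu'.
  have [v' vv'] := av.2; have av' := rep_autV av vv'.
  have E := unit_ofM u av.1.
  rewrite (is_det_eqm fdet (unit_of_mxhom _) (mxhom_comp r_trans (unit_of_mxhom _)
    (unit_of_mxhom _)) (unit_of_mxhom (v' *m u')) E).
    rewrite fM ?[_ * f (unit_of u)]mulrC //; exact: mxhom_patterned (unit_of_mxhom _).
  apply: (eqm_trans (eqm_sym (unit_ofM _ (rep_autM au av).1))).
  have -> : v' *m u' *m (u *m v) = 1%:M.
    apply: mulmx1C.
    by rewrite mulmxA -(mulmxA u) vv' mulmx1.
  exact: unit_of1.
pose z := u - 1; have za j : z *m a j = a j *m z.
  by rewrite mulmxBl mulmxBr au.1 -[1]/(1%:M) mul1mx mulmx1.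
have uE : eqm r A A (1%:M + unit_of z) (unit_of u).
  suff -> : unit_of z = unit_of u - lincomb e eps.
    by rewrite /eqm addrA addrAC addrK; exact: eps1.
  by rewrite /unit_of /z -[1]/(1%:M) mulmxBr mulmx1 lincombB.
have zX l : eqm r A A (unit_of z ^+ l) (unit_of (z ^+ l)).
  elim: l => [|l IH]; first by rewrite !expr0; apply: eqm_sym unit_of1.
  rewrite exprS -[_ * _]/(_ *m _).
  apply: eqm_trans (eqm_compl r_trans (unit_of_mxhom z) IH) _.
  by rewrite exprSr; apply: eqm_sym; apply: unit_ofM.
have [l Hl] : exists l, unit_of z ^+ l = 0.
  have := zX k; rewrite uk /unit_of mulmx0 lincomb0 /eqm subr0.
  by move=> /(mxrad_nilpotent r_refl r_trans) [l Hl]; exists (k * l)%N; rewrite exprM.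
have h1z : mxhom r A A (1%:M + unit_of z).
  by apply: mxhomD; [exact: mxhom1|exact: unit_of_mxhom].
rewrite -(is_det_eqm fdet h1z (unit_of_mxhom u) _ uE
  (y := \sum_(i < l) (- unit_of z) ^+ i)).
- apply: f1; first exact: mxhom_patterned h1z.
  by exists l; rewrite -[1%:M]/1 addrC addKr.
- by apply: mxhom_sum => i; apply: mxhomX => //; apply/mxhomN/unit_of_mxhom.
- by rewrite -[_ *m _]/(_ * _) nilpotent_inv //; apply: eqm_refl.
Qed.
End Units.
End Order.

(** * Bounded equivalences *)

Definition struct_grow (s : nat) : nat := pow_grow (pow_grow (pow_grow (hom_grow s))).

Definition equiv_grow (s : nat) : nat := lin_bound (pow_grow (iso_grow (struct_grow s))).

Lemma good_equiv_grow : good equiv_grow.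
Proof.
apply: (good_comp good_lin_bound); apply: (good_comp good_pow_grow).
apply: (good_comp good_iso_grow).
by do 3!apply: (good_comp good_pow_grow); exact: good_hom_grow.
Qed.

(** Modulo radicals, left multiplication by X is an isomorphism g from End(A) to Hom(A, B) of right
    modules over the order. The bounded isomorphism h provided by [bounded_isomorphism] is
    determined by its value at 1, which lifts to X', congruent to X W0 with W0 the unit attached to
    h g^-1, on which every f k is 1. Congruence is enough: W = Y X' is invertible because the
    radical is nilpotent, X' = X W holds exactly, and f k W = f k W0 = 1. *)
Theorem bounded_equivalence m (r : rel 'I_m) s (A B X Y : 'M[int]_m) (K : finType)
    (f : K -> 'M[int]_m -> int) :
  reflexive r -> transitive r -> (1 < s)%N -> (m * m <= s)%N -> (#|K| <= s)%N ->
  mxle s A -> mxle s B -> (forall k, is_det r (f k)) ->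
  mxhom r A B X -> mxhom r B A Y -> Y *m X = 1%:M ->
  exists X' Y', [/\ mxhom r A B X', mxhom r B A Y', Y' *m X' = 1%:M,
    mxle (equiv_grow s) X' /\ mxle (equiv_grow s) Y' & forall k, f k X' = f k X].
Proof.
move=> r_refl r_trans s1 ms Ks mA mB fdet hX hY YX.
have XY : X *m Y = 1%:M by apply: mulmx1C.
have [d [e [de He gene inje coore]]] := hom_basis r s1 ms mA mA.
have [d' [x [dx Hx genx injx coorx]]] := hom_basis r s1 ms mA mB.
have be : is_basis r A A e by split=> // i; case: (He i).
have bx : is_basis r A B x by split=> // i; case: (Hx i).
set H := hom_grow s in de He coore dx Hx coorx.
pose H1 := pow_grow H; pose H2 := pow_grow H1.
have sH : (s <= H)%N := good_infl _ good_hom_grow.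
have HH1 : (H <= H1)%N := good_infl _ good_pow_grow.
have HH2 : (H1 <= H2)%N := good_infl _ good_pow_grow.
have mH : (m <= H)%N.
  by apply: leq_trans sH; apply: leq_trans ms; case: (m) => // n; rewrite leq_pmulr.
have H1' : (1 < H)%N := leq_trans s1 sH.
have prodle (u v : 'M[int]_m) : mxle H u -> mxle H v -> mxle H1 (u *m v).
  move=> mu mv; apply: (@mxle_mono (H ^ (1 + 1 + 1))).
    by apply: mxle_mul => //; rewrite expn1.
  by apply: expn_le_pow_grow; lia.
have [a Ha] : exists a : 'I_d -> 'I_d -> 'rV[int]_d, forall j i,
    mxrad r A A (e i *m e j - \sum_k a j i 0 k *: e k).
  have h j i : exists c : 'rV[int]_d, mxrad r A A (e i *m e j - \sum_k c 0 k *: e k).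
    by apply: gene; exact: (mxhom_comp r_trans (proj1 (He j)) (proj1 (He i))).
  have [a0 Ha0] := fin_all_exists (fun j => fin_all_exists (h j)).
  by exists a0.
pose a' j := \matrix_i a j i.
have acta : acts_by r A A e e a'.
  by move=> i j; rewrite rowK; apply: Ha.
have ma j : mxle H2 (a' j).
  move=> i k; rewrite mxE; apply: (coore (a j i) (e i *m e j) H1) => //.
  - by exact: (mxhom_comp r_trans (proj1 (He j)) (proj1 (He i))).
  - by apply: prodle; [case: (He i)|case: (He j)].
have [eps eps1] := gene _ (mxhom1 r_refl A).
have meps : mxle H2 eps.
  apply: (coore eps 1%:M H1) => //; first exact: mxhom1.
  by move=> i j; rewrite mxE; case: eqP => //= _; lia.
have [b Hb] : exists b : 'I_d -> 'I_d' -> 'rV[int]_d', forall j i,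
    mxrad r A B (x i *m e j - \sum_k b j i 0 k *: x k).
  have h j i : exists c : 'rV[int]_d', mxrad r A B (x i *m e j - \sum_k c 0 k *: x k).
    by apply: genx; exact: (mxhom_comp r_trans (proj1 (He j)) (proj1 (Hx i))).
  have [b0 Hb0] := fin_all_exists (fun j => fin_all_exists (h j)).
  by exists b0.
pose R j := \matrix_i b j i.
have actR : acts_by r A B e x R by move=> i j; rewrite rowK; apply: Hb.
have mR j : mxle H2 (R j).
  move=> i k; rewrite mxE; apply: (coorx (b j i) (x i *m e j) H1) => //.
  - by exact: (mxhom_comp r_trans (proj1 (He j)) (proj1 (Hx i))).
  - by apply: prodle; [case: (Hx i)|case: (He j)].
have repa : is_rep a' eps a' := acts_by_rep r_trans be be acta acta eps1.
have cas := trace_form_casimir r_refl r_trans be acta eps1.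
have [g Hg] : exists g : 'M[int]_(d, d'), forall i, eqm r A B (X *m e i) (lincomb x (row i g)).
  have h i : exists c : 'rV[int]_d', eqm r A B (X *m e i) (lincomb x c).
    by apply: genx; exact: (mxhom_comp r_trans (proj1 (He i)) hX).
  have [g0 Hg0] := fin_all_exists h.
  by exists (\matrix_i g0 i) => i; rewrite rowK.
have [g' Hg'] : exists g' : 'M[int]_(d', d), forall i, eqm r A A (Y *m x i) (lincomb e (row i g')).
  have h i : exists c : 'rV[int]_d, eqm r A A (Y *m x i) (lincomb e c).
    by apply: gene; exact: (mxhom_comp r_trans (proj1 (Hx i)) hY).
  have [g0 Hg0] := fin_all_exists h.
  by exists (\matrix_i g0 i) => i; rewrite rowK.
have Xlc c : eqm r A B (X *m lincomb e c) (lincomb x (c *m g)).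
  rewrite lincomb_mul /lincomb mulmx_sumr.
  by under eq_bigr => i _ do rewrite -scalemxAr; apply: eqm_sum => i; apply: Hg.
have Ylc c : eqm r A A (Y *m lincomb x c) (lincomb e (c *m g')).
  rewrite lincomb_mul /lincomb mulmx_sumr.
  by under eq_bigr => i _ do rewrite -scalemxAr; apply: eqm_sum => i; apply: Hg'.
have gg' : g *m g' = 1%:M.
  apply/row_matrixP => i; rewrite !rowE mulmx1; set c := delta_mx 0 i.
  apply: (is_basis_inj be); rewrite mulmxA.
  apply: (eqm_trans (eqm_sym (Ylc (c *m g)))).
  apply: (eqm_trans (eqm_compl r_trans hY (eqm_sym (Xlc c)))).
  by rewrite mulmxA YX mul1mx; apply: eqm_refl.
have g'g : g' *m g = 1%:M.
  apply/row_matrixP => i; rewrite !rowE mulmx1; set c := delta_mx 0 i.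
  apply: (is_basis_inj bx); rewrite mulmxA.
  apply: (eqm_trans (eqm_sym (Xlc (c *m g')))).
  apply: (eqm_trans (eqm_compl r_trans hX (eqm_sym (Ylc c)))).
  by rewrite mulmxA XY mul1mx; apply: eqm_refl.
have dd' : d' = d by apply/eqP; rewrite eqn_leq (mulmx1_min gg') (mulmx1_min g'g).
subst d'.
have gR k : a' k *m g = g *m R k.
  apply/row_matrixP => i; rewrite !rowE; set c := delta_mx 0 i.
  apply: (is_basis_inj bx); rewrite !mulmxA.
  apply: (eqm_trans (eqm_sym (Xlc (c *m a' k)))).
  apply: (eqm_trans (eqm_compl r_trans hX (eqm_sym (acts_by_row c k acta)))).
  rewrite mulmxA; apply: (eqm_trans (eqm_compr r_trans (proj1 (He k)) (Xlc c))).
  exact: acts_by_row.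
pose S := struct_grow s.
have SE : S = pow_grow H2 by [].
have H2S : (H2 <= S)%N := good_infl _ good_pow_grow.
have HS : (H <= S)%N := leq_trans HH1 (leq_trans HH2 H2S).
have H21 : (1 < H2)%N by apply: leq_trans H1' (leq_trans HH1 HH2).
have dH2 : (d <= H2)%N := leq_trans de (leq_trans HH1 HH2).
have mG : mxle (H2 ^ 4) (trace_gram a').
  move=> i j; rewrite mxE; apply: leq_trans (mxtrace_mul_le (ma i) (ma j)) _.
  by rewrite !expnS expn0 muln1 !leq_mul.
have adjS : (d ^ d * (H2 ^ 4) ^ d <= S)%N.
  apply: (@leq_trans (H2 ^ d * (H2 ^ 4) ^ d)).
    by rewrite leq_mul2r; apply/orP; right; case: (d) dH2 => // n; rewrite leq_exp2r.
  by rewrite -expnM -expnD SE; apply: expn_le_pow_grow; lia.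
have G0 : (0 < H2 ^ 4)%N by rewrite expn_gt0 ltnW.
have [h [h' [hh' hR mh chih]]] := bounded_isomorphism
  (leq_trans H1' HS) (leq_trans de HS) (leq_trans de HS) cas
  (mxle_mono (adj_absz_le G0 mG) adjS) (leq_trans (det_absz_le mG) adjS) repa
  (fun k => mxle_mono (ma k) H2S) (fun k => mxle_mono (mR k) H2S) gg' gR
  (leq_trans Ks (leq_trans sH HS))
  (fun k => unit_of_is_sign_char r_refl r_trans be acta eps1 (fdet k)).
have h'h : h' *m h = 1%:M by apply: mulmx1C.
pose u := g *m h'; pose u' := h *m g'.
have uu' : u *m u' = 1%:M by rewrite /u /u' mulmxA -(mulmxA g) h'h mulmx1.
have h'R k : h' *m a' k = R k *m h'.
  by rewrite -[LHS]mulmx1 -hh' mulmxA -(mulmxA h') hR mulmxA h'h mul1mx.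
have au : rep_aut a' u.
  split=> [k|]; last by exists u'.
  by rewrite /u -mulmxA h'R !mulmxA gR.
have au' := rep_autV au uu'.
pose W0 := unit_of e eps u'.
have hW0 : mxhom r A A W0 := unit_of_mxhom eps be u'.
have fW0 k : f k W0 = 1.
  have := sign_charV (unit_of_is_sign_char r_refl r_trans be acta eps1 (fdet k)) au uu'.
  by rewrite chih mul1r.
pose X' := lincomb x (eps *m h).
have hX' : mxhom r A B X' by apply: lincomb_mxhom.
have X'E : eqm r A B X' (X *m W0).
  apply: eqm_sym; apply: eqm_trans (Xlc _) _.
  by rewrite /X' /u' mulmxA -(mulmxA _ g') g'g mulmx1; apply: eqm_refl.
pose W := Y *m X'.
have hW : mxhom r A A W := mxhom_comp r_trans hX' hY.
have X'W : X' = X *m W by rewrite /W mulmxA XY mul1mx.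
have WE : eqm r A A W0 W.
  apply: eqm_sym; apply: (eqm_trans (eqm_compl r_trans hY X'E)).
  by rewrite mulmxA YX mul1mx; apply: eqm_refl.
pose V := unit_of e eps u.
have hV : mxhom r A A V := unit_of_mxhom eps be u.
have W0V : eqm r A A (W0 *m V) 1%:M.
  apply: (eqm_trans (eqm_sym (unit_ofM r_trans be acta eps1 u au'.1))).
  by rewrite uu'; apply: unit_of1.
have fW k : f k W = 1.
  by rewrite -(is_det_eqm r_refl r_trans (fdet k) hW0 hW hV WE W0V).
have WV : eqm r A A (W *m V) 1%:M.
  exact: (eqm_trans (eqm_compr r_trans hV (eqm_sym WE)) W0V).
have [k Hk] := mxrad_nilpotent r_refl r_trans WV.
have hN : mxhom r A A (W *m V - 1%:M) by case: WV.
(* The inverse of W: the product W V is 1 plus a nilpotent, inverted by a geometric series. *)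
pose Z := V *m \sum_(i < k) (- (W *m V - 1)) ^+ i.
have WZ : W *m Z = 1%:M.
  rewrite /Z mulmxA -[RHS](nilpotent_inv Hk) -[1%:M]/(1 : 'M[int]_m).
  by rewrite [X in X * _]addrC subrK.
have hZ : mxhom r A A Z.
  apply: (mxhom_comp r_trans) hV; apply: mxhom_sum => i; apply: mxhomX => //.
  exact: mxhomN.
have ZW : Z *m W = 1%:M by apply: mulmx1C.
have Y'X' : Z *m Y *m X' = 1%:M by rewrite -mulmxA.
pose I := iso_grow S.
have SI : (S <= I)%N := good_infl _ good_iso_grow.
have I1 : (1 < I)%N by apply: leq_trans SI; apply: leq_trans H1' HS.
have mX' : mxle (I ^ 5) X'.
  apply: (@lincomb_le I 3 1) => //.
  - exact: leq_trans de (leq_trans HS SI).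
  - apply: (@mxle_mul I 1 1); rewrite ?expn1 //; first exact: leq_trans de (leq_trans HS SI).
    by apply: (mxle_mono meps); apply: leq_trans H2S SI.
  - by move=> i; rewrite expn1; apply: (mxle_mono (proj2 (Hx i))); apply: leq_trans HS SI.
have I5 : (I ^ 5 <= pow_grow I)%N by apply: expn_le_pow_grow; lia.
exists X', (Z *m Y); split=> //.
- exact: mxhom_comp hY hZ.
- split.
    by apply: (mxle_mono mX'); apply: leq_trans I5 (good_infl _ good_lin_bound).
  case: (posnP m) => [m0|m0]; first by move=> i; exfalso; have := ltn_ord i; lia.
  apply: (inverse_bound (M := X')); last exact: mulmx1C.
    rewrite muln_gt0 m0 /=; apply: leq_trans (good_infl _ good_pow_grow).
    exact: leq_trans ms (leq_trans sH (leq_trans HS SI)).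
  exact: (mxle_mono mX').
- move=> k'; have [fM _] := fdet k'.
  rewrite X'W fM ?fW ?mulr1 //; first exact: mxhom_patterned hX.
  exact: mxhom_patterned hW.
Qed.

(** * Correctness of the search *)

Definition vand_prod (n : nat) (f : nat -> int) : int := \prod_(y < n) \prod_(x < y) (f y - f x).

Lemma vand_prodE n (f : 'I_n -> int) (g : nat -> int) : (forall i : 'I_n, g i = f i) ->
  vand_prod n g = \det (Vandermonde n (\row_i f i)).
Proof.
move=> gf; rewrite det_Vandermonde (exchange_big_dep xpredT) //=; apply: eq_bigr => y _.
rewrite (big_ord_widen n (fun x => g y - g x)) ?(ltnW (ltn_ord y)) //.
by apply: eq_bigr => x _; rewrite !mxE !gf.
Qed.

Lemma vand_prod1_neq0 n : vand_prod n (fun x => x%:Z) != 0.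
Proof.
apply/prodf_neq0 => y _; apply/prodf_neq0 => x _; rewrite subr_eq0 eqz_nat.
by rewrite neq_ltn ltn_ord orbT.
Qed.

Lemma vand_prod_perm n (s : 'S_n) (g : nat -> int) :
  (forall i : 'I_n, g i = (s i : nat)%:Z) ->
  vand_prod n g = (-1) ^+ s * vand_prod n (fun x => x%:Z).
Proof.
move=> gs; rewrite (vand_prodE gs) (@vand_prodE n (fun i => (i : nat)%:Z)) //.
rewrite -det_perm -!(det_tr (Vandermonde _ _)) -det_mulmx -row_permE.
by congr (\det _); apply/matrixP => i j; rewrite !mxE.
Qed.

Lemma vand_prod_not_inj n (f : {ffun 'I_n -> 'I_n}) (g : nat -> int) :
  (forall i : 'I_n, g i = (f i : nat)%:Z) -> ~~ injectiveb f -> vand_prod n g = 0.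
Proof.
move=> gf /injectivePn [x [y xy fxy]]; rewrite (vand_prodE gf) -det_tr.
apply: (determinant_alternate xy) => i; rewrite !mxE fxy.
by [].
Qed.

(** Each self-map of the index set is coded by exactly one s. The Vandermonde product of its values
    is 0 if the map is not injective, and otherwise the sign times the product for the identity. *)
Lemma leibniz_vand n (u : nat -> nat -> int) :
  \sum_(s < n.+1 ^ n.+1) (\prod_(x < n.+1) u x (digit n s x)) *
     vand_prod n.+1 (fun x => (digit n s x)%:Z) =
  \det (\matrix_(i < n.+1, j < n.+1) u i j) * vand_prod n.+1 (fun x => x%:Z).
Proof.
pose h (s : 'I_(n.+1 ^ n.+1)) : {ffun 'I_n.+1 -> 'I_n.+1} :=
  [ffun x : 'I_n.+1 => Ordinal (digit_lt n s x)].
have [g hg] : exists g, forall f, h (g f) = f.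
  apply: (@fin_all_exists _ (fun=> 'I_(n.+1 ^ n.+1)) (fun f c => h c = f)) => f.
  have gb j : ((if insub j is Some i then f i : nat else 0) < n.+1)%N.
    by case: insubP => // i _ _; apply: ltn_ord.
  have [c cb cE] := digits_surj n.+1 gb.
  exists (Ordinal cb); apply/ffunP => x; apply/val_inj; rewrite ffunE /= cE ?ltn_ord //.
  by rewrite valK.
have ginj : injective g by move=> f1 f2 e; rewrite -(hg f1) e hg.
have gbij : bijective g.
  by apply: inj_card_bij ginj _; rewrite card_ffun !card_ord.
have digE f (x : 'I_n.+1) : digit n (g f) x = f x.
  by have := congr1 (fun f' : {ffun 'I_n.+1 -> 'I_n.+1} => val (f' x)) (hg f); rewrite ffunE.
rewrite (reindex g) /=; last exact: onW_bij.
rewrite (bigID (fun f : {ffun 'I_n.+1 -> 'I_n.+1} => injectiveb f)) /= [X in _ + X]big1 ?addr0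
  => [|f nf]; last first.
  by rewrite (vand_prod_not_inj (f := f)) ?mulr0 // => i; rewrite digE.
rewrite (reindex_onto (fun s : 'S_n.+1 => pval s) (insubd (1%g : {perm 'I_n.+1}))) /=; last first.
  by move=> f fi; rewrite -[pval _]/(val _) insubdK.
rewrite /determinant mulr_suml; apply: eq_big => [s|s _].
  by rewrite -[pval s]/(val s) valKd eqxx andbT (valP s).
rewrite (vand_prod_perm (s := s)) => [|i]; last by rewrite digE pvalE.
rewrite mulrCA mulrA; congr (_ * _ * _); apply: eq_bigr => x _.
by rewrite mxE digE pvalE.
Qed.

Lemma nth_flatten_const (T S : Type) (x0 : T) (y0 : S) (g : S -> seq T) (s : seq S) q i j :
  (forall y, size (g y) = q) -> (i < size s)%N -> (j < q)%N ->
  nth x0 (flatten [seq g y | y <- s]) (i * q + j) = nth x0 (g (nth y0 s i)) j.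
Proof.
move=> sg; elim: s i => // y s IH [|i] /= Hi Hj; rewrite nth_cat sg.
  by rewrite mul0n add0n Hj.
by rewrite mulSn -addnA ltnNge leq_addr /= addKn IH.
Qed.

Lemma size_flatten_const (T S : Type) (g : S -> seq T) (s : seq S) q :
  (forall y, size (g y) = q) -> size (flatten [seq g y | y <- s]) = (size s * q)%N.
Proof.
by move=> sg; elim: s => //= y s IH; rewrite size_cat sg IH mulSn.
Qed.

Lemma nth_enum_pairs (T : Type) (x0 : T) p q (F : 'I_p -> 'I_q -> T) (i : 'I_p) (j : 'I_q) :
  nth x0 [seq F i j | i <- enum 'I_p, j <- enum 'I_q] (i * q + j) = F i j.
Proof.
rewrite (@nth_flatten_const _ _ _ i _ _ q) ?size_enum_ord // => [|y]; last first.
  by rewrite size_map size_enum_ord.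
by rewrite (nth_map j) ?size_enum_ord // !nth_ord_enum.
Qed.

Lemma size_enum_pairs (T : Type) p q (F : 'I_p -> 'I_q -> T) :
  size [seq F i j | i <- enum 'I_p, j <- enum 'I_q] = (p * q)%N.
Proof. by rewrite size_allpairs !size_enum_ord. Qed.

Lemma mx_wordE p q (M : 'M[rat]_(p, q)) :
  mx_word M = flatten [seq rat_word x | x <- [seq M i j | i <- enum 'I_p, j <- enum 'I_q]].
Proof. by rewrite map_allpairs. Qed.

Lemma size_mx_word p q (M : 'M[rat]_(p, q)) : size (mx_word M) = (2 * (p * q))%N.
Proof. by rewrite mx_wordE (@size_flatten_const _ _ _ _ 2) // size_enum_pairs mulnC. Qed.

Lemma nth_mx_word p q (M : 'M[rat]_(p, q)) (i : 'I_p) (j : 'I_q) t : (t < 2)%N ->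
  nth 0%N (mx_word M) (2 * (i * q + j) + t) = nth 0%N (rat_word (M i j)) t.
Proof.
move=> t2; rewrite mx_wordE mulnC (@nth_flatten_const _ _ _ 0 _ _ 2) //.
  by rewrite nth_enum_pairs.
by rewrite size_enum_pairs; have := ltn_ord i; have := ltn_ord j; nia.
Qed.

Lemma size_code s : (size s <= CodeSeq.code s)%N.
Proof.
elim: s => //= n s IH; apply: (@leq_trans (1 * (CodeSeq.code s).*2.+1)); first by lia.
by rewrite leq_mul2r expn_gt0 orbT.
Qed.

Lemma nth_lt_code s i : (i < size s)%N -> (nth 0%N s i < CodeSeq.code s)%N.
Proof. by move=> Hi; apply: (allP (CodeSeq.ltn_code s)); apply: mem_nth. Qed.

Lemma absz_int_code z : (`|z| <= int_code z)%N.
Proof. by case: z => k /=; lia. Qed.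

Section Input.
Variables (N : nat) (le : rel 'I_N) (n : 'I_N -> nat).
Variables (A B : 'M[rat]_(\sum_i n i)).

Let nt := (\sum_i n i)%N.
Let w := CodeSeq.code (input_word le A B).

Lemma size_input_word : size (input_word le A B) = (1 + N * N + N + 4 * (nt * nt))%N.
Proof.
rewrite /input_word /= !size_cat size_enum_pairs size_map size_enum_ord !size_mx_word.
by rewrite -/nt; lia.
Qed.

Let nth_w j : (j < 1 + N * N + N + 4 * (nt * nt))%N -> ent w j = nth 0%N (input_word le A B) j.
Proof. by move=> Hj; rewrite /w ent_code // size_input_word. Qed.

Lemma pN_input : pN w = N.
Proof. by rewrite /pN nth_w //; lia. Qed.

Lemma ple_input (i j : 'I_N) : ple w i j = le i j.
Proof.
have Hij : (i * N + j < N * N)%N by have := ltn_ord i; have := ltn_ord j; nia.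
rewrite /ple pN_input -addnA nth_w; last by lia.
by rewrite add1n /= nth_cat size_enum_pairs Hij nth_enum_pairs.
Qed.

Lemma pn_input (i : 'I_N) : pn w i = n i.
Proof.
have Hi := ltn_ord i.
rewrite /pn pN_input -addnA nth_w; last by lia.
rewrite add1n /= nth_cat size_enum_pairs ltnNge leq_addr /= addKn nth_cat.
by rewrite size_map size_enum_ord Hi (nth_map i) ?size_enum_ord // nth_ord_enum.
Qed.

Lemma poff_input (i : 'I_N) : poff w i = (\sum_(k < N | k < i) n k)%N.
Proof.
rewrite /poff (big_ord_widen N (pn w)) ?(ltnW (ltn_ord i)) //.
by apply: eq_bigr => k _; rewrite pn_input.
Qed.

Lemma ptot_input : ptot w = nt.
Proof. by rewrite /ptot /poff pN_input; apply: eq_bigr => k _; rewrite pn_input. Qed.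

Lemma Rank_input (i : 'I_N) (x : 'I_(n i)) : (tagnat.Rank i x : nat) = (poff w i + x)%N.
Proof. by rewrite tagnat.RankEsum poff_input. Qed.

Lemma pfact_input : pfact w = w`!.
Proof.
rewrite /pfact; elim: (w) => [|k IH]; first by rewrite big_ord0.
by rewrite big_ord_recr /= IH factS mulnC.
Qed.

Lemma scaled_input (M : 'M[rat]_nt) o (i j : 'I_nt) :
  (forall t, (t < 2)%N -> ent w (pcell w o i j + t) = nth 0%N (rat_word (M i j)) t) ->
  (0 < `|denq (M i j)| < w)%N ->
  pscaled w o i j = (numq (M i j) * ((w`! %/ `|denq (M i j)|)%N)%:Z).
Proof.
move=> Hent den; have := Hent 0%N isT; have := Hent 1%N isT; rewrite addn0 addn1 => e1 e0.
by rewrite /pscaled e0 e1 /= zdecodeK pfact_input prednK //; case/andP: den.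
Qed.

Lemma scaled_rat (x : rat) : (`|denq x| < w)%N ->
  (numq x * ((w`! %/ `|denq x|)%N)%:Z)%:~R = (w`!)%:R * x :> rat.
Proof.
move=> den.
have d0 : (0 < `|denq x|)%N by rewrite absz_gt0 denq_neq0.
have dv : (`|denq x| %| w`!)%N by apply: dvdn_fact; rewrite d0 ltnW.
rewrite -{3}[x]divq_num_den -{2}(divnK dv) intrM natrM.
have dE : (denq x)%:~R = (`|denq x|%N)%:R :> rat.
  by rewrite -[in LHS](gez0_abs (denq_ge0 x)) pmulrn.
rewrite dE pmulrn; field; rewrite pnatr_eq0; lia.
Qed.
End Input.

Section Checker.
Variables (N : nat) (le : rel 'I_N) (n : 'I_N -> nat).
Variables (A B : 'M[rat]_(\sum_i n i)).

Let nt := (\sum_i n i)%N.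
Let w := CodeSeq.code (input_word le A B).

Lemma ent_entries j : (j < 4 * (nt * nt))%N ->
  ent w (1 + N * N + N + j) = nth 0%N (mx_word A ++ mx_word B) j.
Proof.
move=> Hj; rewrite /w ent_code; last by rewrite size_input_word -/nt; lia.
rewrite -!addnA add1n /= nth_cat size_enum_pairs ltnNge leq_addr /= addKn.
by rewrite nth_cat size_map size_enum_ord ltnNge leq_addr /= addKn.
Qed.

(** A denominator occurring in the input word is less than the Goedel number w, so it divides the
    factorial of w. *)
Definition scaled_mx (M : 'M[rat]_nt) : 'M[int]_nt :=
  \matrix_(i, j) (numq (M i j) * ((w`! %/ `|denq (M i j)|)%N)%:Z).

Let cell_lt (i j : 'I_nt) : (i * nt + j < nt * nt)%N.
Proof. by have := ltn_ord i; have := ltn_ord j; nia. Qed.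

Let ent_A (i j : 'I_nt) t : (t < 2)%N ->
  ent w (pcell w 0 i j + t) = nth 0%N (rat_word (A i j)) t.
Proof.
move=> Ht; have Hc := cell_lt i j.
rewrite /pcell (pN_input le A B) (ptot_input le A B) -/nt add0n -addnA ent_entries; last by lia.
by rewrite nth_cat size_mx_word -/nt ifT; [rewrite nth_mx_word|lia].
Qed.

Let ent_B (i j : 'I_nt) t : (t < 2)%N ->
  ent w (pcell w (nt * nt) i j + t) = nth 0%N (rat_word (B i j)) t.
Proof.
move=> Ht; have Hc := cell_lt i j.
rewrite /pcell (pN_input le A B) (ptot_input le A B) -/nt -addnA ent_entries; last by lia.
rewrite nth_cat size_mx_word -/nt ifF; last by lia.
rewrite (_ : (_ - _)%N = (2 * (i * nt + j) + t)%N); last by lia.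
by rewrite nth_mx_word.
Qed.

Let entries_bound M o (i j : 'I_nt) : (o + nt * nt <= 2 * (nt * nt))%N ->
  (forall t, (t < 2)%N -> ent w (pcell w o i j + t) = nth 0%N (rat_word (M i j)) t) ->
  (`|numq (M i j)| < w)%N /\ (`|denq (M i j)| < w)%N.
Proof.
move=> Ho Hent; have Hc := cell_lt i j.
have lt t : (t < 2)%N -> (ent w (pcell w o i j + t) < w)%N.
  move=> Ht; have H : (pcell w o i j + t < size (input_word le A B))%N.
    by rewrite /pcell (pN_input le A B) (ptot_input le A B) size_input_word -/nt; lia.
  by rewrite /w ent_code //; apply: nth_lt_code.
split; last by rewrite -[X in (X < _)%N]/(nth 0%N (rat_word (M i j)) 1) -Hent // lt.
apply: leq_ltn_trans (absz_int_code _) _.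
by rewrite -[X in (X < _)%N]/(nth 0%N (rat_word (M i j)) 0) -Hent // lt.
Qed.

Lemma entries_boundA i j : (`|numq (A i j)| < w)%N /\ (`|denq (A i j)| < w)%N.
Proof. by apply: (@entries_bound A 0 i j) => [|t]; [lia|exact: ent_A]. Qed.

Lemma entries_boundB i j : (`|numq (B i j)| < w)%N /\ (`|denq (B i j)| < w)%N.
Proof. by apply: (@entries_bound B (nt * nt) i j) => [|t]; [lia|exact: ent_B]. Qed.

Lemma pscaledA (i j : 'I_nt) : pscaled w 0 i j = scaled_mx A i j.
Proof.
rewrite mxE; apply: scaled_input => [t|]; first exact: ent_A.
by rewrite absz_gt0 denq_neq0; case: (entries_boundA i j).
Qed.

Lemma pscaledB (i j : 'I_nt) : pscaled w (nt * nt) i j = scaled_mx B i j.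
Proof.
rewrite mxE; apply: scaled_input => [t|]; first exact: ent_B.
by rewrite absz_gt0 denq_neq0; case: (entries_boundB i j).
Qed.

Lemma scaled_mx_bound (M : 'M[rat]_nt) :
  (forall i j, (`|numq (M i j)| < w)%N) -> mxle (w * w`!) (scaled_mx M).
Proof.
move=> Hn i j; rewrite mxE abszM leq_mul ?(ltnW (Hn i j)) //.
exact: leq_div.
Qed.

Lemma scaled_mxE (M : 'M[rat]_nt) : (forall i j, (`|denq (M i j)| < w)%N) ->
  map_mx intr (scaled_mx M) = (w`!)%:R *: M.
Proof. by move=> Hd; apply/matrixP => i j; rewrite !mxE scaled_rat. Qed.

Section Candidates.
Variable be : nat -> nat.

Definition cand_mx c k : 'M[int]_nt := \matrix_(i, j) pcand be w c k i j.

Lemma cand_mx_surj (M : 'I_4 -> 'M[int]_nt) : (forall k, mxle (be w) (M k)) ->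
  exists2 c, (c < (2 * be w).+1 ^ (4 * (nt * nt)))%N &
    forall k : 'I_4, cand_mx c k = M k.
Proof.
move=> Mb; pose F (k : 'I_4) (i j : 'I_nt) := absz (M k i j + (be w)%:Z).
pose s := flatten [seq [seq F k i j | i <- enum 'I_nt, j <- enum 'I_nt] | k <- enum 'I_4].
have sb j : (nth 0%N s j < (2 * be w).+1)%N.
  have [Hj|Hj] := ltnP j (size s); last by rewrite nth_default.
  have /flattenP [t /mapP [k _ ->]] := mem_nth 0%N Hj.
  move=> /allpairsP [[i l] [_ _ ->]]; rewrite /F /=.
  by have := Mb k i l; lia.
have [c cb Hc] := digits_surj (4 * (nt * nt)) sb.
exists c => // k; apply/matrixP => i j.
rewrite mxE /pcand (ptot_input le A B) -/nt -addnA Hc; last first.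
  by have := cell_lt i j; have := ltn_ord k; nia.
rewrite /s (@nth_flatten_const _ _ _ k _ _ (nt * nt)) ?size_enum_ord //.
- by rewrite nth_ord_enum nth_enum_pairs /F; have := Mb k i j; lia.
- by move=> k'; rewrite size_enum_pairs.
Qed.

Variable c : nat.

Lemma pinverseE k l : reflect (cand_mx c k *m cand_mx c l = 1%:M) (pinverse be w c k l).
Proof.
apply: (iffP idP) => [H|H].
  apply/matrixP => i j; rewrite !mxE.
  move/ballP: H => /(_ i); rewrite (ptot_input le A B) => /(_ (ltn_ord i)) /ballP.
  move=> /(_ j (ltn_ord j)) /eqP; rewrite -val_eqE /= natz => <-.
  by apply: eq_bigr => x _; rewrite !mxE.
apply/ballP => i; rewrite (ptot_input le A B) => Hi; apply/ballP => j Hj.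
apply/eqP; have := congr1 (fun M : 'M_nt => M (Ordinal Hi) (Ordinal Hj)) H.
rewrite !mxE -val_eqE /= natz => <-.
by apply: eq_bigr => x _; rewrite !mxE.
Qed.

Lemma pequationE :
  reflect (cand_mx c 0 *m scaled_mx A = scaled_mx B *m cand_mx c 1) (pequation be w c).
Proof.
have EL (i j : 'I_nt) : (cand_mx c 0 *m scaled_mx A) i j =
    \sum_(x < nt) pcand be w c 0 i x * pscaled w 0 x j.
  by rewrite mxE; apply: eq_bigr => x _; rewrite pscaledA !mxE.
have ER (i j : 'I_nt) : (scaled_mx B *m cand_mx c 1) i j =
    \sum_(x < nt) pscaled w (nt * nt) i x * pcand be w c 1 x j.
  by rewrite mxE; apply: eq_bigr => x _; rewrite pscaledB !mxE.
rewrite /pequation (ptot_input le A B) -/nt; apply: (iffP idP) => [H|H].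
  apply/matrixP => i j; rewrite EL ER; apply/eqP.
  by move/ballP: H => /(_ i (ltn_ord i)) /ballP /(_ j (ltn_ord j)).
apply/ballP => i Hi; apply/ballP => j Hj; apply/eqP.
have := congr1 (fun M : 'M_nt => M (Ordinal Hi) (Ordinal Hj)) H.
by rewrite EL ER.
Qed.

Let cand_Rank k (i j : 'I_N) (x : 'I_(n i)) (y : 'I_(n j)) :
  submxblock (cand_mx c k) i j x y = pcand be w c k (poff w i + x) (poff w j + y).
Proof. by rewrite !mxE !(Rank_input le A B). Qed.

Lemma ppatternE k : reflect (inMP le (cand_mx c k)) (ppattern be w c k).
Proof.
rewrite /ppattern (pN_input le A B); apply: (iffP idP) => [H i j Mij|H].
  apply: contraT => nle; case: Mij; apply/matrixP => x y; rewrite cand_Rank mxE; apply/eqP.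
  move/ballP: H => /(_ i (ltn_ord i)) /ballP /(_ j (ltn_ord j)).
  rewrite /pblock_ok (ple_input le A B) (negbTE nle) /= !(pn_input le A B).
  by move=> /ballP /(_ x (ltn_ord x)) /ballP; apply.
apply/ballP => i Hi; apply/ballP => j Hj; apply/implyP.
rewrite (ple_input le A B (Ordinal Hi) (Ordinal Hj)) eqb0 => nle.
rewrite (pn_input le A B (Ordinal Hi)) (pn_input le A B (Ordinal Hj)).
apply/ballP => x Hx; apply/ballP => y Hy; apply/eqP.
have := @cand_Rank k (Ordinal Hi) (Ordinal Hj) (Ordinal Hx) (Ordinal Hy) => /= <-.
have /eqP -> : submxblock (cand_mx c k) (Ordinal Hi) (Ordinal Hj) == 0.
  by apply: contraNT nle => /eqP; apply: H.
by rewrite mxE.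
Qed.

(** The Vandermonde product of the identity is nonzero and cancels. For positive n i, digits with
    parameter [(n i).-1] are digits in base n i. *)
Lemma pdet1E k : (forall i, (0 < n i)%N) ->
  reflect (forall i, \det (submxblock (cand_mx c k) i i) = 1) (pdet1 be w c k).
Proof.
move=> n_gt0.
have E (i : 'I_N) : pleibniz be w c k i =
    \det (submxblock (cand_mx c k) i i) * pvand1 (n i).
  rewrite /pleibniz (pn_input le A B).
  have := n_gt0 i; have := cand_Rank k (i := i) (j := i); move: (submxblock _ _ _).
  case: (n i) => // m M HM _.
  have -> : M = \matrix_(x < m.+1, y < m.+1) pcand be w c k (poff w i + x) (poff w i + y).
    by apply/matrixP => x y; rewrite mxE HM.
  have := leibniz_vand m (fun x y => pcand be w c k (poff w i + x)%N (poff w i + y)%N).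
  exact.

have V0 (i : 'I_N) : pvand1 (n i) != 0 by exact: vand_prod1_neq0.
rewrite /pdet1 (pN_input le A B); apply: (iffP idP) => [H i|H].
  move/ballP: H => /(_ i (ltn_ord i)); rewrite E (pn_input le A B) => /eqP H.
  by apply: (mulIf (V0 i)); rewrite H mul1r.
apply/ballP => i Hi; have := E (Ordinal Hi); rewrite H mul1r /= => ->.
by rewrite (pn_input le A B (Ordinal Hi)).
Qed.
End Candidates.
End Checker.

(** The image of g is convex for r, so in the product of two patterned matrices only indices of the
    image contribute to entries with both ends there; hence restriction is multiplicative. *)
Lemma is_det_minor m q (r : rel 'I_m) (g : 'I_q -> 'I_m) :
  reflexive r -> transitive r -> injective g ->
  (forall a b c, r (g a) c -> r c (g b) -> exists d, c = g d) ->
  is_det r (fun x => \det (mxsub g g x)).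
Proof.
move=> r_refl r_trans g_inj g_conv.
have subM x y : patterned r x -> patterned r y ->
    mxsub g g (x *m y) = mxsub g g x *m mxsub g g y.
  move=> px py; apply/matrixP => a b; rewrite !mxE.
  rewrite (bigID (mem (g @: [set: 'I_q]))) /= [X in _ + X]big1 ?addr0 => [|c nc].
    rewrite big_imset /=; last by move=> ? ? _ _; apply: g_inj.
    by apply: eq_big => [d|d _]; rewrite ?inE // !mxE.
  have [rac|/px ->] := boolP (r (g a) c); last by rewrite mul0r.
  have [rcb|/py ->] := boolP (r c (g b)); last by rewrite mulr0.
  by have [d dc] := g_conv _ _ _ rac rcb; rewrite dc imset_f in nc.
have sub1 : mxsub g g 1%:M = 1%:M :> 'M[int]_q.
  by apply/matrixP => a b; rewrite !mxE (inj_eq g_inj).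
split=> [x y px py|x px [k xk]]; first by rewrite subM // det_mulmx.
apply: det_unipotent; exists k.
have hz : mxhom r 0 0 (x - 1).
  by apply: mxhomB (mxhom1 r_refl 0); split=> //; rewrite mulmx0 mul0mx.
have -> : mxsub g g x - 1 = mxsub g g (x - 1).
  by rewrite -[1 in LHS]sub1; apply/matrixP => a b; rewrite !mxE.
have E l : mxsub g g (x - 1) ^+ l = mxsub g g ((x - 1) ^+ l).
  elim: l => [|l IH]; first by rewrite !expr0 sub1.
  rewrite !exprS IH; symmetry; apply: subM; first by case: hz.
  by case: (mxhomX r_refl r_trans l hz).
by rewrite E xk; apply/matrixP => a b; rewrite !mxE.
Qed.


(** * A pair (U, W) as one block diagonal matrix of double size *)

Section Double.
Variables (m : nat) (r : rel 'I_m).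
Hypotheses (r_refl : reflexive r) (r_trans : transitive r).

Definition double_rel : rel 'I_(m + m) := fun a b =>
  match split a, split b with
  | inl a', inl b' | inr a', inr b' => r a' b'
  | _, _ => false
  end.

Definition half_ord (b : bool) : 'I_m -> 'I_(m + m) := if b then @lshift m m else @rshift m m.

Lemma split_half b a : split (half_ord b a) = if b then inl a else inr a.
Proof. by case: b; [exact: (unsplitK (inl a))|exact: (unsplitK (inr a))]. Qed.

Lemma half_ord_inj b : injective (half_ord b).
Proof. by case: b; [exact: lshift_inj|exact: rshift_inj]. Qed.

Lemma double_relE b b' a a' : double_rel (half_ord b a) (half_ord b' a') = (b == b') && r a a'.
Proof. by rewrite /double_rel !split_half; case: b; case: b'. Qed.

Lemma half_ordP a : exists b a', a = half_ord b a'.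
Proof. by case: (split_ordP a) => a' ->; [exists true, a'|exists false, a']. Qed.

Lemma double_refl : reflexive double_rel.
Proof. by move=> a; have [b [a' ->]] := half_ordP a; rewrite double_relE eqxx r_refl. Qed.

Lemma double_trans : transitive double_rel.
Proof.
move=> a1 a2 a3; have [b1 [c1 ->]] := half_ordP a1; have [b2 [c2 ->]] := half_ordP a2.
have [b3 [c3 ->]] := half_ordP a3; rewrite !double_relE.
by move=> /andP [/eqP -> r1] /andP [/eqP -> r2]; rewrite eqxx (r_trans r1 r2).
Qed.

Lemma patterned_double (X Y : 'M[int]_m) : patterned r X -> patterned r Y ->
  patterned double_rel (block_mx X 0 0 Y).
Proof.
move=> pX pY a a'; have [b [c ->]] := half_ordP a; have [b' [c' ->]] := half_ordP a'.
rewrite double_relE; case: b; case: b' => /= rc;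
  rewrite ?block_mxEul ?block_mxEur ?block_mxEdl ?block_mxEdr ?mxE //.
  exact: pX.
exact: pY.
Qed.

Lemma double_patterned (Z : 'M[int]_(m + m)) : patterned double_rel Z ->
  exists X Y, [/\ Z = block_mx X 0 0 Y, patterned r X & patterned r Y].
Proof.
move=> pZ; exists (ulsubmx Z), (drsubmx Z); split.
- rewrite -[LHS]submxK; congr (block_mx _ _ _ _); apply/matrixP => i j; rewrite !mxE; apply: pZ.
    by rewrite (double_relE true false).
  by rewrite (double_relE false true).
- by move=> i j rij; rewrite !mxE; apply: pZ; rewrite (double_relE true true).
- by move=> i j rij; rewrite !mxE; apply: pZ; rewrite (double_relE false false).
Qed.

(** The matrix diag(U, V) intertwines the matrices with A and B in the upper right corner exactly
    when U A = B V. Every minor is taken in either half, hence the index set [bool * K]. *)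
Lemma bounded_two_sided s (A B U V U' V' : 'M[int]_m) (K : finType) (q : K -> nat)
    (g : forall k, 'I_(q k) -> 'I_m) :
  (1 < s)%N -> ((m + m) * (m + m) <= s)%N -> (2 * #|K| <= s)%N -> mxle s A -> mxle s B ->
  (forall k, injective (@g k)) ->
  (forall k a b c, r (g k a) c -> r c (g k b) -> exists d, c = g k d) ->
  patterned r U -> patterned r V -> patterned r U' -> patterned r V' ->
  U *m A = B *m V -> U' *m U = 1%:M -> V' *m V = 1%:M ->
  exists U1 V1 U1' V1', [/\ [/\ patterned r U1, patterned r V1, patterned r U1' & patterned r V1'],
    U1 *m A = B *m V1, U1' *m U1 = 1%:M /\ V1' *m V1 = 1%:M,
    [/\ mxle (equiv_grow s) U1, mxle (equiv_grow s) V1, mxle (equiv_grow s) U1' &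
        mxle (equiv_grow s) V1'] &
    forall k, \det (mxsub (g k) (g k) U1) = \det (mxsub (g k) (g k) U) /\
              \det (mxsub (g k) (g k) V1) = \det (mxsub (g k) (g k) V)].
Proof.
move=> s1 ms Ks mA mB g_inj g_conv pU pV pU' pV' UA U'U V'V.
pose AA : 'M[int]_(m + m) := block_mx 0 A 0 0; pose BB : 'M[int]_(m + m) := block_mx 0 B 0 0.
pose h (bk : bool * K) : 'I_(q bk.2) -> 'I_(m + m) := half_ord bk.1 \o @g bk.2.
pose f bk (X : 'M[int]_(m + m)) := \det (mxsub (h bk) (h bk) X).
have fE b k (X Y : 'M[int]_m) : f (b, k) (block_mx X 0 0 Y) =
    \det (mxsub (g k) (g k) (if b then X else Y)).
  congr (\det _); apply/matrixP => i j; rewrite [LHS]mxE [RHS]mxE /h /=.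
  by move: i j => /= i j; case: b; rewrite /= ?block_mxEul ?block_mxEdr.
have fdet bk : is_det double_rel (f bk).
  apply: is_det_minor; [exact: double_refl|exact: double_trans| |].
    by apply: inj_comp; [exact: half_ord_inj|exact: g_inj].
  move=> a b c; rewrite /h /=; have [b' [c' ->]] := half_ordP c; rewrite !double_relE.
  move=> /andP [/eqP <- r1] /andP [_ r2].
  by have [d ->] := g_conv _ _ _ _ r1 r2; exists d.
have m0 p1 p2 : mxle s (0 : 'M[int]_(p1, p2)) by move=> i j; rewrite mxE.
have hX : mxhom double_rel AA BB (block_mx U 0 0 V).
  split; first exact: patterned_double.
  by rewrite !mulmx_block !(mulmx0, mul0mx, addr0, add0r) UA.
have UU' : U *m U' = 1%:M by apply: mulmx1C.
have VV' : V *m V' = 1%:M by apply: mulmx1C.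
have U'B : U' *m B = A *m V'.
  by rewrite -[LHS]mulmx1 -VV' mulmxA -(mulmxA U') -UA !mulmxA U'U mul1mx.
have hY : mxhom double_rel BB AA (block_mx U' 0 0 V').
  split; first exact: patterned_double.
  by rewrite !mulmx_block !(mulmx0, mul0mx, addr0, add0r) U'B.
have YX : block_mx U' 0 0 V' *m block_mx U 0 0 V = 1%:M.
  by rewrite mulmx_block !(mulmx0, mul0mx, addr0, add0r) U'U V'V -scalar_mx_block.
have mAA : mxle s AA by apply/mxle_block.
have mBB : mxle s BB by apply/mxle_block.
have Ks' : (#|{: bool * K}| <= s)%N by rewrite card_prod card_bool.
have [X1 [Y1 [hX1 hY1 YX1 [mX1 mY1] fX1]]] :=
  bounded_equivalence double_refl double_trans s1 ms Ks' mAA mBB fdet hX hY YX.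
have [pX1 eX1] := hX1; have [pY1 _] := hY1.
have [U1 [V1 [EX1 pU1 pV1]]] := double_patterned pX1.
have [U1' [V1' [EY1 pU1' pV1']]] := double_patterned pY1.
subst X1 Y1; exists U1, V1, U1', V1'.
move: eX1 YX1; rewrite !mulmx_block !(mulmx0, mul0mx, addr0, add0r) scalar_mx_block.
move=> /eq_block_mx [_ E _ _] /eq_block_mx [E1 _ _ E2].
have /mxle_block [? _ _ ?] := mX1; have /mxle_block [? _ _ ?] := mY1.
split=> // k; have := fX1 (true, k); have := fX1 (false, k).
by rewrite !fE.
Qed.
End Double.

(** Dominates the squared double size, twice the number of blocks, and the entries after scaling,
    which are at most w times the factorial of w. *)
Definition word_bound (w : nat) : nat := (4 * w + w.+1 ^ w * w + 2)%N.
Definition search_bound (w : nat) : nat := equiv_grow (word_bound w).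

Lemma good_search_bound : good search_bound.
Proof.
apply: (good_comp good_equiv_grow); apply/good_addr/good_add.
  exact: good_mulc good_id.
by apply: good_mul good_id; apply: good_exp; exact: good_id.
Qed.

Lemma fact_le_exp w : (w`! <= w.+1 ^ w)%N.
Proof.
suff H k : (k <= w -> k`! <= w.+1 ^ k)%N by apply: H.
elim: k => // k IH kw; rewrite factS expnS leq_mul ?IH ?(ltnW kw) //.
by rewrite ltnW.
Qed.

Section Correctness.
Variables (N : nat) (le : rel 'I_N) (n : 'I_N -> nat).
Hypotheses (Hle : labelled_poset le) (n_gt0 : forall i, (0 < n i)%N).

Let nt := (\sum_i n i)%N.

Definition index_rel : rel 'I_nt := fun a b => le (tagnat.sig1 a) (tagnat.sig1 b).

Lemma inMP_patterned (M : 'M[int]_nt) : inMP le M <-> patterned index_rel M.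
Proof.
split=> [HM a b|HM i j].
  rewrite /index_rel => nle; rewrite -[a]tagnat.sig2K -[b]tagnat.sig2K.
  have /eqP : submxblock M (tagnat.sig1 a) (tagnat.sig1 b) == 0.
    by apply: contraNT nle => /eqP; apply: HM.
  by move=> /(congr1 (fun X : 'M_(_, _) => X (tagnat.sig2 a) (tagnat.sig2 b))); rewrite !mxE.
move=> M0; apply: contraT => nle; case: M0; apply/matrixP => x y; rewrite !mxE.
by apply: HM; rewrite /index_rel !tagnat.Rank1K.
Qed.

Lemma index_refl : reflexive index_rel.
Proof. by case: Hle => r _ _ _ a; apply: r. Qed.

Lemma index_trans : transitive index_rel.
Proof. by case: Hle => _ _ t _ a b c; apply: t. Qed.

Let gR (i : 'I_N) : 'I_(n i) -> 'I_nt := @tagnat.Rank N n i.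

Lemma Rank_inj i : injective (@gR i).
Proof. exact: inc_inj (@tagnat.le_Rank N n i). Qed.

(** The block of c lies both above and below i, so it is i by antisymmetry. *)
Lemma Rank_convex i a b c : index_rel (@gR i a) c -> index_rel c (@gR i b) ->
  exists d, c = @gR i d.
Proof.
rewrite /index_rel !tagnat.Rank1K; case: Hle => _ anti _ _ r1 r2.
have ic : i = tagnat.sig1 c by apply: anti; rewrite r1 r2.
by move: a b r1 r2; rewrite ic => _ _ _ _; exists (tagnat.sig2 c); rewrite /gR tagnat.sig2K.
Qed.

Lemma is_det_block i : is_det index_rel (fun M => \det (submxblock M i i)).
Proof.
apply: is_det_minor; [exact: index_refl|exact: index_trans|exact: Rank_inj|exact: Rank_convex].
Qed.

Lemma det_block_inverse i (M M' : 'M[int]_nt) : inMP le M -> inMP le M' -> M' *m M = 1%:M ->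
  \det (submxblock M i i) = 1 -> \det (submxblock M' i i) = 1.
Proof.
move=> /inMP_patterned pM /inMP_patterned pM' MM' dM.
have [fM f1] := is_det_block i; have := fM _ _ pM' pM; rewrite MM' dM mulr1 => <-.
apply: f1; last exact: unipotent1.
by have [p _] := mxhom1 index_refl 0.
Qed.

Definition arith_group (sl : bool) : 'M[rat]_nt -> Prop := if sl then SLPZ le n else GLPZ le n.

Lemma arith_groupP sl M : arith_group sl M <-> exists M0 M0' : 'M[int]_nt,
  [/\ M = mx_of_int M0, inMP le M0, inMP le M0', M0' *m M0 = 1%:M &
      sl -> forall i, \det (submxblock M0 i i) = 1].
Proof.
rewrite /arith_group; split.
  case: sl => [[M0 [[pM0 [M0' [pM0' _ inv]]] d] ->]|[M0 [pM0 [M0' [pM0' _ inv]]] ->]];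
  by exists M0, M0'; split.
move=> [M0 [M0' [-> pM0 pM0' inv d]]].
have HG : inGLP le M0 by split=> //; exists M0'; split=> //; apply: mulmx1C.
by case: sl d => d; exists M0 => //; split=> //; apply: d.
Qed.

Variables (A B : 'M[rat]_nt) (sl : bool).
Let w := CodeSeq.code (input_word le A B).

Let denA i j := (entries_boundA le A B i j).2.
Let denB i j := (entries_boundB le A B i j).2.

Let fact_neq0 : (w`!)%:R != 0 :> rat.
Proof. by rewrite pnatr_eq0 -lt0n fact_gt0. Qed.

Lemma scaled_equation (U W : 'M[int]_nt) :
  U *m scaled_mx le A B A = scaled_mx le A B B *m W <->
  mx_of_int U *m A = B *m mx_of_int W.
Proof.
have E : map_mx intr (U *m scaled_mx le A B A) = (w`!)%:R *: (mx_of_int U *m A).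
  by rewrite map_mxM scaled_mxE // -scalemxAr.
have E' : map_mx intr (scaled_mx le A B B *m W) = (w`!)%:R *: (B *m mx_of_int W).
  by rewrite map_mxM scaled_mxE // -scalemxAl.
split=> H.
  by apply: (scalerI fact_neq0); rewrite -E -E' H.
apply/matrixP => i j; apply: (@intr_inj rat).
have := congr1 (fun X : 'M[rat]_nt => X i j) (etrans E (etrans (congr1 _ H) (esym E'))).
by rewrite !mxE.
Qed.

Let mx_of_intM (X Y : 'M[int]_nt) : mx_of_int (X *m Y) = mx_of_int X *m mx_of_int Y.
Proof. exact: map_mxM. Qed.

Let mx_of_int1 : mx_of_int (1%:M : 'M[int]_nt) = 1%:M.
Proof. exact: map_mx1. Qed.

Lemma pcheck_sound be c : pcheck sl be w c -> mx_equivalent (arith_group sl) A B.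
Proof.
case/and5P => /pinverseE e02 /pinverseE e13 /and4P [/ppatternE p0 /ppatternE p1 /ppatternE p2
  /ppatternE p3] /pequationE /scaled_equation eq dets.
exists (mx_of_int (cand_mx le A B be c 0)), (mx_of_int (cand_mx le A B be c 3)).
have {}dets : sl -> (forall i, \det (submxblock (cand_mx le A B be c 0) i i) = 1) /\
    (forall i, \det (submxblock (cand_mx le A B be c 3) i i) = 1).
  move=> sl1; move: dets; rewrite sl1 => /andP [d0 d3]; split.
    exact/(@pdet1E _ le n A B be c 0 n_gt0).
  exact/(@pdet1E _ le n A B be c 3 n_gt0).
split.
- apply/arith_groupP; exists (cand_mx le A B be c 0), (cand_mx le A B be c 2).
  by split=> // [|/dets []//]; apply: mulmx1C.
- apply/arith_groupP; exists (cand_mx le A B be c 3), (cand_mx le A B be c 1).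
  by split=> // /dets [].
- by rewrite eq -mulmxA -mx_of_intM e13 mx_of_int1 mulmx1.
Qed.

Lemma pdecide_complete : mx_equivalent (arith_group sl) A B -> pdecide sl search_bound w.
Proof.
case=> _ [_ [/arith_groupP [U [U' [-> pU pU' UU dU]]]
  /arith_groupP [V' [V [-> pV' pV VV dV']]] EB]].
have VV' : V' *m V = 1%:M by apply: mulmx1C.
have eq : U *m scaled_mx le A B A = scaled_mx le A B B *m V.
  by apply/scaled_equation; rewrite -EB -!mulmxA -mx_of_intM VV' mx_of_int1 mulmx1.
have sw : (1 + N * N + N + 4 * (nt * nt) <= w)%N.
  by rewrite -(size_input_word le A B); apply: size_code.
have mle (M : 'M[int]_nt) : mxle (w * w`!) M -> mxle (word_bound w) M.
  move=> HM i j; apply: leq_trans (HM i j) _.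
  by have := leq_mul (fact_le_exp w) (leqnn w); rewrite /word_bound; lia.
have mA := mle _ (scaled_mx_bound (fun i j => (entries_boundA le A B i j).1)).
have mB := mle _ (scaled_mx_bound (fun i j => (entries_boundB le A B i j).1)).
have Ks : (2 * #|'I_N| <= word_bound w)%N by rewrite card_ord /word_bound; nia.
have ms : ((nt + nt) * (nt + nt) <= word_bound w)%N by rewrite /word_bound; nia.
have s1 : (1 < word_bound w)%N by rewrite /word_bound; lia.
move/inMP_patterned: (pU) => qU; move/inMP_patterned: (pV) => qV.
move/inMP_patterned: (pU') => qU'; move/inMP_patterned: (pV') => qV'.
have [U1 [V1 [U1' [V1' [[/inMP_patterned pU1 /inMP_patterned pV1 /inMP_patterned pU1'
  /inMP_patterned pV1'] eq1 [UU1 VV1] [bU1 bV1 bU1' bV1'] dets]]]]] :=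
  bounded_two_sided index_refl index_trans s1 ms Ks mA mB Rank_inj Rank_convex
    qU qV qU' qV' eq UU VV'.
pose M (k : 'I_4) := tnth [tuple U1; V1; U1'; V1'] k.
have Mb k : mxle (search_bound w) (M k).
  by rewrite /M; case: k => [[|[|[|[|k]]]] Hk].
have [c cb Hc] := cand_mx_surj Mb.
have H0 : cand_mx le A B search_bound c 0 = U1 := Hc (@Ordinal 4 0 isT).
have H1 : cand_mx le A B search_bound c 1 = V1 := Hc (@Ordinal 4 1 isT).
have H2 : cand_mx le A B search_bound c 2 = U1' := Hc (@Ordinal 4 2 isT).
have H3 : cand_mx le A B search_bound c 3 = V1' := Hc (@Ordinal 4 3 isT).
apply/bexP; exists c; first by rewrite (ptot_input le A B).
apply/and5P; split.
- by apply/pinverseE; rewrite H0 H2; apply: mulmx1C.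
- by apply/pinverseE; rewrite H1 H3; apply: mulmx1C.
- by apply/and4P; split; apply/ppatternE; rewrite ?H0 ?H1 ?H2 ?H3.
- by apply/pequationE; rewrite H0 H1.
apply/implyP => sl1; apply/andP; split.
  by apply/(@pdet1E _ le n A B search_bound c 0 n_gt0) => i; rewrite H0 (dets i).1 dU.
apply/(@pdet1E _ le n A B search_bound c 3 n_gt0) => i; rewrite H3.
(* Determinant 1 passes from V' to its inverse V, from V to V1, and from V1 to its inverse V1',
   which is candidate 3. *)
apply: (det_block_inverse pV1 pV1' VV1); rewrite (dets i).2.
by apply: (det_block_inverse pV' pV) (dV' sl1 i).
Qed.
End Correctness.

Lemma decision_algorithm (sl : bool) : exists f : recfun,
  forall (N : nat) (le : rel 'I_N) (n : 'I_N -> nat) (A B : 'M[rat]_(\sum_i n i)),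
    labelled_poset le -> (forall i, (0 < n i)%N) ->
    decides_at f (input_word le A B) (mx_equivalent (@arith_group N le n sl) A B).
Proof.
have [f Hf] := cf_pdecide (good_cf good_search_bound) sl.
exists f => N le n A B Hle n0; exists (pdecide sl search_bound (CodeSeq.code (input_word le A B))).
split; first exact: Hf.
split=> [/bexP [c _]|]; first exact: pcheck_sound.
exact: pdecide_complete.
Qed.

Theorem corollary2p3 :
  (exists f : recfun,
     forall (N : nat) (le : rel 'I_N) (n : 'I_N -> nat)
            (A B : 'M[rat]_(\sum_i n i)),
       labelled_poset le -> (forall i, (0 < n i)%N) ->
       inMP le A -> inMP le B ->
       decides_at f (input_word le A B) (mx_equivalent (GLPZ le n) A B))
  /\
  (exists f : recfun,
     forall (N : nat) (le : rel 'I_N) (n : 'I_N -> nat)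
            (A B : 'M[rat]_(\sum_i n i)),
       labelled_poset le -> (forall i, (0 < n i)%N) ->
       inMP le A -> inMP le B ->
       decides_at f (input_word le A B) (mx_equivalent (SLPZ le n) A B)).
Proof.
by split; [have [f Hf] := decision_algorithm false|have [f Hf] := decision_algorithm true];
  exists f => *; apply: Hf.
Qed.
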